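(* Let $p,q$ be coprime positive integers and let $\mathcal{V}_0=V_L\oplus V_{L-\gamma/p}$, $\mathcal{V}_0^o=V_L\oplus V_{L+\gamma/q}$ and $\mathcal{V}(p,q)=V_L\oplus V_{L-\gamma/p}\oplus V_{L+\gamma/q}$ be the vertex operator algebras described in the context, with screening operators $Q=\mathrm{Res}_xY_{\mathcal{V}(p,q)}(e^{\gamma/q},x)$ and $\tilde Q=\mathrm{Res}_xY_{\mathcal{V}(p,q)}(e^{-\gamma/p},x)$ (and their restrictions to $\mathcal{V}_0^o$ and $\mathcal{V}_0$, respectively). (a) If $(W,Y_W)$ is a strongly $\mathbb{C}$-graded generalized $\mathcal{V}_0$-module with the action $e^{2\pi\sqrt{-1}(Y_W)_0(e^{-\gamma/p})}$ of $e^{2\pi\sqrt{-1}\tilde Q}$, whose additional $\mathbb{C}$-grading is given by the generalized eigenspaces of $(Y_W)_0(e^{-\gamma/p})$, then $(W,Y_W^{(e^{-\gamma/p})})$ is a strongly $\mathbb{C}$-graded generalized $e^{2\pi\sqrt{-1}\tilde Q}$-twisted $\mathcal{V}_0$-module. (b) If $(W,Y_W)$ is a strongly $\mathbb{C}$-graded generalized $\mathcal{V}_0^o$-module with the action $e^{2\pi\sqrt{-1}(Y_W)_0(e^{\gamma/q})}$ of $e^{2\pi\sqrt{-1}Q}$, whose additional $\mathbb{C}$-grading is given by the generalized eigenspaces of $(Y_W)_0(e^{\gamma/q})$, then $(W,Y_W^{(e^{\gamma/q})})$ is a strongly $\mathbb{C}$-graded generalized $e^{2\pi\sqrt{-1}Q}$-twisted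 $\mathcal{V}_0^o$-module. (c) If $(W,Y_W)$ is a strongly $\mathbb{C}$-graded generalized $\mathcal{V}(p,q)$-module with the action $e^{2\pi\sqrt{-1}(Y_W)_0(e^{-\gamma/p})}$ of $e^{2\pi\sqrt{-1}\tilde Q}$ (respectively $e^{2\pi\sqrt{-1}(Y_W)_0(e^{\gamma/q})}$ of $e^{2\pi\sqrt{-1}Q}$), whose additional $\mathbb{C}$-grading is given by the generalized eigenspaces of $(Y_W)_0(e^{-\gamma/p})$ (respectively $(Y_W)_0(e^{\gamma/q})$), then $(W,Y_W^{(e^{-\gamma/p})})$ (respectively $(W,Y_W^{(e^{\gamma/q})})$) is a strongly $\mathbb{C}$-graded generalized $e^{2\pi\sqrt{-1}\tilde Q}$-twisted (respectively $e^{2\pi\sqrt{-1}Q}$-twisted) $\mathcal{V}(p,q)$-module. Here $W$ carries the $\mathbb{C}\times\mathbb{C}$-grading $W=\coprod_{n,\alpha}W_{[n]}^{[\alpha]}$ by joint generalized eigenspaces of $L_W^{(u)}(0)$ (eigenvalue $n$) and $(Y_W)_0(u)$ (eigenvalue $\alpha$), where $u=e^{-\gamma/p}$ or $u=e^{\gamma/q}$ accordingly.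
   Context: The algebras. $L=\mathbb{Z}\gamma$ is the even positive-definite lattice with $\langle\gamma,\gamma\rangle=2pq$, $\widetilde L$ is its dual lattice, $V_L$ is the lattice vertex algebra, $V_{\widetilde L}$ is the generalized vertex algebra associated to $\widetilde L$ (with the usual vertex operators $Y_{V_{\widetilde L}}$), and $V_{L+\lambda}\subset V_{\widetilde L}$ is the $V_L$-module associated to the coset $L+\lambda$. The conformal element used is $\omega=\frac{1}{4pq}\gamma(-1)^2\mathbf 1+\frac{p-q}{2pq}\gamma(-2)\mathbf 1$; with respect to it $e^{\gamma/q}$ and $e^{-\gamma/p}$ have weight $1$. The vertex operators of the extensions are, for $u_i\in V_L$, $v_i\in V_{L-\gamma/p}$, $w_i\in V_{L+\gamma/q}$, $$Y_{\mathcal{V}_0}(u_1+v_1,x)(u_2+v_2)=Y_{V_{\widetilde L}}(u_1+v_1,x)u_2+Y_{V_{\widetilde L}}(u_1,x)v_2,$$ $$Y_{\mathcal{V}_0^o}(u_1+w_1,x)(u_2+w_2)=Y_{V_{\widetilde L}}(u_1+w_1,x)u_2+Y_{V_{\widetilde L}}(u_1,x)w_2,$$ $$Y_{\mathcal{V}(p,q)}(u_1+v_1+w_1,x)(u_2+v_2+w_2)=Y_{V_{\widetilde L}}(u_1+v_1+w_1,x)u_2+Y_{V_{\widetilde L}}(u_1,x)(v_2+w_2).$$ $e^{2\pi\sqrt{-1}\tilde Q}$ is an automorphism of $\mathcal{V}_0$, $e^{2\pi\sqrt{-1}Q}$ of $\mathcal{V}_0^o$, and both are automorphisms of $\mathcal{V}(p,q)$.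 In what follows $V$ is one of these vertex operator algebras and $u\in V_{(1)}$ is $e^{-\gamma/p}$ or $e^{\gamma/q}$, as appropriate. Write $Y(v,x)=\sum_{n\in\mathbb{Z}}Y_n(v)x^{-n-1}$, $L(n)=Y_{n+1}(\omega)$; for a module, $Y_W(v,x)=\sum_n(Y_W)_n(v)x^{-n-1}$, $L_W(n)=(Y_W)_{n+1}(\omega)$. $W\{x\}$ is the space of formal series in arbitrary complex powers of $x$ with coefficients in $W$; $W\{x\}[\log x]$ is the space of polynomials in $\log x$ over it, with $\frac{d}{dx}\log x=x^{-1}$. The modified vertex operators. The additional $\mathbb{C}$-grading of $V$ is by generalized eigenspaces $V^{[\alpha]}$ of $Y_0(u)$. Let $(Y_0(u))_{ss}$ be the semisimple part of $Y_0(u)$, and $$\Delta_V^{(u)}(x)=x^{(Y_0(u))_{ss}}e^{(Y_0(u)-(Y_0(u))_{ss})\log x}\exp\Big(\sum_{n\ge1}\frac{(-1)^n}{-n}Y_n(u)x^{-n}\Big),$$ where $x^{(Y_0(u))_{ss}}$ acts as $x^\alpha$ on $V^{[\alpha]}$. Define $Y_W^{(u)}(v,x)w=Y_W(\Delta_V^{(u)}(x)v,x)w$ and $Y_W^{(u)}(\omega,x)=\sum_{n\in\mathbb{Z}}L_W^{(u)}(n)x^{-n-2}$. Strongly $\mathbb{C}$-graded vertex operator algebra: a vertex operator algebra with a second grading $V=\coprod_{\alpha\in\mathbb{C}}V^{[\alpha]}$ such that $V_{(n)}=\coprod_\alpha (V_{(n)}\cap V^{[\alpha]})$, $\mathbf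 1,\omega\in V^{[0]}$, and $Y_n(v)V^{[\beta]}\subset V^{[\alpha+\beta]}$ for $v\in V^{[\alpha]}$. It is compatible with an automorphism $g$ if each $v\in V^{[\alpha]}$ is a generalized eigenvector of $g$ with eigenvalue $e^{2\pi\sqrt{-1}\alpha}$. Strongly $\mathbb{C}$-graded generalized $V$-module: a vector space $W=\coprod_{n,\alpha\in\mathbb{C}}W_{\langle n\rangle}^{[\alpha]}$ with $Y_W:V\otimes W\to W((x))$ satisfying the identity property, the Jacobi identity and the $L(-1)$-derivative property, such that $W_{\langle n\rangle}=\coprod_\alpha W_{\langle n\rangle}^{[\alpha]}$ is the generalized eigenspace of $L_W(0)$ with eigenvalue $n$; $(Y_W)_m(v)W^{[\beta]}\subset W^{[\alpha+\beta]}$ for $v\in V^{[\alpha]}$, where $W^{[\beta]}=\coprod_nW_{\langle n\rangle}^{[\beta]}$; and for all $n,\alpha$, $\dim W_{\langle n\rangle}^{[\alpha]}<\infty$ and $W_{\langle n+l\rangle}^{[\alpha]}=0$ for all sufficiently negative integers $l$. The additional grading is given by the generalized eigenspaces of $(Y_W)_0(u)$ if $W^{[\alpha]}$ is the generalized eigenspace of $(Y_W)_0(u)$ with eigenvalue $\alpha$. Analytic branches. For $z\in\mathbb{C}^\times$ let $\log z=\log|z|+\sqrt{-1}\arg z$, $0\le\arg z<2\pi$, and $l_r(z)=\log z+2r\pi\sqrt{-1}$ for $r\in\mathbb{Z}$. Give $x$ degree $-1$ and $\log x$ degree $0$. For a grading-preserving linear map $X:W_1\otimes W_2\to W_3\{x\}[\log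 x]$ between $\mathbb{C}$-graded spaces, its $r$-th analytic branch is $X^r(w_1,z)w_2=X(w_1,x)w_2\big|_{x^n=e^{nl_r(z)},\,\log x=l_r(z)}\in\prod_{n\in\mathbb{C}}(W_3)_{(n)}$. Strongly $\mathbb{C}$-graded generalized $g$-twisted $V$-module (for $V$ strongly $\mathbb{C}$-graded compatibly with $g$): a $\mathbb{C}\times\mathbb{C}$-graded vector space $W=\coprod_{n,\alpha\in\mathbb{C}}W_{[n]}^{[\alpha]}$ with a linear map $Y^g:V\otimes W\to W\{x\}[\log x]$, preserving the first $\mathbb{C}$-grading (so that branches $Y^{g;r}$ are defined), and an action of $g$ on $W$, such that: 1. (Grading restriction) For all $n,\alpha$, $\dim W_{[n]}^{[\alpha]}<\infty$ and $W_{[n+l]}^{[\alpha]}=0$ for all sufficiently negative real numbers $l$. 2. (Equivariance) $Y^{g;r+1}(gv,z)w=Y^{g;r}(v,z)w$ for $r\in\mathbb{Z}$, $z\in\mathbb{C}^\times$, $v\in V$, $w\in W$. 3. (Identity) $Y^g(\mathbf 1,x)w=w$ for $w\in W$. 4. (Duality) Let $W'=\coprod_{n,\alpha}(W_{[n]}^{[\alpha]})^*$ and let $\pi_n$ be the projection onto the subspace of weight $n$ (of $W$, resp. $V$). For all $v_1,v_2\in V$, $w\in W$, $w'\in W'$ there exists a multivalued analytic function of the form $f(z_1,z_2)=\sum_{i,j,k,l=0}^Na_{ijkl}z_1^{m_i}z_2^{n_j}(\log z_1)^k(\log z_2)^l(z_1-z_2)^{-t}$ with $N\in\mathbb{N}$,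 $a_{ijkl},m_i,n_j\in\mathbb{C}$ and $t\in\mathbb{Z}_+$ such that for $r\in\mathbb{Z}$ the series $\sum_{n\in\mathbb{C}}\langle w',Y^{g;r}(v_1,z_1)\pi_nY^{g;r}(v_2,z_2)w\rangle$, $\sum_{n\in\mathbb{C}}\langle w',Y^{g;r}(v_2,z_2)\pi_nY^{g;r}(v_1,z_1)w\rangle$, $\sum_{n\in\mathbb{C}}\langle w',Y^{g;r}(\pi_nY(v_1,z_1-z_2)v_2,z_2)w\rangle$ are absolutely convergent in the regions $|z_1|>|z_2|>0$, $|z_2|>|z_1|>0$, $|z_2|>|z_1-z_2|>0$, respectively, to the branch $\sum_{i,j,k,l=0}^Na_{ijkl}e^{m_il_r(z_1)}e^{n_jl_r(z_2)}l_r(z_1)^kl_r(z_2)^l(z_1-z_2)^{-t}$ of $f(z_1,z_2)$. 5. ($L^g(0)$-grading) Writing $Y^g(\omega,x)=\sum_{n\in\mathbb{Z}}L^g(n)x^{-n-2}$, for each $w\in W_{[n]}^{[\alpha]}$ there is $K\in\mathbb{Z}_+$ with $(L^g(0)-n)^Kw=0$. 6. (Grading compatibility) $Y^g(v,x)w\in W^{[\alpha+\beta]}\{x\}[\log x]$ for $v\in V^{[\alpha]}$, $w\in W^{[\beta]}$. 7. ($L(-1)$-derivative) $\frac{d}{dx}Y^g(v,x)=Y^g(L(-1)v,x)$ for $v\in V$.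
   Formalization: Equivariance is read as Y^{g;r+1}(v,z)=Y^{g;r}(gv,z), since the printed form fails for W=V_0, v=γ(-1)1; in the third duality region log z_1 is the branch within π/2 in imaginary part of l_r(z_2), which is l_r(z_1) if |arg z_1−arg z_2|<π/2, since the printed form fails across the cut. *)

(* Defs.v *)
From HB Require Import structures.
From mathcomp Require Import all_boot all_order all_algebra.
From mathcomp Require Import finmap multiset complex.
From mathcomp Require Import boolp classical_sets functions cardinality fsbigop.
From mathcomp Require Import reals sequences exp trigo.
From mathcomp Require Import -(notations) monalg.

Set Implicit Arguments.
Unset Strict Implicit.
Unset Printing Implicit Defensive.

Import Order.TTheory GRing.Theory Num.Theory.

Local Open Scope classical_set_scope.
Local Open Scope ring_scope.

(* The complex numbers are R[i] with R : realType.
   Pitfall: [\sum_(i \in A) F i] is the finite-support sum of fsbigop, which is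
   0 when F has infinite support on A.  Below it only replaces sums that are
   finite for truncation or grading reasons. *)

Section ComplexFunctions.
Variable R : realType.
Implicit Types (x : R) (z a : R[i]).

Definition cexp z : R[i] :=
  Complex (expR (complex.Re z) * cos (complex.Im z))
          (expR (complex.Re z) * sin (complex.Im z)).

Definition cabs z : R := complex.Re `|z|.

Definition twopii : R[i] := Complex 0 (2%:R * pi).

(* the value in [0, 2 pi) for z != 0 *)
Definition arg z : R :=
  let t := acos (complex.Re z / cabs z) in
  if 0 <= complex.Im z then t else 2%:R * pi - t.

Definition lbranch (r : int) z : R[i] :=
  Complex (ln (cabs z)) (arg z) + r%:~R * twopii.

Definition gbinom (l : int) (i : nat) : R[i] :=
  (\prod_(j < i) (l%:~R - j%:R)) / (i`!)%:R.

Definition abs_cvg_to (a : R[i] -> R[i]) (s : R[i]) : Prop :=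
  (exists M : R, forall F : {fset R[i]}, \sum_(n <- F) cabs (a n) <= M) /\
  (forall e : R, 0 < e -> exists F0 : {fset R[i]}, forall F : {fset R[i]},
     (F0 `<=` F)%fset -> cabs (\sum_(n <- F) a n - s) < e).

End ComplexFunctions.

Section LinearAlgebra.
Variables (R : realType) (W : lmodType R[i]).

Definition subspace (S : set W) : Prop :=
  S 0 /\ forall (a : R[i]) x y, S x -> S y -> S (a *: x + y).

Definition findim (S : set W) : Prop :=
  exists (d : nat) (b : 'I_d -> W), forall w, S w ->
    exists c : 'I_d -> R[i], w = \sum_(i < d) c i *: b i.

Section Family.
Variables (I : choiceType) (S : I -> set W).

Definition decomp (w : W) (c : I -> W) : Prop :=
  [/\ finite_set [set i | c i != 0], forall i, S i (c i)
    & \sum_(i \in [set: I]) c i = w].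

Definition ssum : set W := [set w | exists c, decomp w c].

(* W is the (internal) direct sum of the S i *)
Definition is_grading : Prop :=
  (forall i, subspace (S i)) /\ (forall w, exists! c, decomp w c).

Definition proj (i : I) (w : W) : W :=
  xget 0 [set y | exists2 c, decomp w c & y = c i].

End Family.

Definition geneig (A : W -> W) (a : R[i]) : set W :=
  [set w | exists K : nat, iter K (fun x => A x - a *: x) w = 0].

Definition sspart (A : W -> W) (w : W) : W :=
  \sum_(a \in [set: R[i]]) a *: proj (geneig A) a w.

Definition nilpart (A : W -> W) (w : W) : W := A w - sspart A w.

(* e^{2 pi i A} = e^{2 pi i A_ss} e^{2 pi i (A - A_ss)} *)
Definition exp2pii (A : W -> W) (w : W) : W :=
  \sum_(a \in [set: R[i]]) cexp (twopii R * a) *: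
    \sum_(k \in [set: nat])
      (twopii R ^+ k / (k`!)%:R) *: iter k (nilpart A) (proj (geneig A) a w).

(* coefficient of t^r in (\sum_(n >= 1) A_n t^n)^k *)
Fixpoint powcoef (A : nat -> W -> W) (k r : nat) (w : W) : W :=
  match k with
  | 0 => if r == 0%N then w else 0
  | k'.+1 => \sum_(1 <= n < r.+1) A n (powcoef A k' (r - n) w)
  end.

(* coefficient of t^r in exp (\sum_(n >= 1) A_n t^n) *)
Definition expcoef (A : nat -> W -> W) (r : nat) (w : W) : W :=
  \sum_(k < r.+1) ((k`!)%:R)^-1 *: powcoef A k r w.

End LinearAlgebra.

Record voaData (R : realType) := VoaData {
  vcar :> lmodType R[i];
  vmode : vcar -> int -> vcar -> vcar; (* vmode v n w = Y_n(v) w *)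
  vvac : vcar;
  vomega : vcar }.

Arguments vvac {R} V : rename.
Arguments vomega {R} V : rename.

Section VertexAlgebra.
Variables (R : realType) (V : voaData R).
Local Notation C := R[i].

Definition wt (n : C) : set V := [set v | vmode (vomega V) 1 v = n *: v].

Section ModuleAxioms.
Variables (W : lmodType C) (YW : V -> int -> W -> W).

Definition Lmode (n : int) (w : W) : W := YW (vomega V) (n + 1) w.

Definition bilinear_modes : Prop :=
  forall n, (forall v, linear (YW v n)) /\ (forall w, linear (fun v => YW v n w)).

(* Y_W(v,x)w lies in W((x)) *)
Definition truncated : Prop :=
  forall v w, exists N : int, forall n : int, N <= n -> YW v n w = 0.

Definition identity_property : Prop :=
  forall n w, YW (vvac V) n w = if n == -1 then w else 0.

(* the coefficient of x0^(-l-1) x1^(-m-1) x2^(-n-1) in the Jacobi identity *)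
Definition jacobi : Prop :=
  forall (v1 v2 : V) (w : W) (l m n : int),
    \sum_(i \in [set: nat]) ((-1) ^+ i * gbinom R l i) *:
       (YW v1 (m + l - i%:Z) (YW v2 (n + i%:Z) w)
        - (-1) ^ l *: YW v2 (n + l - i%:Z) (YW v1 (m + i%:Z) w))
    = \sum_(i \in [set: nat]) gbinom R m i *:
       YW (vmode v1 (l + i%:Z) v2) (m + n - i%:Z) w.

Definition L1_derivative : Prop :=
  forall v n w,
    YW (vmode (vomega V) 0 v) n w = (- n%:~R) *: YW v (n - 1) w.

End ModuleAxioms.

Definition vertex_operator_algebra : Prop :=
  [/\ [/\ bilinear_modes (@vmode R V), truncated (@vmode R V),
        identity_property (@vmode R V), jacobi (@vmode R V)
      & L1_derivative (@vmode R V)],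
      (forall v : V, vmode v (-1) (vvac V) = v /\
         forall n : int, 0 <= n -> vmode v n (vvac V) = 0),
      (exists c : C, forall (m n : int) v,
         Lmode (@vmode R V) m (Lmode (@vmode R V) n v)
         - Lmode (@vmode R V) n (Lmode (@vmode R V) m v)
         = (m - n)%:~R *: Lmode (@vmode R V) (m + n) v
           + (if m + n == 0 then ((m ^ 3 - m)%:~R / 12%:R * c) *: v else 0)),
      is_grading (fun n : int => wt n%:~R)
    & (forall n : int, findim (wt n%:~R)) /\
      (exists N : int, forall n : int, n < N -> wt n%:~R = [set 0])].

Definition strongly_graded_voa (VA : C -> set V) : Prop :=
  [/\ vertex_operator_algebra,
      is_grading VA /\
        (forall n v, wt n v -> ssum (fun a => wt n `&` VA a) v),
      VA 0 (vvac V), VA 0 (vomega V)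
    & forall a b v v' n, VA a v -> VA b v' -> VA (a + b) (vmode v n v')].

Definition voa_automorphism (g : V -> V) : Prop :=
  [/\ linear g, bijective g, g (vvac V) = vvac V, g (vomega V) = vomega V
    & forall v n v', g (vmode v n v') = vmode (g v) n (g v')].

Definition compatible_grading (VA : C -> set V) (g : V -> V) : Prop :=
  forall a v, VA a v -> geneig g (cexp (twopii R * a)) v.

Section StronglyGradedModule.
Variables (VA : C -> set V) (W : lmodType C) (YW : V -> int -> W -> W).
(* Wg n a = W_<n>^[a] *)
Variable Wg : C -> C -> set W.

(* the notion includes that V is a strongly C-graded vertex operator algebra *)
Definition strongly_graded_module : Prop :=
  [/\ strongly_graded_voa VA,
      [/\ bilinear_modes YW, truncated YW, identity_property YW, jacobi YW
        & L1_derivative YW],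
      is_grading (fun na : C * C => Wg na.1 na.2) /\
        (forall n, ssum (Wg n) = geneig (Lmode YW 0) n),
      (forall a b v w n, VA a v -> ssum (fun m => Wg m b) w ->
         ssum (fun m => Wg m (a + b)) (YW v n w))
    & forall n a, findim (Wg n a) /\
        exists N : int, forall l : int, l < N -> Wg (n + l%:~R) a = [set 0]].

Definition graded_by_geneig (A : W -> W) : Prop :=
  forall a, ssum (fun n => Wg n a) = geneig A a.

End StronglyGradedModule.

Section TwistedModule.
Variables (VA : C -> set V) (g : V -> V) (W : lmodType C).
(* Wg n a = W_[n]^[a];  Yg v s k w = coefficient of x^s (log x)^k *)
Variables (Wg : C -> C -> set W) (Yg : V -> C -> nat -> W -> W) (gW : W -> W).

Definition W1 (n : C) : set W := ssum (Wg n).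
Definition W2 (a : C) : set W := ssum (fun n => Wg n a).

(* component of weight n of the r-th branch of Y^g(v,z)w *)
Definition branch (r : int) (v : V) (z : C) (w : W) (n : C) : W :=
  \sum_(sk \in [set: C * nat])
    (cexp (sk.1 * lbranch r z) * lbranch r z ^+ sk.2) *:
      proj W1 n (Yg v sk.1 sk.2 w).

(* component of weight n of Y(v1,z)v2 *)
Definition vcomp (v1 : V) (z : C) (v2 : V) (n : C) : V :=
  \sum_(m \in [set: int]) z ^ (- m - 1) *: proj wt n (vmode v1 m v2).

(* the graded dual \coprod_(n,a) (W_[n]^[a])^* *)
Definition graded_dual (w' : {linear W -> C^o}) : Prop :=
  exists F : {fset C * C}, forall n a w,
    (n, a) \notin F -> Wg n a w -> w' w = 0.

(* pairing with an element of the product of the W_[n] *)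
Definition pairing (w' : {linear W -> C^o}) (y : C -> W) : C :=
  \sum_(n \in [set: C]) (w' (y n) : C).

Definition fbranch (N : nat) (a : nat -> nat -> nat -> nat -> C)
    (m n : nat -> C) (t : nat) (l1 l2 z1 z2 : C) : C :=
  \sum_(i < N.+1) \sum_(j < N.+1) \sum_(k < N.+1) \sum_(l < N.+1)
    a i j k l * cexp (m i * l1) * cexp (n j * l2) * l1 ^+ k * l2 ^+ l
      * (z1 - z2) ^- t.

(* Convention: on |z2| > |z1 - z2| > 0 the sum of iterates is continuous, while
   l_r(z1) and l_r(z2) may jump separately across the cut.  There the branch of
   log z1 is the one in the half-plane around l_r(z2); it is l_r(z1) whenever
   |arg z1 - arg z2| < pi/2. *)
Definition duality : Prop :=
  forall (v1 v2 : V) (w : W) (w' : {linear W -> C^o}), graded_dual w' ->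
  exists (N : nat) (a : nat -> nat -> nat -> nat -> C) (m n : nat -> C) (t : nat),
    (0 < t)%N /\ forall (r : int) (z1 z2 : C),
    [/\ 0 < `|z2| -> `|z2| < `|z1| ->
          abs_cvg_to
            (fun k => pairing w' (branch r v1 z1 (branch r v2 z2 w k)))
            (fbranch N a m n t (lbranch r z1) (lbranch r z2) z1 z2),
        0 < `|z1| -> `|z1| < `|z2| ->
          abs_cvg_to
            (fun k => pairing w' (branch r v2 z2 (branch r v1 z1 w k)))
            (fbranch N a m n t (lbranch r z1) (lbranch r z2) z1 z2)
      & 0 < `|z1 - z2| -> `|z1 - z2| < `|z2| ->
          forall r1 : int,
          `|complex.Im (lbranch r1 z1 - lbranch r z2)| < pi / 2%:R ->
          abs_cvg_to
            (fun k => pairing w' (branch r (vcomp v1 (z1 - z2) v2 k) z2 w))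
            (fbranch N a m n t (lbranch r1 z1) (lbranch r z2) z1 z2)].

(* Convention: g is the monodromy of Y^g around 0, so that Y^{g;r+1}(v,z) is
   Y^{g;r}(gv,z).  As x^{Y_0(u)} has monodromy e^{2 pi i Y_0(u)}, this is the
   orientation for which the modified operators are e^{2 pi i Y_0(u)}-twisted;
   with the opposite one, Y^{g;r+1}(gv,z) = Y^{g;r}(v,z), the same modules
   would be called e^{-2 pi i Y_0(u)}-twisted. *)
Definition equivariance : Prop :=
  forall (r : int) (z : C) (v : V) (w : W) (n : C), z != 0 ->
    branch (r + 1) v z w n = branch r (g v) z w n.

Definition twisted_map : Prop :=
  [/\ (forall s k, (forall v, linear (Yg v s k)) /\
                   (forall w, linear (fun v => Yg v s k w))),
      (forall v w, exists K : nat, forall s k, (K <= k)%N -> Yg v s k w = 0)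
    & forall m n s k v w, wt m v -> W1 n w -> W1 (m + n + s) (Yg v s k w)].

Definition twisted_module : Prop :=
  [/\ [/\ strongly_graded_voa VA, voa_automorphism g & compatible_grading VA g],
      [/\ is_grading (fun na : C * C => Wg na.1 na.2), twisted_map,
        linear gW & bijective gW],
      (forall n a, findim (Wg n a) /\
        exists M : R, forall l : R, l < M -> Wg (n + l%:C%C) a = [set 0]),
      [/\ equivariance,
        (forall s k w,
           Yg (vvac V) s k w = if (s == 0) && (k == 0%N) then w else 0)
      & duality]
    & [/\ (forall s k w, Yg (vomega V) s k w != 0 ->
             k = 0%N /\ exists n : int, s = n%:~R),
          (forall n a w, Wg n a w -> exists2 K : nat, (0 < K)%N &
             iter K (fun x => Yg (vomega V) (- 2%:R) 0 x - n *: x) w = 0),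
          (forall a b s k v w, VA a v -> W2 b w -> W2 (a + b) (Yg v s k w))
        & (forall s k v w,
             (s + 1) *: Yg v (s + 1) k w + k.+1%:R *: Yg v (s + 1) k.+1 w
             = Yg (vmode (vomega V) 0 v) s k w)]].

End TwistedModule.

Section ModifiedOperators.
Variable u : V.

(* coefficient of x^s (log x)^k in Delta_V^(u)(x) v *)
Definition Delta (s : C) (k : nat) (v : V) : V :=
  \sum_(n \in [set: nat])
    proj (geneig (vmode u 0)) (s + n%:R)
      (((k`!)%:R)^-1 *: iter k (nilpart (vmode u 0))
         (expcoef (fun m => fun x =>
            ((-1) ^+ m / (- m%:R)) *: vmode u m%:Z x) n v)).

Variables (W : lmodType C) (YW : V -> int -> W -> W).

(* coefficient of x^s (log x)^k in Y_W(Delta_V^(u)(x) v, x) w *)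
Definition twistY (v : V) (s : C) (k : nat) (w : W) : W :=
  \sum_(n \in [set: int]) YW (Delta (s + n%:~R + 1) k v) n w.

Definition twistL (n : int) (w : W) : W :=
  twistY (vomega V) (- n%:~R - 2%:R) 0 w.

Definition jointgrading (n a : C) : set W :=
  geneig (twistL 0) n `&` geneig (YW u 0) a.

End ModifiedOperators.

End VertexAlgebra.

(* The generalized vertex algebra of the dual lattice L~ = Z gamma/(2pq).  The
   basis vector (m, k) is \prod_(i in m) gamma(-(i+1)) e^{k gamma/(2pq)}; the
   rank being one, the group algebra of L~ needs no cocycle. *)
Section Lattice.
Variables (R : realType) (p q : nat).
Local Notation C := R[i].

Definition fockidx : choiceType := (multiset nat * int)%type.

Definition VLt : lmodType C := malg fockidx C.

Definition basisv (K : fockidx) : VLt := mkmalgU K 1.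

Definition linext (f : fockidx -> VLt) (w : VLt) : VLt :=
  \sum_(K <- msupp w) mcoeff K w *: f K.

Definition heis (n : int) : VLt -> VLt :=
  linext (fun K => match n with
    | Posz 0 => K.2%:~R *: basisv K
    | Posz j.+1 => (2 * p * q * j.+1 * K.1 j)%N%:R *: basisv (K.1 `\ j, K.2)%mset
    | Negz i => basisv (i +` K.1, K.2)%mset
    end).

Definition shift (l : int) : VLt -> VLt :=
  linext (fun K => basisv (K.1, K.2 + l)).

(* beta(n) for beta = l gamma/(2pq) *)
Definition heisl (l n : int) (w : VLt) : VLt :=
  (l%:~R / (2 * p * q)%N%:R) *: heis n w.

(* exp(\sum_(n >= 1) beta(-n) x^n / n) and exp(-\sum_(n >= 1) beta(n) x^-n / n) *)
Definition Eminus (l : int) : nat -> VLt -> VLt :=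
  expcoef (fun n w => (n%:R)^-1 *: heisl l (- n%:Z) w).
Definition Eplus (l : int) : nat -> VLt -> VLt :=
  expcoef (fun n w => (- (n%:R)^-1) *: heisl l n%:Z w).

(* coefficient of x^s in Y(e^beta, x) *)
Definition Yexp (l : int) (s : rat) : VLt -> VLt :=
  linext (fun K =>
    \sum_(ab \in [set ab : nat * nat |
         (l * K.2)%:~R / (2 * p * q)%N%:R + ab.1%:R - ab.2%:R = s])
      Eminus l ab.1 (shift l (Eplus l ab.2 (basisv K)))).

(* coefficient of x^s in Y(gamma(-i1-1)...gamma(-ir-1) e^beta, x), from
   Y(gamma(-i-1)v, x) = :(d/dx)^i gamma(x) / i! . Y(v, x): *)
Fixpoint Ymono (l : int) (ms : seq nat) (s : rat) (w : VLt) : VLt :=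
  match ms with
  | [::] => Yexp l s w
  | i :: ms' =>
      \sum_(j \in [set: nat]) 'C(i + j, i)%:R *:
         heis (- (i + j).+1%:Z) (Ymono l ms' (s - j%:R) w)
    + \sum_(j \in [set: nat]) ((-1) ^+ i * 'C(i + j, i)%:R) *:
         Ymono l ms' (s + (i + j).+1%:R) (heis j%:Z w)
  end.

(* coefficient of x^s in Y_{V_L~}(v, x) w *)
Definition YVLt (v : VLt) (s : rat) (w : VLt) : VLt :=
  \sum_(K <- msupp v)
    mcoeff K v *: Ymono K.2 (enum_mset K.1) s w.

(* V_{L + k gamma/(2pq)} *)
Definition in_coset (k : int) : {pred VLt} :=
  [pred v : VLt |
    all (fun K : fockidx => (K.2 == k %[mod (2 * p * q)%N])%Z) (msupp v)].

Record Vcoset (k : int) := InCoset { coset_val : VLt; _ : in_coset k coset_val }.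

HB.instance Definition _ k := [isSub for @coset_val k].
HB.instance Definition _ k := [Choice of Vcoset k by <:].

Fact in_coset_submod_closed k : submod_closed (in_coset k).
Proof.
have supp v : reflect (forall K : fockidx, mcoeff K v != 0 ->
    (K.2 == k %[mod (2 * p * q)%N])%Z) (v \in in_coset k).
  rewrite inE; apply: (iffP allP) => H K; have := H K.
    by rewrite -mcoeff_neq0; apply.
  by rewrite -mcoeff_neq0.
split; first by apply/supp => K; rewrite mcoeff0 eqxx.
move=> a x y /supp hx /supp hy; apply/supp => K.
rewrite mcoeffD mcoeffZ.
case: (eqVneq (mcoeff K x) 0) => [->|/hx //].
by rewrite mulr0 add0r => /hy.
Qed.

HB.instance Definition _ k :=
  GRing.isSubmodClosed.Build C VLt (in_coset k) (in_coset_submod_closed k).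
HB.instance Definition _ k := [SubChoice_isSubLmodule of Vcoset k by <:].

(* restriction of the codomain; it is only applied to elements of the coset *)
Definition to_coset (k : int) (w : VLt) : Vcoset k := insubd 0 w.

(* Y_n : V_{L+k1} x V_{L+k2} -> V_{L+k3} *)
Definition Yc (k1 k2 k3 : int) (v : Vcoset k1) (n : int) (w : Vcoset k2) :
    Vcoset k3 :=
  to_coset k3 (YVLt (val v) (- n%:~R - 1) (val w)).

End Lattice.

Section Extensions.
Variables (R : realType) (p q : nat).
Local Notation C := R[i].

(* -gamma/p and gamma/q in units of gamma/(2pq) *)
Definition kp : int := - (2 * q)%N%:Z.
Definition kq : int := (2 * p)%N%:Z.

Definition VL : lmodType C := Vcoset R p q 0.
Definition VLp : lmodType C := Vcoset R p q kp.
Definition VLq : lmodType C := Vcoset R p q kq.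

Definition vacL : VL := to_coset p q 0 (basisv R (mset0, 0)).

Definition omegaL : VL :=
  let h := heis p q in
  to_coset p q 0
    ((4 * p * q)%N%:R^-1 *: h (- 1) (h (- 1) (basisv R (mset0, 0)))
     + ((p%:R - q%:R) / (2 * p * q)%N%:R) *: h (- 2) (basisv R (mset0, 0))).

Definition expp : VLp := to_coset p q kp (basisv R (mset0, kp)).
Definition expq : VLq := to_coset p q kq (basisv R (mset0, kq)).

(* The sums are external: for p = 1 or q = 1 the summands coincide in V_{L~}. *)
Definition V0 : voaData R := @VoaData R (VL * VLp)%type
  (fun a n b => (Yc 0 a.1 n b.1, Yc kp a.2 n b.1 + Yc kp a.1 n b.2))
  (vacL, 0) (omegaL, 0).

Definition V0o : voaData R := @VoaData R (VL * VLq)%type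
  (fun a n b => (Yc 0 a.1 n b.1, Yc kq a.2 n b.1 + Yc kq a.1 n b.2))
  (vacL, 0) (omegaL, 0).

Definition Vpq : voaData R := @VoaData R (VL * VLp * VLq)%type
  (fun a n b => (Yc 0 a.1.1 n b.1.1,
                 Yc kp a.1.2 n b.1.1 + Yc kp a.1.1 n b.1.2,
                 Yc kq a.2 n b.1.1 + Yc kq a.1.1 n b.2))
  (vacL, 0, 0) (omegaL, 0, 0).

Definition u0 : V0 := (0, expp).
Definition u0o : V0o := (0, expq).
Definition upq_p : Vpq := (0, expp, 0).
Definition upq_q : Vpq := (0, 0, expq).

(* Res_x Y(v, x) = Y_0(v) *)
Definition Q : Vpq -> Vpq := vmode upq_q 0.
Definition Qtilde : Vpq -> Vpq := vmode upq_p 0.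

(* restrictions to V_0^o and V_0 *)
Definition Q_V0o (x : V0o) : V0o := let y := Q (x.1, 0, x.2) in (y.1.1, y.2).
Definition Qtilde_V0 (x : V0) : V0 := (Qtilde (x.1, x.2, 0)).1.

End Extensions.

(* Main.v *)
(* The components of V other than V_L multiply to zero, so u_i u_j = 0 on V and the
   modification is affine in the modes of u:
     Delta(x) v = v + log x u_0 v + \sum_(j >= 1) (-1)^j / (-j) x^-j u_j v.
   As u_0 is locally nilpotent on W as well, the additional grading is
   concentrated in charge 0, and L_W^(u)(0) = L_W(0) + (Y_W)_0(u) has the same
   generalized eigenspaces as L_W(0).

   Duality, for homogeneous vectors and a fixed total degree: the commutator
   formula and the iterate formula express products and iterates of the
   untwisted modes through one rational function with poles at z1 = 0, z2 = 0,
   z1 = z2.  The remaining factors are log z and powers of z; in the region of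
   iterates they are recombined by expanding log z1 and z1^-j around z2, which
   also fixes the branch of log z1.

   Lower bound of the real parts of the weights: e^gamma maps a lowest weight
   vector to an eigenvector of gamma(0) with integral eigenvalue c, and the
   weight is then a quadratic polynomial in c with positive leading coefficient. *)

Require Import Defs.
From HB Require Import structures.
From mathcomp Require Import all_boot all_order all_algebra.
From mathcomp Require Import finmap multiset complex ring lra zify.
From mathcomp Require Import mathcomp_extra boolp classical_sets functions cardinality fsbigop.
From mathcomp Require Import reals topology normedtype sequences derive realfun exp trigo.
From mathcomp Require Import -(notations) monalg.

Set Implicit Arguments.
Unset Strict Implicit.
Unset Printing Implicit Defensive.

Import Order.TTheory GRing.Theory Num.Theory.
Import numFieldNormedType.Exports.

(* again, since topology shadows some of its names *)
Require Import Defs.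
Local Open Scope classical_set_scope.
Local Open Scope ring_scope.

(** * Complex exponentials and logarithms *)

(** All four cases are instances of one theorem about a primary vector u of weight 1 and square zero
    in a vertex operator algebra containing V_L. Nothing is assumed on how W decomposes over V_L;
    only the module axioms are used. Square zero in V does not directly kill products of two u-modes
    on W, only the modes of iterates of u_i v1 and u_j v2. In the region of iterates this still
    forces the correlation function of these two vectors to vanish, by uniqueness of limits. Log z1
    and the powers z1^-j recombine because they are, with their coefficients, the logarithm and its
    divided derivatives. Their Taylor expansions at z2 carry exactly the binomial coefficients with
    which u_j acts on a mode (v1)_l v2. The weights need a separate argument because the module
    axioms bound them only along n + Z, whereas a twisted module asks for a bound over all real
    shifts. That e^gamma does not annihilate a lowest weight vector follows from the vacuum being a
    mode product of e^-gamma and e^gamma. *)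

Section Complex.
Variable R : realType.
Local Notation C := R[i].
Implicit Types z : C.

Lemma cabsE z : `|z| = (cabs z)%:C%C.
Proof. by rewrite /cabs normc_def; exact: erefl. Qed.

Lemma cabs_ge0 z : 0 <= cabs z.
Proof. by rewrite /cabs normc_def /= sqrtr_ge0. Qed.

Lemma cabsM z1 z2 : cabs (z1 * z2) = cabs z1 * cabs z2.
Proof. by apply: complexI; rewrite rmorphM /= -!cabsE normrM. Qed.

Lemma cabsX z n : cabs (z ^+ n) = cabs z ^+ n.
Proof. by apply: complexI; rewrite rmorphXn /= -!cabsE normrX. Qed.

Lemma cabs_eq0 z : (cabs z == 0) = (z == 0).
Proof.
by rewrite -[RHS]normr_eq0 cabsE -(inj_eq (@complexI _)).
Qed.

Lemma cabs0 : cabs (0 : C) = 0.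
Proof. by apply/eqP; rewrite cabs_eq0. Qed.

Lemma cabs1 : cabs (1 : C) = 1.
Proof. by apply: complexI; rewrite -cabsE normr1. Qed.

Lemma cabsN z : cabs (- z) = cabs z.
Proof. by rewrite /cabs normrN. Qed.

Lemma cabsV z : cabs z^-1 = (cabs z)^-1.
Proof. by apply: complexI; rewrite fmorphV /= -!cabsE normfV. Qed.

Lemma ler_cabsD z1 z2 : cabs (z1 + z2) <= cabs z1 + cabs z2.
Proof.
by have := ler_normD z1 z2; rewrite !cabsE -rmorphD lecR.
Qed.

Lemma cabs_nat n : cabs (n%:R : C) = n%:R.
Proof. by apply: complexI; rewrite -cabsE normr_nat rmorph_nat. Qed.

Lemma ler_cabs_sum (I : Type) (r : seq I) (P : pred I) (F : I -> C) :
  cabs (\sum_(i <- r | P i) F i) <= \sum_(i <- r | P i) cabs (F i).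
Proof.
elim/big_ind2: _ => [||//]; first by rewrite cabs0.
by move=> x y u v h1 h2; apply: le_trans (ler_cabsD _ _) (lerD h1 h2).
Qed.

Lemma ler_Re_cabs z : `|complex.Re z| <= cabs z.
Proof.
rewrite /cabs normc_def /= -sqrtr_sqr ler_sqrt ?addr_ge0 ?sqr_ge0 //.
by rewrite lerDl sqr_ge0.
Qed.

Lemma ler_Im_cabs z : `|complex.Im z| <= cabs z.
Proof.
rewrite /cabs normc_def /= -sqrtr_sqr ler_sqrt ?addr_ge0 ?sqr_ge0 //.
by rewrite lerDr sqr_ge0.
Qed.

Lemma ler_cabs_ReIm z : cabs z <= `|complex.Re z| + `|complex.Im z|.
Proof.
rewrite -[leRHS]ger0_norm ?addr_ge0 // -sqrtr_sqr /cabs normc_def /=.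
rewrite ler_sqrt ?sqr_ge0 // sqrrD !real_normK ?num_real //.
by rewrite [leRHS]addrAC lerDl mulrn_wge0 // mulr_ge0.
Qed.

Lemma cexpD z1 z2 : cexp (z1 + z2) = cexp z1 * cexp z2.
Proof.
case: z1 z2 => [a b] [c d]; rewrite /cexp /= expRD cosD sinD.
by apply/eqP; rewrite eq_complex /=; apply/andP; split; apply/eqP; ring.
Qed.

Lemma cexp0 : cexp (0 : C) = 1.
Proof. by rewrite /cexp /= expR0 cos0 sin0 !mul1r. Qed.

Lemma cexpN z : cexp (- z) = (cexp z)^-1.
Proof.
have h : cexp z * cexp (- z) = 1 by rewrite -cexpD subrr cexp0.
have nz : cexp z != 0.
  by apply: contra_eq_neq h => ->; rewrite mul0r eq_sym oner_neq0.
by apply: (mulfI nz); rewrite h divff.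
Qed.

Lemma cexp_neq0 z : cexp z != 0.
Proof.
apply/eqP => h; have := cexpD z (- z).
by rewrite subrr cexp0 h mul0r => /eqP; rewrite oner_eq0.
Qed.

Lemma cexpMn z n : cexp (n%:R * z) = cexp z ^+ n.
Proof.
elim: n => [|n IH]; first by rewrite mul0r cexp0.
by rewrite -natr1 mulrDl mul1r cexpD IH exprSr.
Qed.

Lemma cexpMz z (n : int) : cexp (n%:~R * z) = cexp z ^ n.
Proof.
case: n => n; first exact: cexpMn.
by rewrite NegzE mulrNz mulNr cexpN -exprnN; congr (_^-1); exact: cexpMn.
Qed.

Lemma cexp_twopii : cexp (twopii R) = 1.
Proof.
rewrite /cexp /twopii /= expR0 !mul1r.
have -> : 2%:R * pi = 0 + pi *+ 2 :> R by rewrite add0r mulr_natl.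
by rewrite cosD2pi sinD2pi cos0 sin0.
Qed.

(** The sine of [acos (a / m)] is |b| / m. For b < 0 the reflected angle in [arg] keeps the cosine
    and restores the sign of the sine. *)
Lemma cexp_lbranch r z : z != 0 -> cexp (lbranch r z) = z.
Proof.
move=> z0; rewrite /lbranch cexpD cexpMz cexp_twopii exp1rz mulr1 /cexp /=.
have m0 : 0 < cabs z by rewrite lt_neqAle eq_sym cabs_eq0 z0 cabs_ge0.
rewrite lnK ?posrE //; case: z z0 m0 => [a b] z0 m0.
set m := cabs _ in m0 *.
have m2 : a ^+ 2 + b ^+ 2 = m ^+ 2.
  by rewrite /m /cabs normc_def /= sqr_sqrtr // addr_ge0 // sqr_ge0.
have t1 : -1 <= a / m <= 1.
  by rewrite -ler_norml normrM normfV (gtr0_norm m0) ler_pdivrMr // mul1r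
    (ler_Re_cabs (Complex a b)).
have s1 : Num.sqrt (1 - (a / m) ^+ 2) = `|b| / m.
  rewrite -[RHS]ger0_norm ?divr_ge0 ?(ltW m0) // -sqrtr_sqr; congr Num.sqrt.
  rewrite !exprMn real_normK ?num_real // !exprVn -m2.
  by field; rewrite m2 lt0r_neq0 // exprn_gt0.
rewrite /arg /= -/m; case: ifPn => [b0|].
  rewrite acosK ?in_itv //= sin_acos // s1 ger0_norm //.
  by congr Complex; field; rewrite lt0r_neq0.
rewrite -ltNge => b0.
have -> : 2%:R * pi - acos (a / m) = - acos (a / m) + pi *+ 2 :> R.
  by rewrite addrC mulr_natl.
rewrite cosD2pi sinD2pi cosN sinN acosK ?in_itv //= sin_acos // s1 ltr0_norm //.
by congr Complex; field; rewrite lt0r_neq0.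
Qed.

Lemma lbranchS r z : lbranch (r + 1) z = lbranch r z + twopii R.
Proof. by rewrite /lbranch intrD mulrDl mul1r addrA. Qed.

End Complex.

(** * Absolutely convergent families *)

Lemma big_fset_iota (T : choiceType) (V : nmodType) (f : nat -> T) n (g : T -> V) :
  injective f ->
  \sum_(i <- [fset f k | k in iota 0 n]%fset) g i = \sum_(k < n) g (f k).
Proof.
move=> fI; rewrite big_imfset; last by move=> x y _ _ /fI.
rewrite -(big_mkord xpredT (g \o f)) /index_iota subn0; apply/perm_big/uniq_perm.
- exact: enum_finmem_uniq.
- exact: iota_uniq.
exact: enum_finmemE.
Qed.

Lemma mem_fset_iota (T : choiceType) (f : nat -> T) n x :
  reflect (exists2 k, (k < n)%N & x = f k) (x \in [fset f k | k in iota 0 n]%fset).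
Proof.
apply: (iffP idP) => [/imfsetP[k kn ->]|[k kn ->]].
  by exists k => //; have : k \in iota 0 n := kn; rewrite mem_iota.
by apply/imfsetP; exists k => //; have : k \in iota 0 n by rewrite mem_iota.
Qed.

Section AbsoluteConvergence.
Variable R : realType.
Local Notation C := R[i].

Definition asummable (I : choiceType) (a : I -> C) :=
  exists M : R, forall F : {fset I}, \sum_(n <- F) cabs (a n) <= M.

(** This is [abs_cvg_to] over an arbitrary index type, so that sums over naturals, integers and
    pairs can be compared; over the complex numbers the two are convertible. *)
Definition acvg (I : choiceType) (a : I -> C) (s : C) :=
  asummable a /\
  forall e : R, 0 < e -> exists F0 : {fset I}, forall F : {fset I},
     (F0 `<=` F)%fset -> cabs (\sum_(n <- F) a n - s) < e.

Section OneFamily.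
Variable I : choiceType.
Implicit Types (a b : I -> C) (F : {fset I}).

Lemma big_fset_sub (V : nmodType) (f : I -> V) F0 F : (F0 `<=` F)%fset ->
  \sum_(n <- F) f n = \sum_(n <- F0) f n + \sum_(n <- (F `\` F0)%fset) f n.
Proof.
move=> sF; rewrite (big_fsetID _ (mem F0)) /=; congr (_ + _).
  apply: eq_fbigl => x; rewrite !inE /= andbC; case: (boolP (x \in F0)) => //= h.
  by rewrite (fsubsetP sF).
by apply: eq_fbigl => x; rewrite !inE /= andbC.
Qed.

Lemma ler_fset_sub (f : I -> R) F0 F : (forall i, 0 <= f i) -> (F0 `<=` F)%fset ->
  \sum_(n <- F0) f n <= \sum_(n <- F) f n.
Proof. by move=> f0 /big_fset_sub ->; rewrite lerDl sumr_ge0. Qed.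

(** Some finite sum of absolute values comes within e of the supremum, so less than e is left
    outside it. *)
Lemma asummable_tail a : asummable a -> forall e : R, 0 < e ->
  exists F0 : {fset I}, forall F, (F0 `<=` F)%fset ->
    \sum_(n <- (F `\` F0)%fset) cabs (a n) < e.
Proof.
move=> [M bM] e e0.
pose S : set R := [set x | exists F, x = \sum_(n <- F) cabs (a n)].
have hS : has_sup S.
  split; first by exists 0; exists fset0; rewrite big_seq_fset0.
  by exists M => _ [F ->].
have [x [F0 ->] hx] := sup_adherent e0 hS.
exists F0 => F sF.
have := @sup_ubound _ S (proj2 hS) _ (ex_intro _ F erefl).
rewrite (big_fset_sub _ sF); lra.
Qed.

Lemma acvg_fset a F : (forall i, i \notin F -> a i = 0) ->
  acvg a (\sum_(i <- F) a i).
Proof.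
move=> h; split.
  exists (\sum_(i <- F) cabs (a i)) => G.
  apply: (@le_trans _ _ (\sum_(i <- (F `|` G)%fset) cabs (a i))).
    by apply: ler_fset_sub (fsubsetUr _ _) => i; apply: cabs_ge0.
  rewrite (big_fset_sub _ (fsubsetUl F G)) [X in _ + X]big1_seq ?addr0 //.
  by move=> i /=; rewrite !inE => /andP[/h -> _]; rewrite cabs0.
move=> e e0; exists F => G /big_fset_sub ->.
rewrite [X in cabs (_ + X - _)]big1_seq ?addr0 ?subrr ?cabs0 //.
by move=> i /=; rewrite !inE => /andP[/h -> _].
Qed.

Lemma acvg0 : acvg (fun _ : I => 0) 0.
Proof. by have := @acvg_fset (fun=> 0) fset0 (fun _ _ => erefl); rewrite big_seq_fset0. Qed.

Lemma acvgD a b s t : acvg a s -> acvg b t -> acvg (fun i => a i + b i) (s + t).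
Proof.
move=> [[M bM] ca] [[N bN] cb]; split.
  exists (M + N) => F; apply: le_trans (lerD (bM F) (bN F)).
  by rewrite -big_split ler_sum // => i _; apply: ler_cabsD.
move=> e e0; have e2 : 0 < e / 2%:R by rewrite divr_gt0.
have [F0 h0] := ca _ e2; have [F1 h1] := cb _ e2.
exists (F0 `|` F1)%fset => F; rewrite fsubUset => /andP[/h0 l0 /h1 l1].
rewrite big_split opprD addrACA; apply: le_lt_trans (ler_cabsD _ _) _.
rewrite [ltRHS](_ : _ = e / 2%:R + e / 2%:R); last by field.
exact: ltrD.
Qed.

Lemma acvgZ c a s : acvg a s -> acvg (fun i => c * a i) (c * s).
Proof.
move=> [[M bM] ca]; split.
  exists (cabs c * M) => F; under eq_bigr do rewrite cabsM.
  by rewrite -mulr_sumr ler_wpM2l ?cabs_ge0.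
move=> e e0; have c1 : 0 < cabs c + 1 by rewrite ltr_wpDl ?cabs_ge0.
have [F0 h0] := ca _ (divr_gt0 e0 c1); exists F0 => F /h0 l.
rewrite -mulr_sumr -mulrBr cabsM.
apply: (@le_lt_trans _ _ ((cabs c + 1) * cabs (\sum_(n <- F) a n - s))).
  by rewrite ler_wpM2r ?cabs_ge0 // lerDl.
by rewrite mulrC -ltr_pdivlMr.
Qed.

Lemma acvg_sum (J : Type) (r : seq J) (P : pred J) (a : J -> I -> C) (s : J -> C) :
  (forall j, P j -> acvg (a j) (s j)) ->
  acvg (fun i => \sum_(j <- r | P j) a j i) (\sum_(j <- r | P j) s j).
Proof.
move=> h; elim: r => [|j r IH].
  rewrite big_nil [X in acvg X](_ : _ = fun=> 0); first exact: acvg0.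
  by apply/funext => i; rewrite big_nil.
rewrite big_cons [X in acvg X](_ : _ = fun i =>
   (if P j then a j i else 0) + \sum_(j <- r | P j) a j i); last first.
  by apply/funext => i; rewrite big_cons; case: ifP; rewrite ?add0r.
case: ifP => Pj; first exact: acvgD (h _ Pj) IH.
by under eq_fun do rewrite add0r.
Qed.

Lemma acvg_uniq a s t : acvg a s -> acvg a t -> s = t.
Proof.
move=> [_ ca] [_ cb]; apply/eqP; rewrite -subr_eq0 -cabs_eq0.
rewrite eq_le cabs_ge0 andbT leNgt; apply/negP => e0.
have e2 : 0 < cabs (s - t) / 2%:R by rewrite divr_gt0.
have [F0 h0] := ca _ e2; have [F1 h1] := cb _ e2.
have := h0 _ (fsubsetUl F0 F1); have := h1 _ (fsubsetUr F0 F1).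
set x := \sum_(n <- _) _ => l1 l0.
have := ler_cabsD (x - t) (- (x - s)).
rewrite cabsN opprB addrC addrA subrK; lra.
Qed.

End OneFamily.

(** Summation along the fibres of [h]. The finite sets [Fib j] carry all nonzero terms of the
    fibres, so the inner sums are finite; Cauchy products and changes of indices are of this
    kind. *)
Lemma acvg_regroup (I J : choiceType) (a : I -> C) (b : J -> C) (h : I -> J)
    (Fib : J -> {fset I}) (s : C) :
  (forall j i, i \in Fib j -> h i = j) ->
  (forall i, i \notin Fib (h i) -> a i = 0) ->
  (forall j, b j = \sum_(i <- Fib j) a i) ->
  acvg a s -> acvg b s.
Proof.
move=> hF h0 hb [[M bM] ca].
have key (V : nmodType) (f : I -> V) (G : {fset J}) :
    \sum_(j <- G) \sum_(i <- Fib j) f i =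
    \sum_(i <- (\bigcup_(j <- G) Fib j)%fset) f i.
  rewrite (partition_big_imfset _ h) /=.
  transitivity (\sum_(j <- G)
      \sum_(i <- (\bigcup_(j <- G) Fib j)%fset | h i == j) f i).
    apply: eq_big_seq => j jG.
    rewrite -[RHS]big_filter; apply: perm_big; apply: uniq_perm.
    - exact: fset_uniq.
    - by rewrite filter_uniq // fset_uniq.
    move=> i; rewrite mem_filter; apply/idP/andP => [ij|[/eqP <- /bigfcupP]].
      by rewrite (hF _ _ ij); split=> //; apply/bigfcupP; exists j; rewrite ?jG.
    by case=> j' _ ij'; rewrite (hF _ _ ij').
  set A := (\bigcup_(j <- G) Fib j)%fset.
  apply/esym/big_fset_incl.
    apply/fsubsetP => j /imfsetP[i /= /bigfcupP[j' /andP[j'G _] ij'] ->].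
    by rewrite (hF _ _ ij').
  move=> j _ jn; rewrite big1_seq // => i /andP[/eqP hi iA].
  by move: jn; rewrite -hi in_imfset.
split.
  exists M => G; apply: le_trans (bM (\bigcup_(j <- G) Fib j)%fset).
  by rewrite -key; apply: ler_sum => j _; rewrite hb; apply: ler_cabs_sum.
move=> e e0; have [F0 hF0] := ca _ e0.
exists [fset h i | i in F0]%fset => G sG.
under eq_bigr do rewrite hb; rewrite key.
set A := (\bigcup_(j <- G) Fib j)%fset.
(* As G contains the image of F0, an index of F0 outside A lies outside its own [Fib], and its term
   is 0. *)
rewrite (_ : \sum_(i <- A) a i = \sum_(i <- (F0 `|` A)%fset) a i).
  exact: hF0 (fsubsetUl _ _).
apply: big_fset_incl (fsubsetUr _ _) _ => i; rewrite inE => /orP[iF|-> //] iA.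
apply: h0; apply: contra iA => iF'; apply/bigfcupP; exists (h i) => //.
by rewrite andbT (fsubsetP sG) // in_imfset.
Qed.

(** Regrouping along an injection, whose fibres are empty or singletons. *)
Lemma acvg_inj (I J : choiceType) (a : I -> C) (b : J -> C) (h : I -> J) s :
  injective h -> (forall i, b (h i) = a i) ->
  (forall j, (forall i, j <> h i) -> b j = 0) -> acvg a s -> acvg b s.
Proof.
move=> hi hb h0.
pose Fib j : {fset I} :=
  if pselect (exists i, h i = j) is left p then [fset projT1 (cid p)]%fset
  else fset0.
apply: (@acvg_regroup I J a b h Fib).
- by move=> j i; rewrite /Fib; case: pselect => // p; rewrite inE => /eqP ->; case: cid.
- move=> i; rewrite /Fib; case: pselect => [p|[]]; last by exists i.
  by rewrite inE; case: cid => x /= /hi ->; rewrite eqxx.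
move=> j; rewrite /Fib; case: pselect => [p|np].
  by rewrite big_seq_fset1; case: cid => x /= <-; rewrite hb.
by rewrite big_seq_fset0 h0 // => i ji; apply: np; exists i.
Qed.

Lemma acvg_bij (I J : choiceType) (a : I -> C) (h : J -> I) s :
  bijective h -> acvg a s -> acvg (a \o h) s.
Proof.
move=> [g hg gh]; apply: (@acvg_inj I J a (a \o h) g) => [x y e|i|j ne].
- by rewrite -[x]gh -[y]gh e.
- by rewrite /= gh.
by case: (ne (h j)); rewrite hg.
Qed.

Lemma acvg_int (a : int -> C) s t :
  acvg (fun n => a (Posz n)) s -> acvg (fun n => a (Negz n)) t -> acvg a (s + t).
Proof.
move=> cs ct.
have h1 : acvg (fun n : int => if n is Posz m then a m else 0) s.
  apply: (acvg_inj (h := Posz)) cs => [x y [//]|//|[] n // ne].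
  by case: (ne n).
have h2 : acvg (fun n : int => if n is Negz m then a (Negz m) else 0) t.
  apply: (acvg_inj (h := Negz)) ct => [x y [//]|//|[] n // ne].
  by case: (ne n).
have := acvgD h1 h2; congr acvg.
by apply/funext => -[] n; rewrite ?addr0 ?add0r.
Qed.

Lemma acvg_mul (I J : choiceType) (a : I -> C) (b : J -> C) s t :
  acvg a s -> acvg b t -> acvg (fun p : I * J => a p.1 * b p.2) (s * t).
Proof.
move=> [sa ca] [sb cb]; have [M bM] := sa; have [N bN] := sb.
have M0 : 0 <= M by apply: le_trans (bM fset0); rewrite big_seq_fset0.
have N0 : 0 <= N by apply: le_trans (bN fset0); rewrite big_seq_fset0.
pose X (F : {fset I}) (G : {fset J}) : {fset (I * J)%type} :=
  [fset ((x, y) : (I * J)%type) | x in F, y in G]%fset.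
have XE (V : pzSemiRingType) (f : I -> V) (g : J -> V) F G :
    \sum_(p <- X F G) f p.1 * g p.2 =
    (\sum_(x <- F) f x) * (\sum_(y <- G) g y).
  rewrite /X big_imfset2 /=; last first.
    by move=> [x1 y1] [x2 y2] _ _ /= [-> ->].
  by rewrite mulr_suml; apply: eq_bigr => x _; rewrite mulr_sumr.
have inX x y F G : ((x, y) \in X F G) = (x \in F) && (y \in G).
  apply/imfset2P/andP => [[x' /= x'F [y' y'G [-> ->]]] //|[xF yG]].
  by exists x => //; exists y.
have sub (F : {fset I * J}) : (F `<=` X (fst @` F) (snd @` F))%fset.
  apply/fsubsetP => -[x y] xyF; rewrite inX.
  by apply/andP; split; apply/imfsetP; exists (x, y).
have c0 (p : I * J) : 0 <= cabs (a p.1) * cabs (b p.2).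
  by rewrite mulr_ge0 ?cabs_ge0.
split.
  exists (M * N) => F; under eq_bigr do rewrite cabsM.
  apply: le_trans (ler_fset_sub c0 (sub F)) _.
  by rewrite (XE _ (fun i => cabs (a i)) (fun i => cabs (b i))) ler_pM ?sumr_ge0 // => i _; exact: cabs_ge0.
move=> e e0.
pose d := e / (4%:R * (M + N + 1)).
have MN0 : 0 < M + N + 1 by lra.
have d0 : 0 < d by rewrite divr_gt0 ?mulr_gt0.
have [F1 h1] := asummable_tail sa d0; have [G1 g1] := asummable_tail sb d0.
have e4 : 0 < e / 2%:R by rewrite divr_gt0.
(* On rectangles the double sum is a product of partial sums, which converges to s t. *)
have cst : exists F2 G2, forall F G, (F2 `<=` F)%fset -> (G2 `<=` G)%fset ->
    cabs ((\sum_(x <- F) a x) * (\sum_(y <- G) b y) - s * t) < e / 2%:R.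
  pose d' := e / (2%:R * (M + cabs t + 1)).
  have t0 := cabs_ge0 t.
  have Mt : 0 < M + cabs t + 1 by lra.
  have d'0 : 0 < d' by rewrite divr_gt0 ?mulr_gt0.
  have [F2 h2] := ca _ d'0; have [G2 g2] := cb _ d'0.
  exists F2, G2 => F G /h2; set x := \sum_(n <- F) _ => l1.
  move/g2; set y := \sum_(n <- G) _ => l2.
  have -> : x * y - s * t = x * (y - t) + (x - s) * t by ring.
  apply: le_lt_trans (ler_cabsD _ _) _; rewrite !cabsM.
  have xM : cabs x <= M by apply: le_trans (ler_cabs_sum _ _ _) (bM F).
  apply: (@le_lt_trans _ _ (M * d' + d' * cabs t)).
    apply: lerD; first by apply: ler_pM; rewrite ?cabs_ge0 // ltW.
    by apply: ler_wpM2r; rewrite ?cabs_ge0 // ltW.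
  have -> : e / 2%:R = d' * (M + cabs t + 1) by rewrite /d'; field; rewrite lt0r_neq0.
  nra.
have [F2 [G2 h2]] := cst.
pose F0 := (F1 `|` F2)%fset; pose G0 := (G1 `|` G2)%fset.
exists (X F0 G0) => F sF.
rewrite (big_fset_sub _ sF) (XE _ a b) addrAC.
apply: le_lt_trans (ler_cabsD _ _) _.
have -> : e = e / 2%:R + e / 2%:R by field.
apply: ltr_leD; first by apply: h2; exact: fsubsetUr.
apply: le_trans (ler_cabs_sum _ _ _) _.
under eq_bigr do rewrite cabsM.
(* What F has beyond the rectangle F0 x G0 lies in the larger rectangle F' x G'. The absolute values
   over the difference add up to x' y' - x y, which the two tail estimates make small. *)
pose F' := (F0 `|` (fst @` F))%fset; pose G' := (G0 `|` (snd @` F))%fset.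
have s1 : (F `\` X F0 G0 `<=` X F' G' `\` X F0 G0)%fset.
  apply: fsetSD; apply: fsubset_trans (sub F) _.
  apply/fsubsetP => -[x y]; rewrite !inX => /andP[xF yF].
  by rewrite !inE xF yF !orbT.
apply: le_trans (ler_fset_sub c0 s1) _.
have s2 : (X F0 G0 `<=` X F' G')%fset.
  apply/fsubsetP => -[x y]; rewrite !inX => /andP[xF yF].
  by rewrite !inE; move: xF yF; rewrite !inE => -> ->.
have := big_fset_sub (fun p => cabs (a p.1) * cabs (b p.2)) s2.
rewrite !(XE _ (fun i => cabs (a i)) (fun i => cabs (b i))) /=.
have tl (K : choiceType) (c : K -> C) (K1 K0 K' : {fset K}) (Q : R) :
    (K1 `<=` K0)%fset -> (K0 `<=` K')%fset ->
    (forall F, (K1 `<=` F)%fset ->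
      \sum_(n <- (F `\` K1)%fset) cabs (c n) < d) ->
    \sum_(x <- K') cabs (c x) <= \sum_(x <- K0) cabs (c x) + d.
  move=> k1 k2 /(_ _ (fsubset_trans k1 k2)) hd.
  rewrite (big_fset_sub _ k2) lerD2l; apply: le_trans (ltW hd).
  by apply: ler_fset_sub (fsetDS _ k1) => i; exact: cabs_ge0.
have l1 := tl _ a F1 F0 F' 0 (fsubsetUl _ _) (fsubsetUl _ _) h1.
have l2 := tl _ b G1 G0 G' 0 (fsubsetUl _ _) (fsubsetUl _ _) g1.
move: l1 l2 (bM F0) (bN G') (bN G0) (bM F').
set x := \sum_(x <- F0) _; set x' := \sum_(x <- F') _.
set y := \sum_(x <- G0) _; set y' := \sum_(x <- G') _ => l1 l2 l3 l4 l5 l6.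
set z := \sum_(n <- _) _ => E.
have -> : z = (x' - x) * y' + x * (y' - y) by rewrite [in RHS]mulrBl E; ring.
have x0 : 0 <= x by rewrite sumr_ge0 // => i _; exact: cabs_ge0.
have y0 : 0 <= y' by rewrite sumr_ge0 // => i _; exact: cabs_ge0.
apply: (@le_trans _ _ (d * N + M * d)).
  apply: lerD; last by apply: (@le_trans _ _ (x * d)); rewrite ?ler_wpM2l ?ler_wpM2r ?(ltW d0) //; lra.
  by apply: (@le_trans _ _ (d * y')); rewrite ?ler_wpM2r ?ler_wpM2l ?(ltW d0) //; lra.
have -> : e / 2%:R = 2%:R * d * (M + N + 1) by rewrite /d; field; rewrite lt0r_neq0.
nra.
Qed.

(** A finite set containing a long initial segment differs from it by a small tail, so ordinary
    partial sums decide. *)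
Lemma asummable_nat_acvg (a : nat -> C) (s : C) (M : R) :
  (forall n, \sum_(i < n) cabs (a i) <= M) ->
  (forall e : R, 0 < e -> exists N, forall n, (N <= n)%N ->
     cabs (\sum_(i < n) a i - s) < e) ->
  acvg a s.
Proof.
move=> bM ca.
have ext (V : nmodType) (f : nat -> V) n :
    \sum_(i <- [fset i | i in iota 0 n]%fset) f i = \sum_(i < n) f i.
  exact: big_fset_iota.
have bnd (F : {fset nat}) : exists n, (F `<=` [fset i | i in iota 0 n])%fset.
  exists (\max_(i <- F) i).+1; apply/fsubsetP => i iF.
  by apply/mem_fset_iota; exists i; rewrite // ltnS (leq_bigmax_seq (F := id)).
have sm : asummable a.
  exists M => F; have [n /ler_fset_sub] := bnd F.
  by move=> /(_ (fun i => cabs (a i)) (fun _ => cabs_ge0 _)) /= /le_trans; apply; rewrite ext.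
split=> // e e0; have e2 : 0 < e / 2%:R by rewrite divr_gt0.
have [F0 h0] := asummable_tail sm e2; have [N hN] := ca _ e2.
have [n1 hn1] := bnd F0.
exists [fset i | i in iota 0 (maxn n1 N)]%fset => F sF.
rewrite (big_fset_sub _ sF) ext addrAC.
apply: le_lt_trans (ler_cabsD _ _) _.
have -> : e = e / 2%:R + e / 2%:R by field.
apply: ltrD; first by apply: hN; rewrite leq_maxr.
apply: le_lt_trans (ler_cabs_sum _ _ _) _.
have s0 : (F0 `<=` [fset i | i in iota 0 (maxn n1 N)])%fset.
  apply: fsubset_trans hn1 _; apply/fsubsetP => i /mem_fset_iota[k kn ->].
  by apply/mem_fset_iota; exists k; rewrite // (leq_trans kn) // leq_maxl.
apply: le_lt_trans (h0 F (fsubset_trans s0 sF)).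
by apply: ler_fset_sub (fsetDS _ s0) => i; exact: cabs_ge0.
Qed.

Lemma acvg_nat_bound (a : nat -> C) s : acvg a s ->
  exists M : R, forall n, \sum_(i < n) cabs (a i) <= M.
Proof.
move=> [[M bM] _]; exists M => n; apply: le_trans (bM [fset i | i in iota 0 n]%fset).
by rewrite (big_fset_iota _ (fun i => cabs (a i))).
Qed.

End AbsoluteConvergence.

(** * Geometric, binomial and logarithmic series *)

Section Series.
Variable R : realType.
Local Notation C := R[i].

Lemma acvg_nat_cvg (a : nat -> C) s : acvg a s -> forall e : R, 0 < e ->
  exists N, forall n, (N <= n)%N -> cabs (\sum_(i < n) a i - s) < e.
Proof.
move=> [_ ca] e e0; have [F hF] := ca _ e0.
exists (\max_(i <- F) i).+1 => n hn.
rewrite -(big_fset_iota n a (@inj_id nat)).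
apply: hF; apply/fsubsetP => i iF; apply/mem_fset_iota; exists i => //.
by apply: leq_trans hn; rewrite ltnS (leq_bigmax_seq (F := id)).
Qed.

Lemma subr1_neq0 (y : C) : cabs y < 1 -> 1 - y != 0.
Proof.
by move=> y1; rewrite subr_eq0; apply: contraTneq y1 => <-; rewrite cabs1 ltxx.
Qed.

Lemma acvg_geometric (y : C) : cabs y < 1 -> acvg (fun j => y ^+ j) (1 - y)^-1.
Proof.
move=> y1; have nz := subr1_neq0 y1.
have r0 := cabs_ge0 y.
have gs (K : fieldType) (x : K) n : 1 - x != 0 ->
    \sum_(i < n) x ^+ i = (1 - x ^+ n) / (1 - x).
  by move=> x1; apply: (mulIf x1); rewrite mulfVK // -[RHS]opprB subrX1 -mulNr opprB mulrC.
apply: (@asummable_nat_acvg _ _ _ (1 - cabs y)^-1).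
  move=> n; under eq_bigr do rewrite cabsX.
  rewrite gs; last by rewrite subr_eq0 gt_eqF.
  by rewrite ler_pdivrMr ?subr_gt0 // mulVf ?subr_eq0 ?gt_eqF // gerBl exprn_ge0.
move=> e e0.
have d0 : 0 < e * cabs (1 - y).
  by rewrite mulr_gt0 // lt_neqAle eq_sym cabs_eq0 nz cabs_ge0.
have := @cvg_expr R (cabs y); rewrite ger0_norm // => /(_ y1).
move=> /cvgrPdist_lt /(_ _ d0) [N _ hN].
exists N => n Nn; rewrite gs // mulrBl mul1r addrC addKr cabsN cabsM cabsV cabsX.
rewrite ltr_pdivrMr; last by rewrite lt_neqAle eq_sym cabs_eq0 nz cabs_ge0.
by have := hN n Nn; rewrite sub0r normrN ger0_norm // exprn_ge0.
Qed.

(** Multiplication by the geometric series sums the coefficients up to degree n, and the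
    hockey-stick identity yields the next binomial coefficient. *)
Lemma acvg_binomial i (y : C) : cabs y < 1 ->
  acvg (fun j => 'C(i + j, i)%:R * y ^+ j) ((1 - y) ^- i.+1).
Proof.
move=> y1; have nz := subr1_neq0 y1.
elim: i => [|i IH].
  rewrite expr1; under eq_fun do rewrite bin0 mul1r.
  exact: acvg_geometric.
have := acvg_mul IH (acvg_geometric y1).
rewrite -invfM -exprSr.
apply: (@acvg_regroup _ _ _ _ _ (fun p => p.1 + p.2)%N
  (fun n => [fset (k, n - k)%N | k in iota 0 n.+1]%fset)).
- by move=> n [k l] /mem_fset_iota[k' kn [-> ->]] /=; lia.
- move=> [k l] /negP[]; apply/mem_fset_iota; exists k; first by rewrite /=; lia.
  by congr pair; rewrite /=; lia.
move=> n; rewrite (big_fset_iota (f := fun k => (k, n - k)%N)) /=; last by move=> x z [].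
rewrite [RHS](_ : _ = \sum_(j < n.+1) 'C(i + j, i)%:R * y ^+ n); last first.
  by apply: eq_bigr => j _; rewrite -mulrA -exprD subnKC // -ltnS.
rewrite -mulr_suml -natr_sum; congr (_%:R * _).
elim: n => [|n IHn]; first by rewrite big_ord1 !addn0 !binn.
by rewrite big_ord_recr /= -IHn addnS binS -addSnnS.
Qed.

(** Taylor coefficients of log(1 + y), written as in the exponent of Delta. As 0 has inverse 0, the
    constant coefficient comes out as 0, the correct value. *)
Definition logcoef (j : nat) : C := (-1) ^+ j / - j%:R.

Lemma logcoef0 : logcoef 0 = 0.
Proof. by rewrite /logcoef oppr0 invr0 mulr0. Qed.

Lemma logcoefS j : j.+1%:R * logcoef j.+1 = (-1) ^+ j.
Proof.
rewrite /logcoef invrN mulrN exprS mulN1r mulNr opprK mulrCA divff ?mulr1 //.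
by rewrite pnatr_eq0.
Qed.

Lemma cabs_logcoef j : cabs (logcoef j) <= 1.
Proof.
case: j => [|j]; first by rewrite logcoef0 cabs0.
rewrite /logcoef cabsM cabsV cabsX !cabsN cabs1 expr1n mul1r cabs_nat.
by rewrite invf_le1 ?ltr0n // ler1n.
Qed.

Lemma bounded_cvg_series (u : nat -> R) (M : R) :
  (forall n, \sum_(i < n) `|u i| <= M) -> cvgn (series u).
Proof.
move=> bM; apply: normed_cvg; apply: nondecreasing_is_cvgn.
  by apply: nondecreasing_series => n _ _ /=; exact: normr_ge0.
by exists M => _ [n _ <-]; rewrite /= /series /= big_mkord.
Qed.

Section Log.
Variable f : C -> R.
Hypothesis fB : {morph f : x y / x - y}.
Hypothesis f_le : forall z, `|f z| <= cabs z.
Hypothesis fZ : forall (r : R) z, f (r%:C%C * z) = r * f z.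
Variables (y : C) (H : R -> R).
Hypothesis y1 : cabs y < 1.
Hypothesis H0 : H 0 = 0.
Hypothesis dH : forall t : R, 0 <= t -> t <= 1 ->
  is_derive t (1 : R) H (f (y / (1 + t%:C%C * y))).

Let f0 : f 0 = 0.
Proof. by rewrite -(subrr 0) fB subrr. Qed.

Let f_sum n (z : 'I_n -> C) : f (\sum_(i < n) z i) = \sum_(i < n) f (z i).
Proof.
apply: (big_morph f _ f0) => x w.
by rewrite -[in LHS](opprK w) fB -[in LHS](sub0r w) fB f0 sub0r opprK.
Qed.

(** Here [f] is the real or the imaginary part and [H] the same part of t -> log(1 + t y). The
    series in t and [H] agree at 0 and have equal derivatives on [0, 1], so they agree at 1 by the
    mean value theorem. *)
Lemma log_series_part :
  series (fun j => f (logcoef j * y ^+ j)) @ \oo --> H 1.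
Proof.
pose r := cabs y; have r0 : 0 <= r := cabs_ge0 y; have r1 : r < 1 := y1.
(* A point beyond 1 with r K < 1: convergence at K permits differentiation term by term on all of
   [0, 1], the endpoint included. *)
pose K : R := 2%:R / (1 + r).
have K1 : 1 < K by rewrite ltr_pdivlMr ?mul1r; lra.
have rK : r * K < 1.
  by rewrite mulrA ltr_pdivrMr; lra.
have rK0 : 0 <= r * K by rewrite mulr_ge0 // ltW // (lt_trans _ K1).
have K0 : 0 <= K by lra.
(* One majorant for the series and its first two formal derivatives at K. *)
have [M bM] : exists M : R, forall n, \sum_(i < n) i.+1%:R * (r * K) ^+ i <= M.
  have : cabs ((r * K)%:C%C : C) < 1.
    by rewrite /cabs ger0_norm //= ler0c.
  move=> /(acvg_binomial 1)/acvg_nat_bound[M bM]; exists M => n.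
  apply: le_trans (bM n); apply: ler_sum => i _.
  rewrite cabsM cabs_nat cabsX [cabs (_)%:C%C]/cabs ger0_norm ?ler0c //=.
  by rewrite bin1 add1n.
pose c j := f (logcoef j * y ^+ j).
have dcE j : pseries_diffs c j = f ((-1) ^+ j * y ^+ j.+1).
  rewrite /pseries_diffs /c -fZ mulrA; congr (f (_ * _)).
  by rewrite rmorph_nat logcoefS.
have cvK (v : nat -> R) : (forall j, `|v j| <= j.+1%:R * r ^+ j) ->
    cvgn (pseries v K).
  move=> hv; apply: (@bounded_cvg_series _ M) => n; apply: le_trans (bM n).
  apply: ler_sum => i _; rewrite normrM normrX (ger0_norm K0) [(r * K) ^+ i]exprMn [leRHS]mulrA.
  by rewrite ler_wpM2r ?exprn_ge0.
have c1 : cvgn (pseries c K).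
  apply: cvK => j; apply: le_trans (f_le _) _; rewrite cabsM cabsX -/r.
  rewrite ler_wpM2r ?exprn_ge0 //; apply: le_trans (cabs_logcoef _) _.
  by rewrite ler1n.
have yS j : cabs ((-1) ^+ j * y ^+ j.+1) <= r ^+ j.
  rewrite cabsM !cabsX cabsN cabs1 expr1n mul1r -/r exprS.
  by rewrite ler_piMl ?exprn_ge0 // ltW.
have c2 : cvgn (pseries (pseries_diffs c) K).
  apply: cvK => j; rewrite dcE; apply: le_trans (f_le _) _.
  by apply: le_trans (yS j) _; rewrite ler_peMl ?exprn_ge0 // ler1n.
have c3 : cvgn (pseries (pseries_diffs (pseries_diffs c)) K).
  apply: cvK => j; rewrite {1}/pseries_diffs dcE normrM normr_nat.
  rewrite ler_wpM2l ?ler0n //; apply: le_trans (f_le _) _.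
  apply: le_trans (yS j.+1) _; rewrite exprS ler_piMl ?exprn_ge0 //.
  exact: ltW.
pose F t := limn (pseries c t).
have dF (t : R) : 0 <= t -> t <= 1 ->
    is_derive t (1 : R) F (f (y / (1 + t%:C%C * y))).
  move=> t0 t1; have tK : `|t| < `|K|.
    by rewrite !ger0_norm // (le_lt_trans t1).
  have := pseries_snd_diffs c1 c2 c3 tK.
  congr is_derive; apply/cvg_lim => //.
  (* The differentiated series is the image under [f] of y times the geometric series in -t y. *)
  have ty : cabs (- (t%:C%C * y)) < 1.
    rewrite cabsN cabsM [cabs (_)%:C%C]/cabs ger0_norm ?ler0c //=.
    by apply: le_lt_trans y1; rewrite ler_piMl ?cabs_ge0.
  have := acvgZ y (acvg_geometric ty); rewrite opprK => /acvg_nat_cvg cv.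
  apply/cvgrPdist_lt => e e0; have [N hN] := cv _ e0.
  exists N => // n Nn; rewrite distrC; apply: le_lt_trans (hN n Nn).
  apply: le_trans (f_le _); rewrite fB f_sum /pseries /series /=.
  rewrite big_mkord le_eqVlt; apply/orP; left; apply/eqP; congr (`|_ - _|).
  apply: eq_bigr => j _; rewrite dcE [LHS]mulrC -fZ; congr (f _).
  by rewrite [in RHS]exprNn exprMn rmorphXn exprS; ring.
have F0 : F 0 = 0.
  apply/cvg_lim => //; apply/cvgrPdist_lt => e e0; exists 0%N => // n _.
  rewrite /pseries /series /= big_mkord big1 ?subrr ?normr0 // => j _.
  by case: (val j) => [|k]; rewrite ?expr0n ?mulr0 // /c logcoef0 mul0r f0 mul0r.
have dFH (t : R) : 0 <= t -> t <= 1 -> is_derive t (1 : R) (F - H) 0.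
  move=> t0 t1; rewrite -(subrr (f (y / (1 + t%:C%C * y)))).
  have ? := dF t t0 t1; have ? := dH t0 t1; exact: is_deriveB.
have [| |z _] := @MVT _ (F - H) (fun=> 0) 0 1 ltr01.
- by move=> t; rewrite in_itv /= => /andP[/ltW ? /ltW ?]; exact: dFH.
- apply: derivable_within_continuous => t; rewrite in_itv /= => /andP[h1 h2].
  by have [] := dFH t h1 h2.
rewrite mul0r /= -[X in X = _]/(F 1 - H 1 - (F 0 - H 0)) F0 H0 subrr subr0.
move=> /eqP; rewrite subr_eq0 => /eqP <-.
have := is_cvg_pseries_inside c1 (_ : `|1| < `|K|).
rewrite normr1 ger0_norm // => /(_ K1) cv1.
have -> : series (fun j => f (logcoef j * y ^+ j)) = pseries c 1.
  by apply/funext => n; apply: eq_bigr => j _ /=; rewrite expr1n mulr1.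
exact: cv1.
Qed.

End Log.

(** Since 1 + y has positive real part, the bound on Im L singles out the principal logarithm, whose
    imaginary part is an arctangent. *)
Lemma acvg_log (y L : C) : cabs y < 1 -> cexp L = 1 + y ->
  `|complex.Im L| < pi / 2%:R -> acvg (fun j => logcoef j * y ^+ j) L.
Proof.
case: y L => [a b] [l m] y1 eL /= mpi.
have a1 : `|a| < 1 by apply: le_lt_trans y1; exact: (ler_Re_cabs (Complex a b)).
have [e1 e2] : expR l * cos m = 1 + a /\ expR l * sin m = b.
  by move: eL; rewrite /cexp /= => -[-> ->]; rewrite add0r.
have pa (t : R) : 0 <= t -> t <= 1 -> 0 < 1 + t * a.
  by move: a1; rewrite ltr_norml => /andP[? ?] ? ?; nra.
have pD (t : R) : 0 <= t -> t <= 1 -> 0 < (1 + t * a) ^+ 2 + (t * b) ^+ 2.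
  by move=> t0 t1; rewrite ltr_wpDr ?sqr_ge0 // exprn_gt0 // pa.
have yE (t : R) : Complex a b / (1 + t%:C%C * Complex a b) =
   Complex ((a * (1 + t * a) + b * (t * b)) / ((1 + t * a) ^+ 2 + (t * b) ^+ 2))
           (b / ((1 + t * a) ^+ 2 + (t * b) ^+ 2)).
  rewrite [(1 + _)](_ : _ = Complex (1 + t * a) (t * b)); last first.
    by apply/eqP; rewrite eq_complex /=; apply/andP; split; apply/eqP; ring.
  by apply/eqP; rewrite eq_complex /=; apply/andP; split; apply/eqP; ring.
(* [Hr] and [Hi] are the real and imaginary parts of the principal logarithm of 1 + t y. *)
pose Hr (t : R) := 2%:R^-1 * ln ((1 + t * a) ^+ 2 + (t * b) ^+ 2).
pose Hi (t : R) := atan (t * b / (1 + t * a)).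
have cr : series (fun j => complex.Re (logcoef j * Complex a b ^+ j)) @ \oo --> Hr 1.
  apply: (@log_series_part (@complex.Re R) _ _ _ (Complex a b) Hr) => //.
  - by case=> ? ? [].
  - exact: ler_Re_cabs.
  - by move=> r [z1 z2] /=; rewrite mul0r subr0.
  - by rewrite /Hr !mul0r addr0 expr0n expr1n addr0 ln1 mulr0.
  move=> t t0 t1; rewrite yE /=.
  have D0 := pD t t0 t1.
  have dD : is_derive t (1 : R) (fun t : R => (1 + t * a) ^+ 2 + (t * b) ^+ 2)
      (2%:R * (a * (1 + t * a) + b * (t * b))).
    apply: is_derive_eq; rewrite /GRing.scale /= ; ring.
  have dl := is_derive1_ln D0.
  have dz := is_deriveZ 2%:R^-1 (@is_derive1_comp _ (@ln R)
    (fun t : R => (1 + t * a) ^+ 2 + (t * b) ^+ 2) _ _ _ dl dD).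
  apply: (@is_derive_eq _ _ _ Hr _ _ _ _ dz).
  by rewrite /GRing.scale /=; field; rewrite lt0r_neq0.
have ci : series (fun j => complex.Im (logcoef j * Complex a b ^+ j)) @ \oo --> Hi 1.
  apply: (@log_series_part (@complex.Im R) _ _ _ (Complex a b) Hi) => //.
  - by case=> ? ? [].
  - exact: ler_Im_cabs.
  - by move=> r [z1 z2] /=; rewrite mul0r addr0.
  - by rewrite /Hi !mul0r atan0.
  move=> t t0 t1; rewrite yE /=.
  have D0 := pD t t0 t1; have p0 := pa t t0 t1.
  have dn : is_derive t (1 : R) (fun t : R => t * b) b.
    by apply: is_derive_eq; rewrite /GRing.scale /=; ring.
  have dd : is_derive t (1 : R) (fun t : R => 1 + t * a) a.
    by apply: is_derive_eq; rewrite /GRing.scale /=; ring.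
  have dq := is_deriveM dn (@is_deriveV _ (fun t : R => 1 + t * a) _ _ _ (lt0r_neq0 p0) dd).
  have dz := @is_derive1_comp _ (@atan R) (fun t : R => t * b / (1 + t * a)) _ _ _
    (is_derive1_atan _) dq.
  apply: (@is_derive_eq _ _ _ Hi _ _ _ _ dz).
  by rewrite /GRing.scale /=; field; rewrite !lt0r_neq0.
have Hr1 : Hr 1 = l.
  rewrite /Hr !mul1r -e1 -e2 !exprMn -mulrDr cos2Dsin2 mulr1 lnXn ?expR_gt0 //.
  by rewrite expRK mulr2n; field.
have Hi1 : Hi 1 = m.
  rewrite /Hi !mul1r -e1 -e2 -mulf_div divff ?mul1r; last by rewrite gt_eqF ?expR_gt0.
  by rewrite tanK // in_itv /= -ltr_norml.
rewrite Hr1 in cr; rewrite Hi1 in ci.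
have [M bM] := acvg_nat_bound (acvg_geometric y1).
apply: (@asummable_nat_acvg _ _ _ M).
  move=> n; apply: le_trans (bM n); apply: ler_sum => i _.
  by rewrite cabsM ler_piMl ?cabs_ge0 // cabs_logcoef.
move=> e e0; have h0 : 0 < e / 2%:R by rewrite divr_gt0.
move/cvgrPdist_lt: cr => /(_ _ h0) [N1 _ h1].
move/cvgrPdist_lt: ci => /(_ _ h0) [N2 _ h2].
exists (maxn N1 N2) => n; rewrite geq_max => /andP[/h1 l1 /h2 l2].
apply: le_lt_trans (ler_cabs_ReIm _) _.
have -> : e = e / 2%:R + e / 2%:R by field.
rewrite !raddfB /= !raddf_sum /= distrC [X in _ + X < _]distrC.
by move: l1 l2; rewrite /= /series /= !big_mkord => l1 l2; exact: ltrD.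
Qed.

End Series.

(** * Correlation functions *)

Section Correlation.
Variable R : realType.
Local Notation C := R[i].

(* the coefficients of log x and of x^-j, j >= 1, in the modified operators, on
   the branch log x = l *)
Definition logmono (j : nat) (l : C) : C :=
  if j is 0 then l else logcoef R j * cexp l ^- j.

Lemma acvg_nat_fin (a : nat -> C) K : (forall j, (K <= j)%N -> a j = 0) ->
  acvg a (\sum_(j < K) a j).
Proof.
move=> h; rewrite -(big_fset_iota K a (@inj_id nat)); apply: acvg_fset => i iK.
apply: h; rewrite leqNgt; apply: contra iK => ik.
by apply/mem_fset_iota; exists i.
Qed.

(** [logmono i] is the i-th derivative of the logarithm divided by i!, and this is its Taylor
    expansion at exp l2. For i = 0 it is the logarithmic series, where the bound on the imaginary
    part decides which logarithm l1 results; for i > 0 it is a binomial series. Truncated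
    subtraction in j - i is harmless, as the binomial coefficient vanishes for j < i. *)
Lemma acvg_logmono i (l1 l2 z : C) : cexp l1 = cexp l2 + z ->
  cabs z < cabs (cexp l2) -> `|complex.Im (l1 - l2)| < pi / 2%:R ->
  acvg (fun j => logmono j l2 * 'C(j, i)%:R * z ^+ (j - i)) (logmono i l1).
Proof.
move=> e12 zl im; have l20 := cexp_neq0 l2.
set z2 := cexp l2 in e12 zl l20 *.
have y1 : cabs (z / z2) < 1.
  by rewrite cabsM cabsV ltr_pdivrMr ?mul1r // lt_neqAle eq_sym cabs_eq0 l20 cabs_ge0.
case: i => [|i].
  have eL : cexp (l1 - l2) = 1 + z / z2 by rewrite cexpD cexpN e12 -/z2 mulrDl divff.
  have -> : logmono 0 l1 = \sum_(j < 1) l2 + (l1 - l2).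
    by rewrite big_ord1 /= addrC subrK.
  have c0 := @acvg_nat_fin (fun j => if j is 0 then l2 else 0) 1 ltac:(by case).
  have := acvgD c0 (acvg_log y1 eL im); rewrite !big_ord1.
  congr acvg; apply/funext => -[|j] /=.
    by rewrite logcoef0 mul0r addr0 bin0 mulr1 mulr1.
  by rewrite add0r bin0 mulr1 subn0 exprMn exprVn -/z2; ring.
have y2 : cabs (- (z / z2)) < 1 by rewrite cabsN.
have := acvgZ (logcoef R i.+1 * z2 ^- i.+1) (acvg_binomial i y2).
have -> : logcoef R i.+1 * z2 ^- i.+1 * (1 - - (z / z2)) ^- i.+1 = logmono i.+1 l1.
  rewrite /= opprK e12 -/z2 -mulrA -invfM -exprMn mulrDr mulr1.
  by rewrite [z2 * (z / z2)]mulrCA divff ?mulr1.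
apply: (@acvg_inj _ _ _ _ _ (fun n => i.+1 + n)%N).
- by move=> m n /addnI.
- move=> n; rewrite [logmono _ _]/= -/z2 addKn.
  (* Absorption turns the factor 1 / (i + 1 + n) of the logarithmic coefficient into 1 / (i + 1). *)
  have e : (i.+1 + n)%:R * 'C(i + n, i)%:R = i.+1%:R * 'C(i.+1 + n, i.+1)%:R :> C.
    by rewrite -!natrM addSn mul_bin_diag.
  rewrite /logcoef [(- (_ / _)) ^+ n]exprNn !exprMn exprVn !exprD !exprS.
  have n1 : (i.+1 + n)%:R != 0 :> C by rewrite pnatr_eq0 addSn.
  have n2 : i.+1%:R != 0 :> C by rewrite pnatr_eq0.
  have -> : 'C(i.+1 + n, i.+1)%:R = (i.+1 + n)%:R * 'C(i + n, i)%:R / i.+1%:R :> C.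
    by rewrite e mulrC mulKf.
  by field; rewrite !expf_neq0 // l20 nat1r n2 -natrD n1.

move=> j ne; rewrite bin_small ?mulr0 ?mul0r // ltnNge; apply/negP => ij.
by apply: (ne (j - i.+1)%N); rewrite subnKC.
Qed.

Lemma gbinom_nat (m i : nat) : gbinom R m%:Z i = 'C(m, i)%:R.
Proof.
rewrite /gbinom; apply: (@mulIf _ (i`!)%:R); first by rewrite pnatr_eq0 -lt0n fact_gt0.
rewrite mulfVK ?pnatr_eq0 -?lt0n ?fact_gt0 // -natrM bin_ffact.
elim: i => [|i IH]; first by rewrite big_ord0.
rewrite big_ord_recr /= IH ffactnSr natrM; case: (leqP i m) => im.
  by rewrite natrB.
by rewrite ffact_small // !mul0r.
Qed.

Lemma gbinom_Negz (j i : nat) : gbinom R (Negz j) i = (-1) ^+ i * 'C(i + j, i)%:R.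
Proof.
rewrite /gbinom; apply: (@mulIf _ (i`!)%:R); first by rewrite pnatr_eq0 -lt0n fact_gt0.
rewrite mulfVK ?pnatr_eq0 -?lt0n ?fact_gt0 // -mulrA -natrM.
apply: (@mulIf _ (j`!)%:R); first by rewrite pnatr_eq0 -lt0n fact_gt0.
have bf : ('C(i + j, i) * (i`! * j`!) = (i + j)`!)%N.
  by rewrite -[in RHS](bin_fact (leq_addr j i)) addKn.
rewrite -mulrA -natrM -mulnA bf {bf}.
elim: i => [|i IH]; first by rewrite big_ord0 !mul1r.
rewrite big_ord_recr /= mulrAC IH addSn factS natrM exprS NegzE mulrNz.
by rewrite -pmulrn -[(i + j).+1]addnS natrD; ring.
Qed.

(** To be used with the matrix coefficients [M m] of a_m b_(e-m), [M' m] of b_(e-m) a_m and [I l] of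
    (a_l b)_(e-l). K bounds all truncations; [hcomm] and [hiter] are the commutator and the iterate
    formula. *)
Variables (M M' I : int -> C) (K : nat) (e : int).
Hypothesis hM : forall n : nat, (K <= n)%N -> M (Negz n) = 0.
Hypothesis hM' : forall n : nat, (K <= n)%N -> M' n%:Z = 0.
Hypothesis hI : forall n : nat, (K <= n)%N -> I n%:Z = 0.
Hypothesis hcomm : forall m, M m - M' m = \sum_(i < K) gbinom R m i * I i%:Z.
Hypothesis hiter : forall j : nat, I (Negz j) =
  \sum_(i < K) (-1) ^+ i * gbinom R (Negz j) i *
    (M (Negz j - i%:Z) - (-1) ^ (Negz j) * M' i%:Z).

(* the common rational function: its polynomial part in z1, its principal part
   at z1 = 0 and its principal part at z1 = z2 *)
Definition correlation (z1 z2 : C) : C :=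
  \sum_(j < K) M (Negz j) * z1 ^ j%:Z * z2 ^ (Negz j - e - 1)
  + \sum_(j < K) M' j%:Z * z1 ^ Negz j * z2 ^ (j%:Z - e - 1)
  + \sum_(i < K) I i%:Z * z2 ^ (i%:Z - e - 1) * (z1 - z2) ^- i.+1.

(** Negative m give the polynomial part in z1. For m >= 0 the commutator formula replaces M by the
    finitely supported M' plus binomial multiples of [I i], which expand (z1 - z2)^-(i+1) in powers
    of z2 / z1. *)
Lemma correlation_product (z1 z2 : C) : z2 != 0 -> cabs z2 < cabs z1 ->
  acvg (fun m => M m * z1 ^ (- m - 1) * z2 ^ (m - e - 1)) (correlation z1 z2).
Proof.
move=> z20 lt; have z10 : z1 != 0.
  by rewrite -cabs_eq0 gt_eqF // (le_lt_trans (cabs_ge0 _) lt).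
have y1 : cabs (z2 / z1) < 1.
  by rewrite cabsM cabsV ltr_pdivrMr ?mul1r // lt_neqAle eq_sym cabs_eq0 z10 cabs_ge0.
rewrite /correlation -addrA addrC; apply: acvg_int; last first.
  rewrite (_ : (fun n => _) = fun n => M (Negz n) * z1 ^ n%:Z * z2 ^ (Negz n - e - 1)).
    by apply: acvg_nat_fin => n /hM ->; rewrite !mul0r.
  by apply/funext => n; congr (_ * z1 ^ _ * _); lia.
rewrite (_ : (fun n => _) = fun n : nat =>
    M' n%:Z * z1 ^ Negz n * z2 ^ (n%:Z - e - 1)
    + \sum_(i < K) 'C(n, i)%:R * I i%:Z * z1 ^ Negz n * z2 ^ (n%:Z - e - 1)); last first.
  apply/funext => n.
  have -> : M n%:Z = M' n%:Z + \sum_(i < K) 'C(n, i)%:R * I i%:Z.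
    rewrite -[LHS](subrK (M' n%:Z)) hcomm addrC; congr (_ + _).
    by apply: eq_bigr => i _; rewrite gbinom_nat.
  have -> : - n%:Z - 1 = Negz n by lia.
  by rewrite !mulrDl !mulr_suml.
apply: acvgD; first by apply: acvg_nat_fin => n /hM' ->; rewrite !mul0r.
apply: acvg_sum => i _.
have := acvgZ (I i%:Z * z1 ^- i.+1 * z2 ^ (i%:Z - e - 1)) (acvg_binomial i y1).
have -> : I i%:Z * z1 ^- i.+1 * z2 ^ (i%:Z - e - 1) * (1 - z2 / z1) ^- i.+1 =
    I i%:Z * z2 ^ (i%:Z - e - 1) * (z1 - z2) ^- i.+1.
  rewrite -[in RHS](mulfVK z10 (z1 - z2)) mulrBl divff // exprMn invfM; ring.
apply: (@acvg_inj _ _ _ _ _ (fun n => i + n)%N).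
- by move=> m n /addnI.
- move=> n.
  have -> : Negz (i + n) = (- i.+1%:Z) + (- n%:Z) by lia.
  have -> : (i + n)%:Z - e - 1 = (i%:Z - e - 1) + n%:Z by lia.
  rewrite !expfzDr // -!exprnN -!exprnP exprMn exprVn; ring.
move=> j ne; rewrite bin_small ?mul0r // ltnNge; apply/negP => ij.
by apply: (ne (j - i)%N); rewrite subnKC.
Qed.

(** Now the commutator formula is applied for m < 0, and (z1 - z2)^-(i+1) is expanded in powers of
    z1 / z2. *)
Lemma correlation_product_swap (z1 z2 : C) : z1 != 0 -> cabs z1 < cabs z2 ->
  acvg (fun m => M' m * z1 ^ (- m - 1) * z2 ^ (m - e - 1)) (correlation z1 z2).
Proof.
move=> z10 lt; have z20 : z2 != 0.
  by rewrite -cabs_eq0 gt_eqF // (le_lt_trans (cabs_ge0 _) lt).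
have y1 : cabs (z1 / z2) < 1.
  by rewrite cabsM cabsV ltr_pdivrMr ?mul1r // lt_neqAle eq_sym cabs_eq0 z20 cabs_ge0.
rewrite /correlation addrAC addrC; apply: acvg_int.
  rewrite (_ : (fun n => _) = fun n : nat => M' n%:Z * z1 ^ Negz n * z2 ^ (n%:Z - e - 1)).
    by apply: acvg_nat_fin => n /hM' ->; rewrite !mul0r.
  by apply/funext => n; congr (_ * z1 ^ _ * _); lia.
rewrite (_ : (fun n => _) = fun n : nat =>
    M (Negz n) * z1 ^ n%:Z * z2 ^ (Negz n - e - 1)
    + \sum_(i < K) - ((-1) ^+ i * 'C(i + n, i)%:R * I i%:Z) * z1 ^ n%:Z
        * z2 ^ (Negz n - e - 1)); last first.
  apply/funext => n.
  have -> : M' (Negz n) =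
      M (Negz n) + \sum_(i < K) - ((-1) ^+ i * 'C(i + n, i)%:R * I i%:Z).
    rewrite -[LHS](subKr (M (Negz n))) hcomm sumrN; congr (_ - _).
    by apply: eq_bigr => i _; rewrite gbinom_Negz.
  have -> : - Negz n - 1 = n%:Z by lia.
  by rewrite !mulrDl !mulr_suml.
apply: acvgD; first by apply: acvg_nat_fin => n /hM ->; rewrite !mul0r.
apply: acvg_sum => i _.
have := acvgZ (- ((-1) ^+ i * I i%:Z * z2 ^ (- 2%:Z - e))) (acvg_binomial i y1).
have -> : - ((-1) ^+ i * I i%:Z * z2 ^ (- 2%:Z - e)) * (1 - z1 / z2) ^- i.+1 =
    I i%:Z * z2 ^ (i%:Z - e - 1) * (z1 - z2) ^- i.+1.
  have -> : z1 - z2 = - z2 * (1 - z1 / z2) by rewrite mulrBr mulr1; field.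
  have -> : i%:Z - e - 1 = (- 2%:Z - e) + i.+1%:Z by lia.
  rewrite (expfzDr (- 2%:Z - e) i.+1%:Z z20) -exprnP exprMn [(- z2) ^+ _]exprNn !invfM.
  move: (z2 ^ (- 2%:Z - e)) ((1 - z1 / z2) ^+ i.+1) => a b.
  rewrite -[(-1) ^- _]exprVn invrN1 [(-1) ^+ i.+1]exprS.
  have zi : z2 ^+ i.+1 != 0 by rewrite expf_neq0.
  by move: (z2 ^+ i.+1) (b^-1) zi => c b' c0; field.
congr acvg; apply/funext => n.
have -> : Negz n - e - 1 = (- 2%:Z - e) + (- n%:Z) by lia.
rewrite (expfzDr (- 2%:Z - e) (- n%:Z) z20) -exprnN -exprnP exprMn exprVn; ring.
Qed.

(** Nonnegative l give the pole at z1 = z2. For l < 0 the iterate formula yields M-terms, which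
    rebuild the powers of z1 = z0 + z2 by the binomial theorem, and M'-terms, which expand z1^-(i+1)
    in powers of z0 / z2. *)
Lemma correlation_iterate (z1 z2 : C) : z1 != z2 -> cabs (z1 - z2) < cabs z2 ->
  acvg (fun l => I l * (z1 - z2) ^ (- l - 1) * z2 ^ (l - e - 1)) (correlation z1 z2).
Proof.
rewrite -subr_eq0 => z00 lt; have z20 : z2 != 0.
  by rewrite -cabs_eq0 gt_eqF // (le_lt_trans (cabs_ge0 _) lt).
have ->: z1 = (z1 - z2) + z2 by rewrite subrK.
move: (z1 - z2) z00 lt => z0 z00 lt.
have y1 : cabs (- (z0 / z2)) < 1.
  by rewrite cabsN cabsM cabsV ltr_pdivrMr ?mul1r // lt_neqAle eq_sym cabs_eq0 z20 cabs_ge0.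
rewrite /correlation addrK [X in acvg _ X]addrC; apply: acvg_int.
  rewrite (_ : (fun n => _) = fun n : nat => I n%:Z * z2 ^ (n%:Z - e - 1) * z0 ^- n.+1).
    by apply: acvg_nat_fin => n /hI ->; rewrite !mul0r.
  apply/funext => n; have -> : - n%:Z - 1 = - n.+1%:Z by lia.
  by rewrite -exprnN mulrAC.
rewrite (_ : (fun n => _) = fun n : nat =>
    (\sum_(i < K) 'C(i + n, i)%:R * M (Negz (i + n)) * z0 ^+ n * z2 ^ (Negz n - e - 1))
    + \sum_(i < K) (M' i%:Z * z2 ^ (- 2%:Z - e)) * ('C(i + n, i)%:R * (- (z0 / z2)) ^+ n));
    last first.
  apply/funext => n; rewrite hiter !mulr_suml -big_split; apply: eq_bigr => i _ /=.
  have -> : - Negz n - 1 = n%:Z by lia.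
  have -> : Negz n - i%:Z = Negz (i + n) by lia.
  rewrite gbinom_Negz mulrA -expr2 sqrr_sign mul1r.
  have -> : Negz n - e - 1 = (- 2%:Z - e) + (- n%:Z) by lia.
  rewrite (expfzDr (- 2%:Z - e) (- n%:Z) z20) -exprnN -exprnP [(- (z0 / z2)) ^+ n]exprNn exprMn exprVn.
  have -> : (-1) ^ (Negz n) = - (-1) ^+ n :> C.
    by rewrite NegzE -exprnN -exprVn invrN1 exprS mulN1r.
  by ring.
apply: acvgD; last first.
  apply: acvg_sum => i _; have := acvgZ (M' i%:Z * z2 ^ (- 2%:Z - e)) (acvg_binomial i y1).
  congr acvg; rewrite -!mulrA; congr (_ * _); rewrite opprK NegzE -exprnN.
  have -> : z0 + z2 = z2 * (1 + z0 / z2) by field.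
  have -> : i%:Z - e - 1 = (- 2%:Z - e) + i.+1%:Z by lia.
  rewrite (expfzDr (- 2%:Z - e) i.+1%:Z z20) -exprnP exprMn invfM.
  have zi : z2 ^+ i.+1 != 0 by rewrite expf_neq0.
  move: (z2 ^+ i.+1) (z2 ^ (- 2%:Z - e)) (((1 + z0 / z2) ^+ i.+1)^-1) zi => c a b' c0.
  by field.
rewrite (_ : \sum_(j < K) _ = \sum_(n < K) \sum_(i < K)
   'C(i + n, i)%:R * M (Negz (i + n)) * z0 ^+ n * z2 ^ (Negz n - e - 1)).
  apply: acvg_nat_fin => n Kn; apply: big1 => i _.
  by rewrite hM ?mulr0 ?mul0r // (leq_trans Kn) // leq_addl.
pose t i n := 'C(i + n, i)%:R * z0 ^+ n * z2 ^+ i.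
pose c m := M (Negz m) * z2 ^ (Negz m - e - 1).
have c0 m : (K <= m)%N -> c m = 0 by rewrite /c => /hM ->; rewrite mul0r.
transitivity (\sum_(n < K) \sum_(i < K) c (i + n)%N * t i n); last first.
  apply: eq_bigr => n _; apply: eq_bigr => i _; rewrite /c /t.
  have -> : Negz n - e - 1 = (Negz (i + n) - e - 1) + i%:Z by lia.
  by rewrite (expfzDr (Negz (i + n) - e - 1) i%:Z z20) -exprnP; ring.
transitivity (\sum_(m < K) c m * (z0 + z2) ^+ m).
  by apply: eq_bigr => m _; rewrite /c -exprnP; ring.
(* Terms are collected by m = i + n. Those with m >= K vanish, so the square range of (i, n) may be
   traded for the triangle n <= m < K. *)
have tr n : (n < K)%N ->
    \sum_(i < K) c (i + n)%N * t i n = \sum_(m < K) if (n <= m)%N then c m * t (m - n)%N n else 0.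
  move=> nK; rewrite -(big_mkord xpredT (fun i => c (i + n)%N * t i n)).
  rewrite -(big_mkord xpredT (fun m => if (n <= m)%N then c m * t (m - n)%N n else 0)).
  rewrite (@big_cat_nat _ _ _ (K - n) 0 K) /= ?leq_subr //.
  rewrite [X in _ + X]big_nat_cond [X in _ + X]big1 ?addr0; last first.
    by move=> i /andP[/andP[h _] _]; rewrite c0 ?mul0r //; lia.
  rewrite [RHS](@big_cat_nat _ _ _ n 0 K) ?(ltnW nK) //=.
  rewrite [X in _ = X + _]big_nat_cond [X in _ = X + _]big1 ?add0r; last first.
    by move=> m /andP[/andP[_ h] _]; rewrite leqNgt h.
  rewrite [RHS](big_addn 0 K n xpredT); apply: eq_big_nat => i _.
  by rewrite leq_addl addnK.
under [RHS]eq_bigr => n _ do rewrite tr //.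
rewrite exchange_big /=; apply: eq_bigr => m _.
rewrite exprDn_comm; last exact: mulrC.
rewrite mulr_sumr.
rewrite -(big_mkord xpredT (fun n => if (n <= m)%N then c m * t (m - n)%N n else 0)).
rewrite (@big_cat_nat _ _ _ m.+1 0 K) //= [X in _ = _ + X]big_nat_cond.
rewrite [X in _ = _ + X]big1 ?addr0; last first.
  by move=> n /andP[/andP[h _] _]; rewrite leqNgt h.
rewrite big_mkord [RHS](reindex_inj rev_ord_inj) /=; apply: eq_bigr => i _.
rewrite subSS leq_subr /t.
have im : (i <= m)%N by rewrite -ltnS.
by rewrite subKn // subnKC // -mulr_natl; ring.
Qed.

End Correlation.

(** * Gradings and generalized eigenspaces *)

Section FiniteSums.
Variables (I : choiceType) (V : nmodType).

Lemma fsum_fset (F : I -> V) (X : {fset I}) : (forall i, i \notin X -> F i = 0) ->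
  \sum_(i \in [set: I]) F i = \sum_(i <- X) F i.
Proof. exact: fsbigTE. Qed.

Lemma fsum_at (F : I -> V) i0 : (forall i, i != i0 -> F i = 0) ->
  \sum_(i \in [set: I]) F i = F i0.
Proof.
move=> h; rewrite (fsum_fset (X := [fset i0]%fset)) ?big_seq_fset1 // => i.
by rewrite inE => /h.
Qed.

Lemma fsum_0 (F : I -> V) : (forall i, F i = 0) -> \sum_(i \in [set: I]) F i = 0.
Proof. by move=> h; apply: fsbig1. Qed.

Lemma fsum_inj (J : choiceType) (h : J -> I) (X : {fset J}) (F : I -> V) :
  injective h -> (forall i, (forall j, j \in X -> i <> h j) -> F i = 0) ->
  \sum_(i \in [set: I]) F i = \sum_(j <- X) F (h j).
Proof.
move=> hi h0; rewrite (fsum_fset (X := [fset h j | j in X]%fset)).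
  by rewrite big_imfset //= => x y _ _; apply: hi.
by move=> i /imfsetP ni; apply: h0 => j jX e; apply: ni; exists j.
Qed.

End FiniteSums.

Lemma fsum_ord (V : nmodType) (F : nat -> V) K : (forall n, (K <= n)%N -> F n = 0) ->
  \sum_(i \in [set: nat]) F i = \sum_(i < K) F i.
Proof.
move=> h; rewrite (fsum_fset (X := [fset i | i in iota 0 K]%fset)) => [|i iK].
  exact: (big_fset_iota K F (@inj_id nat)).
apply: h; rewrite leqNgt; apply: contra iK => ik.
by apply/mem_fset_iota; exists i.
Qed.

Section LinearMaps.
Variables (K : pzRingType) (U W : lmodType K) (f : U -> W).
Hypothesis fL : linear f.

Lemma lin0 : f 0 = 0.
Proof. by have := fL (-1) 0 0; rewrite scaler0 addr0 scaleN1r addNr. Qed.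

Lemma linD x y : f (x + y) = f x + f y.
Proof. by rewrite -[x]scale1r fL !scale1r. Qed.

Lemma linZ a x : f (a *: x) = a *: f x.
Proof. by rewrite -[a *: x]addr0 fL lin0 addr0. Qed.

Lemma linN x : f (- x) = - f x.
Proof. by rewrite -scaleN1r linZ scaleN1r. Qed.

Lemma linB x y : f (x - y) = f x - f y.
Proof. by rewrite linD linN. Qed.

Lemma lin_sum (I : Type) (r : seq I) (P : pred I) (F : I -> U) :
  f (\sum_(i <- r | P i) F i) = \sum_(i <- r | P i) f (F i).
Proof. exact: (big_morph f linD lin0). Qed.

End LinearMaps.

Lemma lin_iter (K : pzRingType) (W : lmodType K) (f : W -> W) n :
  linear f -> linear (iter n f).
Proof. by move=> fL a x y; elim: n => [//|n IH] /=; rewrite IH fL. Qed.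

Section Gradings.
Variables (R : realType) (W : lmodType R[i]).
Local Notation C := R[i].

Lemma subspaceD (S : set W) x y : subspace S -> S x -> S y -> S (x + y).
Proof. by move=> [_ h] sx sy; rewrite -[x]scale1r; apply: h. Qed.

Lemma subspaceZ (S : set W) a x : subspace S -> S x -> S (a *: x).
Proof. by move=> [h0 h] sx; rewrite -[_ *: _]addr0; apply: h. Qed.

Lemma subspace_sum (S : set W) (I : Type) (r : seq I) (P : pred I) (F : I -> W) :
  subspace S -> (forall i, P i -> S (F i)) -> S (\sum_(i <- r | P i) F i).
Proof.
move=> Ss h; elim/big_ind: _ => //; first by case: Ss.
by move=> x y; apply: subspaceD.
Qed.

Section OneGrading.
Variables (I : choiceType) (S : I -> set W).

Lemma decomp_fset w c : decomp S w c ->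
  exists F : {fset I}, (forall i, i \notin F -> c i = 0) /\ \sum_(i <- F) c i = w.
Proof.
move=> [fc Sc <-]; exists (fset_set [set i | c i != 0]).
have h i : i \notin fset_set [set i | c i != 0] -> c i = 0.
  by rewrite in_fset_set // notin_setE /= => /negP; rewrite negbK => /eqP.
by split=> //; rewrite (fsum_fset h).
Qed.

Lemma fset_decomp w c (F : {fset I}) : (forall i, S i (c i)) ->
  (forall i, i \notin F -> c i = 0) -> \sum_(i <- F) c i = w -> decomp S w c.
Proof.
move=> Sc cF <-; split=> //; last exact: fsum_fset.
by apply: (finite_subfset F) => i /=; apply: contraNT => /cF ->; rewrite eqxx.
Qed.

Lemma gradingP : is_grading S <->
  [/\ forall i, subspace (S i),
      (forall w, exists (F : {fset I}) (c : I -> W),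
         (forall i, S i (c i)) /\ w = \sum_(i <- F) c i)
    & forall (F : {fset I}) (c : I -> W), (forall i, S i (c i)) ->
         \sum_(i <- F) c i = 0 -> forall i, i \in F -> c i = 0].
Proof.
split=> [[sub uniq]|[sub ex indep]].
  split=> // [w|F c Sc c0 i iF].
    have [c [dc _]] := uniq w; have [F [h <-]] := decomp_fset dc.
    by exists F, c; split=> //; case: dc.
  have [c' [_ cu]] := uniq 0; pose d i := if i \in F then c i else 0.
  have S0 j : S j 0 by case: (sub j).
  have e1 : c' = d.
    apply: cu; apply: (@fset_decomp _ _ F) => [j|j|].
    - by rewrite /d; case: ifP.
    - by rewrite /d => /negPf ->.
    by rewrite -[RHS]c0; apply: eq_big_seq => j jF; rewrite /d jF.
  have e2 : c' = fun=> 0.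
    by apply: cu; apply: (@fset_decomp _ _ fset0) => //; rewrite big_seq_fset0.
  by have := congr1 (fun f => f i) e1; rewrite e2 /d iF.
split=> // w; have [F [c [Sc wE]]] := ex w.
have S0 j : S j 0 by case: (sub j).
exists (fun i => if i \in F then c i else 0); split.
  apply: (@fset_decomp _ _ F) => [j|j /negPf -> //|]; first by case: ifP.
  by rewrite wE; apply: eq_big_seq => j jF; rewrite jF.
move=> d dd; have [G [dG dE]] := decomp_fset dd.
pose e i := (if i \in F then c i else 0) - d i.
have Se i : S i (e i).
  have Sd : S i (d i) by case: dd.
  rewrite /e -scaleN1r; apply: subspaceD => //; first by case: ifP.
  exact: subspaceZ.
have e0 : \sum_(i <- (F `|` G)%fset) e i = 0.
  rewrite sumrB; apply/eqP; rewrite subr_eq0; apply/eqP.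
  rewrite -(big_fset_incl _ (fsubsetUl F G)); last by move=> i _ /negPf ->.
  rewrite -(big_fset_incl _ (fsubsetUr F G)); last by move=> i _; exact: dG.
  by rewrite dE wE; apply: eq_big_seq => i ->.
apply/funext => i; apply/eqP; rewrite -subr_eq0; apply/eqP; rewrite -/(e i).
have [iF|iF] := boolP (i \in (F `|` G)%fset); first exact: (indep _ _ Se e0).
move: iF; rewrite inE negb_or /e => /andP[/negPf -> /dG ->]; exact: subrr.
Qed.

Hypothesis gS : is_grading S.

Lemma grading_ind (P : W -> Prop) : P 0 -> (forall x y, P x -> P y -> P (x + y)) ->
  (forall i x, S i x -> P x) -> forall w, P w.
Proof.
move=> P0 PD PS w; have [_ /(_ w) [F [c [Sc ->]]] _] := gradingP.1 gS.
by elim/big_ind: _ => // i _; apply: PS (Sc i).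
Qed.

(** The zero vector is homogeneous of degree [i0], so it needs no case of its own. *)
Lemma grading_add_ind (i0 : I) (P : W -> Prop) :
  (forall x y, P x -> P y -> P (x + y)) ->
  (forall i x, S i x -> P x) -> forall w, P w.
Proof. by move=> PD PS; apply: grading_ind => //; apply: (PS i0); case: (gS.1 i0). Qed.

Lemma projP w : decomp S w (fun i => proj S i w).
Proof.
have [c [dc cu]] := gS.2 w.
suff -> : (fun i => proj S i w) = c by [].
apply/funext => i; rewrite /proj; case: xgetP => [y _ [d dd ->]|/(_ (c i))].
  by rewrite (cu _ dd).
by case; exists c.
Qed.

Lemma proj_uniq w c : decomp S w c -> forall i, proj S i w = c i.
Proof.
move=> dc i; have [d [_ du]] := gS.2 w.
by rewrite -(du _ dc) (du _ (projP w)).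
Qed.

Lemma proj_in i w : S i (proj S i w).
Proof. by case: (projP w). Qed.

Lemma proj_at i j w : S i w -> proj S j w = if j == i then w else 0.
Proof.
move=> Sw; apply: (@proj_uniq _ (fun j => if j == i then w else 0)).
apply: (@fset_decomp _ _ [fset i]%fset) => [k|k|].
- by case: eqP => [->|_ //]; case: (gS.1 k).
- by rewrite inE => /negPf ->.
by rewrite big_seq_fset1 eqxx.
Qed.

Lemma proj_linear i : linear (proj S i).
Proof.
move=> a x y; have [F [hF eF]] := decomp_fset (projP x).
have [G [hG eG]] := decomp_fset (projP y).
apply: (@proj_uniq _ (fun i => a *: proj S i x + proj S i y)).
apply: (@fset_decomp _ _ (F `|` G)%fset) => [k|k|].
- by apply: (gS.1 k).2; apply: proj_in.
- by rewrite inE negb_or => /andP[/hF -> /hG ->]; rewrite scaler0 addr0.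
rewrite big_split -scaler_sumr /=.
rewrite -(big_fset_incl _ (fsubsetUl F G)); last by move=> k _; exact: hF.
rewrite -(big_fset_incl _ (fsubsetUr F G)); last by move=> k _; exact: hG.
by rewrite eF eG.
Qed.

End OneGrading.

Lemma fset_preimage (I J : choiceType) (h : I -> J) (F : {fset J}) : injective h ->
  exists G : {fset I}, forall i, (i \in G) = (h i \in F).
Proof.
move=> hi; pose t j : {fset I} := if pselect (exists i, h i = j) is left p
  then [fset projT1 (cid p)]%fset else fset0.
exists (\bigcup_(j <- F) t j)%fset => k; apply/bigfcupP/idP => [[j' /andP[j'F _]]|hk].
  by rewrite /t; case: pselect => // p; rewrite inE => /eqP ->; case: cid => x /= ->.
exists (h k); rewrite ?hk // /t; case: pselect => [p|[]]; last by exists k.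
by rewrite inE; case: cid => x /= /hi ->.
Qed.

Lemma extend_by_0 (I J : choiceType) (h : I -> J) (c : I -> W) : injective h ->
  exists d : J -> W, (forall i, d (h i) = c i) /\
    (forall j, (forall i, j <> h i) -> d j = 0).
Proof.
move=> hi.
exists (fun j => if pselect (exists i, h i = j) is left p then c (projT1 (cid p)) else 0).
split=> [i|j ne]; case: pselect => [p|]; rewrite ?(in0, erefl) //.
- by case: cid => x /= /hi ->.
- by case; exists i.
by case: p => i e; case: (ne i).
Qed.

(** Passes from integral to complex weights, and from the grading by pairs to its part of charge 0:
    the components outside the image of [h] are zero. *)
Lemma grading_reindex (I J : choiceType) (h : I -> J) (S : J -> set W) :
  injective h -> (forall j, subspace (S j)) ->
  (forall j, (forall i, j <> h i) -> S j = [set 0]) ->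
  is_grading (fun i => S (h i)) <-> is_grading S.
Proof.
move=> hi sub S0.
have Sd d : (forall i, S (h i) (d (h i))) ->
    (forall j, (forall i, j <> h i) -> d j = 0) -> forall j, S j (d j).
  move=> Sh d0 j; have [[i <-]|ne] := pselect (exists i, h i = j); first exact: Sh.
  by rewrite d0 => [|i e]; [case: (sub j)|apply: ne; exists i].
have supp (F : {fset J}) (G : {fset I}) (c : J -> W) :
    (forall i, (i \in G) = (h i \in F)) -> (forall j, S j (c j)) ->
    \sum_(j <- F) c j = \sum_(i <- G) c (h i).
  move=> hG Sc; transitivity (\sum_(j <- [fset h i | i in G]%fset) c j); last first.
    by rewrite big_imfset //= => x y _ _; exact: hi.
  apply/esym/big_fset_incl => [|k kF].
    by apply/fsubsetP => k /imfsetP[x /= + ->]; rewrite hG.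
  move=> kn; have := Sc k; rewrite S0 // => x e; move: kn; rewrite e => /negP[].
  by apply/imfsetP; exists x; rewrite //= hG -e.
split=> /gradingP [_ ex indep]; apply/gradingP; split=> //.
- move=> w; have [F [c [Sc ->]]] := ex w; have [d [dh d0]] := extend_by_0 c hi.
  exists [fset h i | i in F]%fset, d; split; first by apply: Sd => // i; rewrite dh.
  by rewrite big_imfset /= => [|x y _ _]; [apply: eq_bigr => i _; rewrite dh|exact: hi].
- move=> F c Sc c0 j jF.
  have [[i hij]|ne] := pselect (exists i, h i = j); last first.
    by have := Sc j; rewrite S0 // => i e; apply: ne; exists i.
  have [G hG] := fset_preimage F hi.
  rewrite -hij; apply: (indep G (fun i => c (h i))) => [k|| ]; last by rewrite hG hij.
    exact: Sc.
  by rewrite -(supp _ _ _ hG).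
- move=> w; have [F [c [Sc ->]]] := ex w; have [G hG] := fset_preimage F hi.
  by exists G, (fun i => c (h i)); split=> [i|]; [exact: Sc|exact: supp].
move=> F c Sc c0 i iF; have [d [dh d0]] := extend_by_0 c hi.
rewrite -dh; apply: (indep [fset h i | i in F]%fset d).
- by apply: Sd => // k; rewrite dh.
- rewrite big_imfset /= => [|x y _ _]; last exact: hi.
  by rewrite -[RHS]c0; apply: eq_bigr => k _; rewrite dh.
by apply/imfsetP; exists i.
Qed.

Lemma ssumE (I : choiceType) (S : I -> set W) i0 :
  (forall i, subspace (S i)) -> (forall i, i != i0 -> S i = [set 0]) -> ssum S = S i0.
Proof.
move=> sub S0; rewrite eqEsubset; split=> w.
  move=> [c dc]; have [F [hF <-]] := decomp_fset dc.
  apply: subspace_sum => // i _; have [->|ne] := eqVneq i i0; first by case: dc.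
  have : S i (c i) by case: dc.
  by rewrite S0 // => ->; case: (sub i0).
move=> Sw; exists (fun i => if i == i0 then w else 0).
apply: (@fset_decomp _ _ _ _ [fset i0]%fset) => [k|k|].
- by case: eqP => [->|_ //]; case: (sub k).
- by rewrite inE => /negPf ->.
by rewrite big_seq_fset1 eqxx.
Qed.

Lemma ssum_le (I : choiceType) (S : I -> set W) i w : (forall i, subspace (S i)) ->
  S i w -> ssum S w.
Proof.
move=> sub Sw; exists (fun j => if j == i then w else 0).
apply: (@fset_decomp _ _ _ _ [fset i]%fset) => [k|k|].
- by case: eqP => [->|_ //]; case: (sub k).
- by rewrite inE => /negPf ->.
by rewrite big_seq_fset1 eqxx.
Qed.

(** The row and the column decomposition are both decompositions for the joint grading, hence equal,
    and only the entry (i, j) can survive. *)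
Lemma ssumI (I J : choiceType) (S : I -> J -> set W) i j w :
  is_grading (fun ij : I * J => S ij.1 ij.2) ->
  ssum (S i) w -> ssum (fun k => S k j) w -> S i j w.
Proof.
move=> gS [c dc] [d dd].
have [F [hF eF]] := decomp_fset dc; have [G [hG eG]] := decomp_fset dd.
have c0 k l : S k l 0 by case: (gS.1 (k, l)).
have d1 : decomp (fun ij : I * J => S ij.1 ij.2) w
    (fun kl => if kl.1 == i then c kl.2 else 0).
  apply: (@fset_decomp _ _ _ _ [fset (i, k) | k in F]%fset) => [[k l]|[k l] /= ne|].
  - by rewrite /=; case: eqP => [->|_ //]; case: dc.
  - case: eqP => // e; apply: hF; apply: contra ne => lF.
    by apply/imfsetP; exists l; rewrite // e.
  rewrite big_imfset /= => [|x y _ _ []//].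
  by rewrite -eF; apply: eq_bigr => k _; rewrite eqxx.
have d2 : decomp (fun ij : I * J => S ij.1 ij.2) w
    (fun kl => if kl.2 == j then d kl.1 else 0).
  apply: (@fset_decomp _ _ _ _ [fset (k, j) | k in G]%fset) => [[k l]|[k l] /= ne|].
  - by rewrite /=; case: eqP => [->|_ //]; case: dd.
  - case: eqP => // e; apply: hG; apply: contra ne => lF.
    by apply/imfsetP; exists k; rewrite // e.
  rewrite big_imfset /= => [|x y _ _ []//].
  by rewrite -eG; apply: eq_bigr => k _; rewrite eqxx.
have e l : c l = if l == j then d i else 0.
  by have := proj_uniq gS d1 (i, l); rewrite (proj_uniq gS d2) /= eqxx.
rewrite -eF; apply: subspace_sum => [|l _]; first exact: (gS.1 (i, j)).
have : S i l (c l) by case: dc.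
by rewrite e; case: eqP => [->|].
Qed.

(** * Generalized eigenspaces and locally nilpotent operators *)

Section GeneralizedEigenspaces.
Implicit Types A B : W -> W.

Lemma shift_linear A a : linear A -> linear (fun x => A x - a *: x).
Proof.
by move=> AL b x y; rewrite AL scalerDr scalerA mulrC -scalerA opprD addrACA -scalerBr.
Qed.

Lemma geneig_subspace A a : linear A -> subspace (geneig A a).
Proof.
move=> AL; have L := shift_linear a AL.
split=> [|b x y [K hx] [N hy]]; first by exists 0%N.
exists (K + N)%N; rewrite (lin_iter _ L) {1}addnC !iterD hx hy.
by rewrite !(lin0 (lin_iter _ L)) scaler0 addr0.
Qed.

(** By induction on the exponent for a, A x - a x is zero, so x is a true eigenvector and (A - b)^N
    x = (a - b)^N x. *)
Lemma geneig_disjoint A a b x : linear A -> a != b ->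
  geneig A a x -> geneig A b x -> x = 0.
Proof.
move=> AL ab [K]; elim: K x => [//|K IH] x; rewrite iterSr => hx [N hN].
have L := shift_linear b AL.
have y0 : A x - a *: x = 0.
  apply: IH => //; exists N.
  rewrite (linB (lin_iter _ L)) (linZ (lin_iter _ L)) hN scaler0 subr0.
  have -> : iter N (fun x => A x - b *: x) (A x) = A (iter N (fun x => A x - b *: x) x).
    by elim: N {hN} => [//|N /= ->]; rewrite (linB AL) (linZ AL).
  by rewrite hN (lin0 AL).
have Ax : A x = a *: x by apply/eqP; rewrite -subr_eq0 y0.
have e : iter N (fun x => A x - b *: x) x = (a - b) ^+ N *: x.
  elim: N {hN} => [|N /= ->]; first by rewrite scale1r.
  by rewrite (linZ AL) Ax !scalerA -scalerBl exprS; congr (_ *: _); ring.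
by move/eqP: hN; rewrite e scaler_eq0 expf_eq0 subr_eq0 (negPf ab) andbF => /eqP.
Qed.

(** [f] intertwines A - a with B - (a + c). *)
Lemma geneig_shift (U : lmodType C) (A : U -> U) B (f : U -> W) a c :
  linear f -> (forall x, B (f x) = f (A x) + c *: f x) ->
  forall x, geneig A a x -> geneig B (a + c) (f x).
Proof.
move=> fL h x [K hK]; exists K.
have -> : iter K (fun x => B x - (a + c) *: x) (f x) = f (iter K (fun x => A x - a *: x) x).
  elim: K {hK} => [//|K /= ->]; rewrite h (linB fL) (linZ fL) scalerDl opprD.
  by rewrite addrACA subrr addr0.
by rewrite hK (lin0 fL).
Qed.

Definition locally_nilpotent A := forall x, exists K, iter K A x = 0.

(** A' = A - a and B commute and are nilpotent on x with exponents K and N. Peeling one factor off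
    (A' + B)^(K + N) leaves A' x, where K has dropped, and B x, where N has dropped. *)
Lemma geneig_add A B a x : linear A -> linear B -> locally_nilpotent B ->
  (forall x, A (B x) = B (A x)) -> geneig A a x -> geneig (fun x => A x + B x) a x.
Proof.
move=> AL BL nB AB [K hK]; have [N hN] := nB x.
set A' := fun x => A x - a *: x.
have A'L : linear A' := shift_linear a AL.
exists (K + N)%N.
rewrite (_ : (fun x => _) = fun x => A' x + B x); last first.
  by apply/funext => y; rewrite /A' addrAC.
have A'B y : A' (B y) = B (A' y) by rewrite /A' (linB BL) (linZ BL) AB.
have L : linear (fun x => A' x + B x).
  by move=> c y z /=; rewrite A'L BL [in RHS]scalerDr addrACA.
have [s] := ubnP (K + N)%N.
elim: s K N x hK hN => [//|s IH] K N x hK hN; rewrite ltnS.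
case: K hK => [/= -> _|K hK]; first exact: lin0 (lin_iter _ L).
case: N hN => [x0 _|N hN].
  by have -> : x = 0 := x0; exact: lin0 (lin_iter _ L).
move=> sKN; rewrite addSn iterSr (linD (lin_iter _ L)).
rewrite IH; [|by rewrite -iterSr| |by move: sKN; rewrite addSn]; last first.
  have -> : iter N.+1 B (A' x) = A' (iter N.+1 B x).
    by elim: (N.+1) => [//|m /= ->]; rewrite A'B.
  by rewrite hN (lin0 A'L).
rewrite add0r -[(K + N.+1)%N]/(K + N.+1)%N addnS -addSn; apply: IH.
- have -> : iter K.+1 A' (B x) = B (iter K.+1 A' x).
    by elim: (K.+1) => [//|m /= ->]; rewrite A'B.
  by rewrite hK (lin0 BL).
- by rewrite -iterSr.
by move: sKN; rewrite addnS.
Qed.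

Section LocallyNilpotent.
Variable A : W -> W.
Hypotheses (AL : linear A) (nA : locally_nilpotent A).

Lemma geneig_lnilp a : geneig A a = if a == 0 then setT else [set 0].
Proof.
have g0 x : geneig A 0 x.
  have [K hK] := nA x; exists K; rewrite -[RHS]hK; apply: eq_iter => y.
  by rewrite scale0r subr0.
case: eqP => [->|/eqP a0]; first by apply/seteqP; split=> x // _; exact: g0.
apply/seteqP; split=> x => [gx|->]; last by case: (geneig_subspace a AL).
exact: geneig_disjoint a0 gx (g0 x).
Qed.

Lemma lnilp_decomp w c : decomp (geneig A) w c -> forall a, c a = if a == 0 then w else 0.
Proof.
move=> dc; have [_ Sc wE] := dc.
have c0 a : a != 0 -> c a = 0.
  by move=> a0; have := Sc a; rewrite geneig_lnilp (negPf a0).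
by move=> a; case: eqP => [->|/eqP /c0 //]; rewrite -wE (fsum_at c0).
Qed.

Lemma lnilp_grading : is_grading (geneig A).
Proof.
split=> [a|w]; first exact: geneig_subspace.
exists (fun a => if a == 0 then w else 0); split.
  apply: (@fset_decomp _ _ _ _ [fset 0]%fset) => [a|a|].
  - by rewrite geneig_lnilp; case: eqP.
  - by rewrite inE => /negPf ->.
  by rewrite big_seq_fset1 eqxx.
by move=> d dd; apply/funext => a; rewrite (lnilp_decomp dd).
Qed.

Lemma proj_lnilp a w : proj (geneig A) a w = if a == 0 then w else 0.
Proof. exact: lnilp_decomp (projP lnilp_grading w) a. Qed.

Lemma nilpart_lnilp : nilpart A = A.
Proof.
apply/funext => w; rewrite /nilpart /sspart fsum_0 ?subr0 // => a.
by rewrite proj_lnilp; case: eqP => [->|_]; rewrite ?scale0r ?scaler0.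
Qed.

Lemma exp2pii_lnilp w K : iter K A w = 0 ->
  exp2pii A w = \sum_(k < K) (twopii R ^+ k / (k`!)%:R) *: iter k A w.
Proof.
move=> hK; rewrite /exp2pii nilpart_lnilp.
have z n : iter n A 0 = 0 by exact: lin0 (lin_iter n AL).
rewrite (@fsum_at _ _ _ 0) => [|a /negPf a0]; last first.
  by rewrite fsum_0 ?scaler0 // => k; rewrite proj_lnilp a0 z scaler0.
rewrite mulr0 cexp0 scale1r proj_lnilp eqxx; apply: fsum_ord => n Kn.
by rewrite -(subnK Kn) iterD hK z scaler0.
Qed.

Lemma exp2pii_linear : linear (exp2pii A).
Proof.
move=> a x y; have [K hK] := nA x; have [N hN] := nA y.
have z n : iter n A 0 = 0 by exact: lin0 (lin_iter n AL).
have hx : iter (K + N) A x = 0 by rewrite addnC iterD hK z.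
have hy : iter (K + N) A y = 0 by rewrite iterD hN z.
rewrite !(exp2pii_lnilp (K := K + N)) //; last first.
  by rewrite (lin_iter _ AL) hx hy scaler0 addr0.
rewrite scaler_sumr -big_split; apply: eq_bigr => k _ /=.
by rewrite (lin_iter _ AL) scalerDr !scalerA mulrC.
Qed.

(** The exponential minus the identity lowers the nilpotency exponent by one ([head]). Injectivity
    and surjectivity follow by induction on it: if x is mapped to exp(w) - w, then w - x is mapped
    to w. *)
Lemma exp2pii_bijective : bijective (exp2pii A).
Proof.
have z n : iter n A 0 = 0 by exact: lin0 (lin_iter n AL).
have head K w : iter K.+1 A w = 0 -> iter K A (exp2pii A w - w) = 0.
  move=> hK; rewrite (exp2pii_lnilp hK) big_ord_recl /= expr0 divr1 scale1r addrC addKr.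
  rewrite (lin_sum (lin_iter K AL)); apply: big1 => i _.
  rewrite (linZ (lin_iter K AL)) -[A (iter i A w)]/(iter i.+1 A w) -iterD.
  by rewrite addnS -addSn addnC iterD hK z scaler0.
have inj0 w : exp2pii A w = 0 -> w = 0.
  move=> ew; have [K] := nA w; elim: K => [//|K IH] hK; apply: IH.
  by have := head K w hK; rewrite ew sub0r (linN (lin_iter K AL)) => /eqP; rewrite oppr_eq0 => /eqP.
have inj : injective (exp2pii A).
  move=> x y e; apply/eqP; rewrite -subr_eq0; apply/eqP/inj0.
  by rewrite (linB exp2pii_linear) e subrr.
have surj w : exists x, exp2pii A x = w.
  have [K] := nA w; elim: K w => [w /= ->|K IH w hK].
    by exists 0; exact: lin0 exp2pii_linear.
  have [x hx] := IH _ (head K w hK); exists (w - x).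
  by rewrite (linB exp2pii_linear) hx opprB addrC subrK.
exists (fun w => projT1 (cid (surj w))) => w; last by case: cid.
by apply: inj; case: cid.
Qed.

End LocallyNilpotent.
End GeneralizedEigenspaces.

End Gradings.

(** * Modes of a module *)

Section Modes.
Variables (R : realType) (V : voaData R) (W : lmodType R[i]).
Variable YW : V -> int -> W -> W.
Local Notation C := R[i].
Hypotheses (BV : bilinear_modes (@vmode R V)) (tV : truncated (@vmode R V)).
Hypotheses (BW : bilinear_modes YW) (jW : jacobi YW).

Lemma trunc_nat (U : lmodType C) (Y : V -> int -> U -> U) v w : truncated Y ->
  exists K : nat, forall n : int, K%:Z <= n -> Y v n w = 0.
Proof.
move=> tY; have [N hN] := tY v w; exists `|N|%N => n Nn; apply: hN.
by apply: le_trans Nn; exact: ler_norm.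
Qed.

Lemma gbinom0 i : gbinom R 0 i = (i == 0%N)%:R.
Proof. by rewrite (gbinom_nat R 0 i); case: i. Qed.

(** The Jacobi identity at l = 0, where the binomials of 0 leave one term on the left. *)
Lemma commutator_formula a b m n w K :
  (forall i : nat, (K <= i)%N -> vmode a i%:Z b = 0) ->
  YW a m (YW b n w) - YW b n (YW a m w) =
  \sum_(i < K) gbinom R m i *: YW (vmode a i%:Z b) (m + n - i%:Z) w.
Proof.
move=> hK; have := jW a b w 0 m n.
rewrite (@fsum_at _ _ _ 0%N) => [|i /negPf i0]; last first.
  by rewrite gbinom0 i0 mulr0 scale0r.
rewrite gbinom0 eqxx -[0%:Z]/(0 : int) mulr1 expr0 expr0z !scale1r !addr0 => ->.
rewrite (fsum_ord (K := K)) => [|i Ki]; first by apply: eq_bigr => i _; rewrite add0r.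
by rewrite add0r hK // (lin0 ((BW _).2 _)) scaler0.
Qed.

(** The Jacobi identity at m = 0, where the binomials of 0 leave one term on the right. *)
Lemma iterate_formula a b l n w K :
  (forall i : nat, (K <= i)%N -> YW b (n + i%:Z) w = 0) ->
  (forall i : nat, (K <= i)%N -> YW a i%:Z w = 0) ->
  YW (vmode a l b) n w =
  \sum_(i < K) ((-1) ^+ i * gbinom R l i) *:
    (YW a (l - i%:Z) (YW b (n + i%:Z) w)
     - (-1) ^ l *: YW b (n + l - i%:Z) (YW a i%:Z w)).
Proof.
move=> hb ha; have := jW a b w l 0 n.
rewrite [in RHS](@fsum_at _ _ _ 0%N) => [|i /negPf i0]; last first.
  by rewrite gbinom0 i0 scale0r.
rewrite gbinom0 eqxx -[0%:Z]/(0 : int) scale1r !addr0 !add0r => <-.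
rewrite (fsum_ord (K := K)) => [|i Ki]; first by [].
by rewrite hb // ha // !(lin0 ((BW _).1 _)) scaler0 subr0 scaler0.
Qed.

Hypothesis dW : L1_derivative YW.

Lemma mode_weight a p n w : wt p a ->
  Lmode YW 0 (YW a n w) = YW a n (Lmode YW 0 w) + (p - n%:~R - 1) *: YW a n w.
Proof.
move=> ap; have [K hK] := trunc_nat (vomega V) a tV.
(* The bound is at least 2 so that the terms i = 0, the derivative, and i = 1, the weight, can be
   split off; the binomials of 1 kill the others. *)
have hK2 i : (K + 2 <= i)%N -> vmode (vomega V) i%:Z a = 0.
  by move=> h; apply: hK; rewrite lez_nat; lia.
have := commutator_formula 1 n w hK2.
rewrite addn2 big_ord_recl big_ord_recl big1 ?addr0 => [|i _]; last first.
  by rewrite (gbinom_nat R 1) /= bin_small ?scale0r.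
rewrite /= !(gbinom_nat R 1) bin0 bin1 !scale1r dW ap (linZ ((BW _).2 _)).
have e1 : 1 + n - 1 = n by lia.
rewrite -[bump 0 0]/1%N e1 => h.
apply/eqP; rewrite -[_ + _ *: _]addrC -subr_eq /Lmode add0r h -scalerDl.
by apply/eqP; congr (_ *: _); rewrite rmorphD /=; ring.
Qed.

Lemma mode_geneig a p n h w : wt p a -> geneig (Lmode YW 0) h w ->
  geneig (Lmode YW 0) (h + (p - n%:~R - 1)) (YW a n w).
Proof.
move=> ap; apply: (geneig_shift ((BW n).1 a)) => x; exact: mode_weight.
Qed.

End Modes.

(** All products of two coefficients vanish, so the exponential stops after its linear term. *)
Lemma expcoef_square_zero (R : realType) (W : lmodType R[i]) (A : nat -> W -> W) :
  (forall n, linear (A n)) -> (forall m n w, A m (A n w) = 0) ->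
  forall n w, expcoef A n w = if n == 0%N then w else A n w.
Proof.
move=> AL AA n w.
have A0 m : A m 0 = 0 by exact: lin0 (AL m).
have p1 m v : powcoef A 1 m v = if m == 0%N then 0 else A m v.
  rewrite /=; case: m => [|m]; first by rewrite big_geq.
  rewrite big_nat_recr //= subnn eqxx big_nat_cond big1 ?add0r // => i.
  move=> /andP[/andP[_ im] _]; rewrite subn_eq0 leqNgt im /= A0 //.
have p2 k m v : powcoef A k.+2 m v = 0.
  rewrite [powcoef]lock /= -lock; rewrite [LHS]/=; apply: big1 => i _.
  by rewrite (lin_sum (AL i)); apply: big1 => j _; exact: AA.
rewrite /expcoef; case: n => [|n].
  by rewrite big_ord1 /= fact0 invr1 scale1r.
rewrite !big_ord_recl big1 ?addr0 => [|i _]; last by rewrite p2 scaler0.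
by rewrite [in X in X + _]/= scaler0 add0r p1 -[(bump 0 0)`!]/1%N invr1 scale1r.
Qed.

(** * Modified operators for a primary vector of weight 1 and square zero *)

Section SquareZero.
Variables (R : realType) (V : voaData R) (u : V).
Local Notation C := R[i].
Local Notation om := (vomega V).
Hypothesis VV : vertex_operator_algebra V.
Hypothesis sq0 : forall i j n v v', vmode (vmode u i v) n (vmode u j v') = 0.
Hypothesis u_wt : vmode om 1 u = u.
Hypothesis u_primary : forall n : nat, (2 <= n)%N -> vmode om n%:Z u = 0.

Let BV : bilinear_modes (@vmode R V). Proof. by case: VV => -[]. Qed.
Let tV : truncated (@vmode R V). Proof. by case: VV => -[]. Qed.
Let jV : jacobi (@vmode R V). Proof. by case: VV => -[]. Qed.
Let dV : L1_derivative (@vmode R V). Proof. by case: VV => -[]. Qed.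
Let cV v : vmode v (-1) (vvac V) = v. Proof. by case: VV => _ /(_ v)[]. Qed.
Let c0 v n : 0 <= n -> vmode v n (vvac V) = 0.
Proof. by case: VV => _ /(_ v)[_ h] _ _ _; exact: h. Qed.

Lemma umode_mode i j v : vmode u i (vmode u j v) = 0.
Proof. by have := sq0 (-1) j i (vvac V) v; rewrite cV. Qed.

Lemma umode_linear n : linear (vmode u n).
Proof. exact: (BV n).1. Qed.

Lemma u0_lnilp : locally_nilpotent (vmode u 0).
Proof. by move=> v; exists 2%N; exact: umode_mode. Qed.

Lemma u_wt1 : wt 1 u.
Proof. by rewrite /wt /= u_wt scale1r. Qed.

Lemma umode_vac n : 0 <= n -> vmode u n (vvac V) = 0.
Proof. exact: c0. Qed.

Section OmegaU.
Variables (W : lmodType C) (YW : V -> int -> W -> W).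
Hypotheses (BW : bilinear_modes YW) (jW : jacobi YW) (dW : L1_derivative YW).

(** The terms i = 0 and i = 1 of the commutator formula contribute -(m + n) and m; the others vanish
    as u is primary. *)
Lemma omega_umode m n w : YW om m (YW u n w) - YW u n (YW om m w) =
  - n%:~R *: YW u (m + n - 1) w.
Proof.
rewrite (commutator_formula BW jW _ _ _ (K := 2)) => [|i]; last exact: u_primary.
rewrite big_ord_recl big_ord1 /= dW u_wt subr0 /gbinom !big_ord_recl !big_ord0.
rewrite !mulr1 fact0 divr1 subr0 scale1r -scalerDl; congr (_ *: _).
by rewrite rmorphD /= -[(bump 0 0)`!]/1%N divr1 opprD addrAC addNr add0r.
Qed.

End OmegaU.

(** The commutator with omega_(-1), applied to the vacuum, gives u_n omega = n u_(n-2) 1, which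
    survives for n = 1 alone. *)
Lemma umode_omega (n : nat) : vmode u n%:Z om = if n == 1%N then u else 0.
Proof.
have := omega_umode BV jV dV (-1) n (vvac V).
rewrite c0 // cV (lin0 ((BV _).1 _)) sub0r => /eqP; rewrite eqr_oppLR => /eqP ->.
rewrite scaleNr opprK; case: n => [|[|n]]; first by rewrite scale0r.
  by rewrite scale1r; exact: cV.
by rewrite c0 ?scaler0.
Qed.

Lemma umode_L1 n v :
  vmode u n (vmode om 0 v) = vmode om 0 (vmode u n v) + n%:~R *: vmode u (n - 1) v.
Proof.
have := omega_umode BV jV dV 0 n v; rewrite add0r scaleNr => /eqP.
by rewrite subr_eq addrC -subr_eq opprK => /eqP <-.
Qed.

Lemma umode_vmode (n : nat) a l b K :
  (forall i : nat, (K <= i)%N -> vmode u i%:Z a = 0) ->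
  vmode u n%:Z (vmode a l b) = vmode a l (vmode u n%:Z b)
    + \sum_(i < K) 'C(n, i)%:R *: vmode (vmode u i%:Z a) (n%:Z + l - i%:Z) b.
Proof.
move=> hK; have := commutator_formula BV jV n%:Z l b hK.
move=> /eqP; rewrite subr_eq addrC => /eqP ->; congr (_ + _).
by apply: eq_bigr => i _; rewrite gbinom_nat.
Qed.

(** Local nilpotency of u_0 leaves the exponents -n. As u_0 u_n = 0, log x occurs at most linearly,
    and never together with a negative power of x. *)
Lemma Delta_nat (n k : nat) v :
  Delta u (- n%:R) k v = if k is 0 then if n == 0%N then v else logcoef R n *: vmode u n%:Z v
    else if (k == 1%N) && (n == 0%N) then vmode u 0 v else 0.
Proof.
rewrite /Delta (@fsum_at _ _ _ n) => [|m mn]; last first.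
  rewrite (proj_lnilp (umode_linear 0) u0_lnilp) ifF // addrC subr_eq0 eqr_nat.
  exact/negbTE.
rewrite (proj_lnilp (umode_linear 0) u0_lnilp) addNr eqxx.
rewrite (nilpart_lnilp (umode_linear 0) u0_lnilp).
have -> : expcoef (fun m x => ((-1) ^+ m / (- m%:R)) *: vmode u m%:Z x) n v =
    if n == 0%N then v else logcoef R n *: vmode u n%:Z v.
  apply: expcoef_square_zero => [m a x y|m l w].
    by rewrite (umode_linear m%:Z) scalerDr !scalerA mulrC.
  by rewrite (linZ (umode_linear m%:Z)) umode_mode !scaler0.
have z : vmode u 0 0 = 0 by exact: lin0 (umode_linear 0).
case: k => [|[|k]]; first by rewrite fact0 invr1 scale1r.
  rewrite -[1`!]/1%N invr1 scale1r /=; case: eqP => // _.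
  by rewrite (linZ (umode_linear 0)) umode_mode scaler0.
rewrite !iterSr umode_mode (lin0 (lin_iter k (umode_linear 0))) scaler0 //.
Qed.

Lemma Delta_out s k v : (forall n : nat, s <> - n%:R) -> Delta u s k v = 0.
Proof.
move=> ns; apply: fsum_0 => n.
rewrite (proj_lnilp (umode_linear 0) u0_lnilp) ifF //; apply/negP.
by rewrite addr_eq0 => /eqP /ns.
Qed.

Section Twist.
Variables (W : lmodType C) (YW : V -> int -> W -> W).
Hypotheses (BW : bilinear_modes YW).

Lemma twistY_out v s k w : (forall n : int, s <> n%:~R) -> twistY u YW v s k w = 0.
Proof.
move=> ns; apply: fsum_0 => n.
rewrite Delta_out ?(lin0 ((BW _).2 _)) // => m e; apply: (ns (- n - 1 - m%:Z)).
by rewrite !rmorphB rmorphN /= -[(m%:Z)%:~R]/(m%:R) -[- m%:R]e; ring.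
Qed.

(** The mode -s - 1 - j is the one that meets the coefficient of x^-j in Delta; J cuts off the sum
    over j. *)
Lemma twistYE v (s : int) k w J : (forall j : nat, (J <= j)%N -> vmode u j%:Z v = 0) ->
  twistY u YW v s%:~R k w =
  match k with
  | 0 => YW v (- s - 1) w + \sum_(j < J) logcoef R j *: YW (vmode u j%:Z v) (- s - 1 - j%:Z) w
  | 1 => YW (vmode u 0 v) (- s - 1) w
  | _ => 0
  end.
Proof.
move=> hJ; have YW0 n : YW 0 n w = 0 by exact: lin0 ((BW n).2 w).
have e (j : nat) : s%:~R + (- s - 1 - j%:Z)%:~R + 1 = - j%:R :> C.
  by rewrite !rmorphB rmorphN /= -[(j%:Z)%:~R]/(j%:R); ring.
rewrite /twistY (fsum_inj (h := fun j : nat => - s - 1 - j%:Z)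
   (X := [fset j | j in iota 0 J.+1]%fset)); first last.
- move=> n hn; have [[j jE]|ne] := pselect (exists j : nat, n = - s - 1 - j%:Z).
    have Jj : (J < j)%N.
      rewrite ltnNge; apply/negP => jJ; apply: (hn j) jE.
      by apply/mem_fset_iota; exists j.
    rewrite jE e Delta_nat hJ ?(ltnW Jj) // scaler0.
    by case: k => [|k]; case: j {jE} Jj => // j _; rewrite ?andbF YW0.
  rewrite Delta_out ?YW0 // => j h; apply: ne; exists j.
  apply: (@intr_inj C); rewrite !rmorphB rmorphN /= -[(j%:Z)%:~R]/(j%:R).
  by rewrite -[- j%:R]h; ring.
- by move=> x y; lia.
rewrite (big_fset_iota _ (fun j : nat =>
  YW (Delta u (s%:~R + (- s - 1 - j%:Z)%:~R + 1) k v) (- s - 1 - j%:Z) w) (@inj_id nat)).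
rewrite big_ord_recl /= e Delta_nat subr0 eqxx.
case: k => [|[|k]]; last first.
- by rewrite YW0 add0r; apply: big1 => j _; rewrite e Delta_nat YW0.
- by rewrite /= big1 ?addr0 // => j _; rewrite e Delta_nat /= YW0.
congr (_ + _); under eq_bigr => j _ do rewrite e Delta_nat /= (linZ ((BW _).2 _)).
(* The sum at hand runs over 1 <= j <= J, the wanted one over 0 <= j < J: the term J vanishes, and
   the term 0 has coefficient [logcoef 0], which is 0. *)
have hJ' : YW (vmode u J%:Z v) (- s - 1 - J%:Z) w = 0 by rewrite hJ.
case: J hJ hJ' => [|J] hJ hJ'; first by rewrite !big_ord0.
rewrite big_ord_recr [in RHS]big_ord_recl logcoef0 scale0r add0r /=.
by rewrite /bump /= add1n hJ' scaler0 addr0.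
Qed.

End Twist.

End SquareZero.

(** * Branches of multivalued functions *)

Section BranchFunctions.
Variable R : realType.
Local Notation C := R[i].

Definition monomial (x : C * C * C * nat * nat) (l1 l2 : C) : C :=
  let: (c, m, n, k, l) := x in c * cexp (m * l1) * cexp (n * l2) * l1 ^+ k * l2 ^+ l.

(** Lists of monomials are closed under sums and products by concatenation and pairing; the rigid
    four-index shape of [fbranch] is imposed only at the end. *)
Definition is_numerator (N : C -> C -> C) := exists s, forall l1 l2,
  N l1 l2 = \sum_(x <- s) monomial x l1 l2.

Lemma is_numeratorD N1 N2 : is_numerator N1 -> is_numerator N2 ->
  is_numerator (fun l1 l2 => N1 l1 l2 + N2 l1 l2).
Proof.
by move=> [s1 h1] [s2 h2]; exists (s1 ++ s2) => l1 l2; rewrite big_cat h1 h2.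
Qed.

Lemma is_numeratorM N1 N2 : is_numerator N1 -> is_numerator N2 ->
  is_numerator (fun l1 l2 => N1 l1 l2 * N2 l1 l2).
Proof.
move=> [s1 h1] [s2 h2].
exists [seq (x.1.1.1.1 * y.1.1.1.1, x.1.1.1.2 + y.1.1.1.2, x.1.1.2 + y.1.1.2,
  (x.1.2 + y.1.2)%N, (x.2 + y.2)%N) | x <- s1, y <- s2] => l1 l2.
rewrite h1 h2 big_allpairs_dep mulr_suml; apply: eq_bigr => -[[[[c m] n] k] l] _.
rewrite mulr_sumr; apply: eq_bigr => -[[[[c' m'] n'] k'] l'] _.
by rewrite /monomial /= !mulrDl !cexpD !exprD; ring.
Qed.

Lemma is_numerator_mono x : is_numerator (monomial x).
Proof. by exists [:: x] => l1 l2; rewrite big_seq1. Qed.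

Lemma is_numerator_ext N N' : (forall l1 l2, N l1 l2 = N' l1 l2) ->
  is_numerator N -> is_numerator N'.
Proof. by move=> e [s h]; exists s => l1 l2; rewrite -e. Qed.

Lemma is_numerator_diff k : is_numerator (fun l1 l2 => (cexp l1 - cexp l2) ^+ k).
Proof.
elim: k => [|k IH].
  apply: is_numerator_ext (is_numerator_mono (1, 0, 0, 0%N, 0%N)) => l1 l2.
  by rewrite /= !mul0r cexp0 !mulr1.
apply: is_numerator_ext (is_numeratorM
  (is_numeratorD (is_numerator_mono (1, 1, 0, 0%N, 0%N))
                 (is_numerator_mono (-1, 0, 1, 0%N, 0%N))) IH) => l1 l2.
by rewrite exprS /= !mul0r !mul1r cexp0 !mulr1 mulN1r.
Qed.

(** The logarithms l1 and l2 are arguments in their own right, so one numerator serves every branch.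
    This gives coefficients independent of r, as [duality] requires. *)
Definition branch_function (F : C -> C -> C -> C -> C) :=
  exists N t, is_numerator N /\ forall l1 l2 z1 z2, cexp l1 = z1 -> cexp l2 = z2 ->
    z1 != z2 -> F l1 l2 z1 z2 = N l1 l2 * (z1 - z2) ^- t.

Lemma branch_functionM F G : branch_function F -> branch_function G ->
  branch_function (fun l1 l2 z1 z2 => F l1 l2 z1 z2 * G l1 l2 z1 z2).
Proof.
move=> [N [t [hN hF]]] [N' [t' [hN' hG]]].
exists (fun l1 l2 => N l1 l2 * N' l1 l2), (t + t')%N.
split=> [|l1 l2 z1 z2 e1 e2 ne]; first exact: is_numeratorM.
by rewrite hF // hG // exprD invfM; ring.
Qed.

Lemma branch_functionD F G : branch_function F -> branch_function G ->
  branch_function (fun l1 l2 z1 z2 => F l1 l2 z1 z2 + G l1 l2 z1 z2).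
Proof.
move=> [N [t [hN hF]]] [N' [t' [hN' hG]]].
exists (fun l1 l2 => N l1 l2 * (cexp l1 - cexp l2) ^+ t' +
                     N' l1 l2 * (cexp l1 - cexp l2) ^+ t), (t + t')%N.
split=> [|l1 l2 z1 z2 e1 e2 ne].
  by apply: is_numeratorD; apply: is_numeratorM => //; exact: is_numerator_diff.
rewrite hF // hG // e1 e2 exprD.
have d0 : z1 - z2 != 0 by rewrite subr_eq0.
by field; rewrite !expf_neq0.
Qed.

Lemma branch_function_ext F G :
  (forall l1 l2 z1 z2, cexp l1 = z1 -> cexp l2 = z2 -> z1 != z2 ->
     F l1 l2 z1 z2 = G l1 l2 z1 z2) -> branch_function F -> branch_function G.
Proof.
move=> e [N [t [hN hF]]]; exists N, t; split=> // l1 l2 z1 z2 e1 e2 ne.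
by rewrite -e // hF.
Qed.

Lemma branch_function_numerator N : is_numerator N ->
  branch_function (fun l1 l2 _ _ => N l1 l2).
Proof.
by move=> hN; exists N, 0%N; split=> // l1 l2 z1 z2 _ _ _; rewrite expr0 invr1 mulr1.
Qed.

Lemma branch_function_cst c : branch_function (fun _ _ _ _ => c).
Proof.
apply: branch_function_ext (branch_function_numerator
  (is_numerator_mono (c, 0, 0, 0%N, 0%N))) => l1 l2 z1 z2 _ _ _ /=.
by rewrite !mul0r cexp0 !mulr1.
Qed.

Lemma branch_function_sum (I : Type) (r : seq I) (P : pred I) (F : I -> _) :
  (forall i, P i -> branch_function (F i)) ->
  branch_function (fun l1 l2 z1 z2 => \sum_(i <- r | P i) F i l1 l2 z1 z2).
Proof.
move=> h; elim: r => [|i r IH].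
  by apply: branch_function_ext (branch_function_cst 0) => *; rewrite big_nil.
have [Pi|nPi] := boolP (P i); last first.
  by apply: branch_function_ext IH => *; rewrite big_cons (negPf nPi).
by apply: branch_function_ext (branch_functionD (h i Pi) IH) => *; rewrite big_cons Pi.
Qed.

Lemma branch_function_z1 (n : int) : branch_function (fun _ _ z1 _ => z1 ^ n).
Proof.
apply: branch_function_ext (branch_function_numerator
  (is_numerator_mono (1, n%:~R, 0, 0%N, 0%N))) => l1 l2 z1 z2 <- _ _ /=.
by rewrite mul0r cexp0 cexpMz mul1r !mulr1.
Qed.

Lemma branch_function_z2 (n : int) : branch_function (fun _ _ _ z2 => z2 ^ n).
Proof.
apply: branch_function_ext (branch_function_numerator
  (is_numerator_mono (1, 0, n%:~R, 0%N, 0%N))) => l1 l2 z1 z2 _ <- _ /=.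
by rewrite mul0r cexp0 cexpMz !mul1r !mulr1.
Qed.

Lemma branch_function_pole t : branch_function (fun _ _ z1 z2 => (z1 - z2) ^- t).
Proof.
exists (monomial (1, 0, 0, 0%N, 0%N)), t; split; first exact: is_numerator_mono.
by move=> l1 l2 z1 z2 _ _ _; rewrite /= !mul0r cexp0 !mul1r.
Qed.

Lemma branch_function_logmono1 j : branch_function (fun l1 _ _ _ => logmono j l1).
Proof.
case: j => [|j].
  apply: branch_function_ext (branch_function_numerator
    (is_numerator_mono (1, 0, 0, 1%N, 0%N))) => l1 l2 z1 z2 _ _ _ /=.
  by rewrite !mul0r cexp0 !mul1r mulr1.
apply: branch_function_ext (branch_functionM (branch_function_cst (logcoef R j.+1))
  (branch_function_z1 (- j.+1%:Z))) => l1 l2 z1 z2 <- _ _ /=.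
by rewrite -exprnN.
Qed.

Lemma branch_function_logmono2 j : branch_function (fun _ l2 _ _ => logmono j l2).
Proof.
case: j => [|j].
  apply: branch_function_ext (branch_function_numerator
    (is_numerator_mono (1, 0, 0, 0%N, 1%N))) => l1 l2 z1 z2 _ _ _ /=.
  by rewrite !mul0r cexp0 !mul1r.
apply: branch_function_ext (branch_functionM (branch_function_cst (logcoef R j.+1))
  (branch_function_z2 (- j.+1%:Z))) => l1 l2 z1 z2 _ <- _ /=.
by rewrite -exprnN.
Qed.

Lemma big_ord_eq (V : nmodType) n k (F : nat -> V) : (k < n)%N ->
  \sum_(i < n) (if i == k :> nat then F i else 0) = F k.
Proof.
move=> kn; by rewrite -big_mkcond (big_pred1 (Ordinal kn)).
Qed.

(** The list of monomials is stored on the diagonal: i and j are both the position in the list, and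
    the coefficient is 0 unless i = j and k, l are the powers of that monomial. Numerator and
    denominator gain a factor z1 - z2 to make t positive. *)
Lemma branch_function_fbranch F : branch_function F ->
  exists (N : nat) (a : nat -> nat -> nat -> nat -> C) (m n : nat -> C) (t : nat),
    (0 < t)%N /\ forall l1 l2 z1 z2, cexp l1 = z1 -> cexp l2 = z2 -> z1 != z2 ->
    F l1 l2 z1 z2 = fbranch N a m n t l1 l2 z1 z2.
Proof.
move=> bF; have [N [t [hN hF]]] := bF.
have hN' := is_numeratorM hN (is_numerator_diff 1).
case: hN' => s hs; pose x0 : C * C * C * nat * nat := (0, 0, 0, 0%N, 0%N).
(* Large enough for every position in the list and every power of a logarithm. *)
pose M := (size s + \sum_(x <- s) (x.1.2 + x.2))%N.
pose x i := nth x0 s i.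
exists M, (fun i j k l => if j == i then if k == (x i).1.2 then
  if l == (x i).2 then (x i).1.1.1.1 else 0 else 0 else 0),
  (fun i => (x i).1.1.1.2), (fun i => (x i).1.1.2), t.+1.
split=> // l1 l2 z1 z2 e1 e2 ne.
have d0 : z1 - z2 != 0 by rewrite subr_eq0.
have -> : F l1 l2 z1 z2 = (\sum_(x <- s) monomial x l1 l2) * (z1 - z2) ^- t.+1.
  rewrite hF // -hs e1 e2 expr1 exprS.
  by field; rewrite !expf_neq0.
have bnd i : (i < size s)%N -> ((x i).1.2 <= M)%N /\ ((x i).2 <= M)%N.
  move=> si; have h : ((x i).1.2 + (x i).2 <= \sum_(y <- s) (y.1.2 + y.2))%N.
    by rewrite (big_nth x0) big_mkord (bigD1 (Ordinal si)) //= leq_addr.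
  by rewrite /M; split; lia.
rewrite (big_nth x0) big_mkord /fbranch mulr_suml.
pose f i := monomial (x i) l1 l2 * (z1 - z2) ^- t.+1.
have f0 i : (size s <= i)%N -> f i = 0.
  by move=> si; rewrite /f /x nth_default //= !mul0r.
have sM : (size s <= M.+1)%N by rewrite /M; lia.
transitivity (\sum_(i < M.+1) f i).
  rewrite (big_ord_widen_cond _ xpredT f sM) big_mkcond; apply: eq_bigr => i _ /=.
  by case: ltnP => // /f0 ->.
apply: eq_bigr => i _.
have [si|si] := ltnP i (size s); last first.
  rewrite f0 // big1 // => j _; apply: big1 => k _; apply: big1 => l _.
  have -> : x i = x0 by rewrite /x nth_default.
  by rewrite /= !if_same !mul0r.
have [b1 b2] := bnd i si.
pose g j k l : C := (x i).1.1.1.1 * cexp ((x i).1.1.1.2 * l1) *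
  cexp ((x j).1.1.2 * l2) * l1 ^+ k * l2 ^+ l * (z1 - z2) ^- t.+1.
transitivity (\sum_(j < M.+1) if j == i :> nat then \sum_(k < M.+1)
   if k == (x i).1.2 :> nat then \sum_(l < M.+1)
   if l == (x i).2 :> nat then g j k l else 0 else 0 else 0).
  rewrite (big_ord_eq (fun j => \sum_(k < M.+1) if k == (x i).1.2 :> nat then
     \sum_(l < M.+1) if l == (x i).2 :> nat then g j k l else 0 else 0)) //.
  rewrite (big_ord_eq (fun k => \sum_(l < M.+1)
     if l == (x i).2 :> nat then g i k l else 0)) ?ltnS //.
  rewrite (big_ord_eq (fun l => g i (x i).1.2 l)) ?ltnS //.
  by rewrite /f /g; case: (x i) => [[[[]]]].
apply: eq_bigr => j _; case: eqP => _; last first.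
  by rewrite big1 // => k _; apply: big1 => l _; rewrite !mul0r.
apply: eq_bigr => k _; case: eqP => _; last by rewrite big1 // => l _; rewrite !mul0r.
by apply: eq_bigr => l _; case: eqP => _ //; rewrite !mul0r.
Qed.

End BranchFunctions.

(** * Branches of the modified operators *)

Lemma functionalZ (R : realType) (W : lmodType R[i]) (f : {linear W -> R[i]^o}) c x :
  (f (c *: x) : R[i]) = c * (f x : R[i]).
Proof. exact: linearZ. Qed.

Lemma subspace_fsum (R : realType) (W : lmodType R[i]) (I : choiceType) (S : set W) (F : I -> W) :
  subspace S -> (forall i, S (F i)) -> S (\sum_(i \in [set: I]) F i).
Proof. by move=> sS h; exact: subspace_sum. Qed.

Section TwistedModule.
Variables (R : realType) (V : voaData R) (u : V).
Local Notation C := R[i].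
Local Notation om := (vomega V).
Hypothesis VV : vertex_operator_algebra V.
Hypothesis sq0 : forall i j n v v', vmode (vmode u i v) n (vmode u j v') = 0.
Hypothesis u_wt : vmode om 1 u = u.
Variables (W : lmodType C) (YW : V -> int -> W -> W).
Hypotheses (BW : bilinear_modes YW) (jW : jacobi YW).
Hypothesis dW : L1_derivative YW.
Variable Wg : C -> C -> set W.
Hypothesis W1E : W1 Wg = geneig (Lmode YW 0).
Hypothesis gW : is_grading (W1 Wg).

Let BV : bilinear_modes (@vmode R V). Proof. by case: VV => -[]. Qed.
Let tV : truncated (@vmode R V). Proof. by case: VV => -[]. Qed.
Let jV : jacobi (@vmode R V). Proof. by case: VV => -[]. Qed.
Let dV : L1_derivative (@vmode R V). Proof. by case: VV => -[]. Qed.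

Local Notation Yg := (twistY u YW).

Lemma mode_W1 a p n h w : wt p a -> W1 Wg h w -> W1 Wg (h + (p - n%:~R - 1)) (YW a n w).
Proof. by rewrite W1E; exact: mode_geneig. Qed.

Lemma mode_wt (a : V) p n (b : V) q : wt p a -> wt q b -> wt (q + (p - n%:~R - 1)) (vmode a n b).
Proof.
move=> ap bq; have := mode_weight tV BV jV dV n b ap.
rewrite /wt /Lmode /= add0r => ->.
by rewrite [vmode om 1 b]bq (linZ ((BV _).1 _)) -scalerDl.
Qed.

Lemma umode_wt p (v : V) j : wt p v -> wt (p - j%:~R) (vmode u j v).
Proof.
move=> /(mode_wt j (u_wt1 u_wt)); congr wt.
by rewrite [1 - _]addrC addrK.
Qed.

Lemma umode_trunc (v : V) : exists J : nat, forall j : nat, (J <= j)%N -> vmode u j%:Z v = 0.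
Proof. by have [J hJ] := trunc_nat u v tV; exists J => j Jj; apply: hJ; rewrite lez_nat. Qed.

Lemma umode_trunc2 (v v' : V) : exists J : nat, forall j : nat, (J <= j)%N ->
  vmode u j%:Z v = 0 /\ vmode u j%:Z v' = 0.
Proof.
have [J hJ] := umode_trunc v; have [J' hJ'] := umode_trunc v'.
by exists (J + J')%N => j Jj; split; [apply: hJ|apply: hJ']; lia.
Qed.

Lemma int_or_out (s : C) : (exists n : int, s = n%:~R) \/ (forall n : int, s <> n%:~R).
Proof.
have [[n ->]|ne] := pselect (exists n : int, s = n%:~R); first by left; exists n.
by right => n e; apply: ne; exists n.
Qed.

Lemma twistY_linear_v s k w : linear (fun v => Yg v s k w).
Proof.
move=> a x y; have [[n ->]|out] := int_or_out s; last first.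
  by rewrite !(twistY_out VV sq0 BW) // scaler0 addr0.
have [J hJ] := umode_trunc2 x y.
rewrite !(twistYE VV sq0 BW _ _ _ (J := J)) //; first last.
- by move=> j /hJ[h1 h2]; rewrite (umode_linear u VV) h1 h2 scaler0 addr0.
- by move=> j /hJ[].
- by move=> j /hJ[].
case: k => [|[|k]]; last by rewrite scaler0 addr0.
- rewrite (BW _).2 scalerDr [RHS]addrACA; congr (_ + _).
  rewrite scaler_sumr -big_split; apply: eq_bigr => j _ /=.
  by rewrite (umode_linear u VV) (BW _).2 scalerDr !scalerA mulrC.
by rewrite (umode_linear u VV) (BW _).2.
Qed.

Lemma twistY_linear_w s k v : linear (Yg v s k).
Proof.
move=> a x y; have [[n ->]|out] := int_or_out s; last first.
  by rewrite !(twistY_out VV sq0 BW) // scaler0 addr0.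
have [J hJ] := umode_trunc v.
rewrite !(twistYE VV sq0 BW _ _ _ (J := J)) //.
case: k => [|[|k]]; last by rewrite scaler0 addr0.
- rewrite (BW _).1 scalerDr [RHS]addrACA; congr (_ + _).
  rewrite scaler_sumr -big_split; apply: eq_bigr => j _ /=.
  by rewrite (BW _).1 scalerDr !scalerA mulrC.
by rewrite (BW _).1.
Qed.

Lemma twistY_log v s k w : (2 <= k)%N -> Yg v s k w = 0.
Proof.
move=> k2; have [[n ->]|out] := int_or_out s; last exact: (twistY_out VV sq0 BW).
have [J hJ] := umode_trunc v.
by rewrite (twistYE VV sq0 BW _ _ _ hJ); case: k k2 => [|[|k]].
Qed.

Lemma twistY_W1 p h v w s k : wt p v -> W1 Wg h w -> W1 Wg (p + h + s) (Yg v s k w).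
Proof.
move=> vp wh; have W0 n : W1 Wg n 0 by case: (gW.1 n).
have [[n ->]|out] := int_or_out s; last by rewrite (twistY_out VV sq0 BW).
have [J hJ] := umode_trunc v; rewrite (twistYE VV sq0 BW _ _ _ hJ).
have key j : W1 Wg (p + h + n%:~R) (YW (vmode u j v) (- n - 1 - j) w).
  have := mode_W1 (- n - 1 - j) (umode_wt j vp) wh; congr W1.
  by rewrite !rmorphB rmorphN /=; ring.
have key0 : W1 Wg (p + h + n%:~R) (YW v (- n - 1) w).
  have := mode_W1 (- n - 1) vp wh; congr W1.
  by rewrite !rmorphB rmorphN /=; ring.
case: k => [|[|k]] //; last by have := key 0; rewrite subr0.
apply: (subspaceD (gW.1 _)) => //; apply: subspace_sum => [|j _]; first exact: gW.1.
by apply: subspaceZ; first exact: gW.1.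
Qed.

Lemma branch_in r v z w n : W1 Wg n (branch Wg Yg r v z w n).
Proof.
apply: subspace_fsum => [|sk]; first exact: gW.1.
by apply: subspaceZ; [exact: gW.1|exact: (proj_in gW)].
Qed.

Section Homogeneous.
Variables (p h : C) (v : V) (w : W).
Hypotheses (vp : wt p v) (wh : W1 Wg h w).

Lemma proj_twistY s k n : proj (W1 Wg) n (Yg v s k w) = if n == p + h + s then Yg v s k w else 0.
Proof. exact: (proj_at gW _ (twistY_W1 s k vp wh)). Qed.

(** For homogeneous vectors the weight n determines the exponent of x, and powers of log x from the
    second on are absent. *)
Lemma branch_log r z n : branch Wg Yg r v z w n =
  \sum_(k < 2) (cexp ((n - p - h) * lbranch r z) * lbranch r z ^+ k) *: Yg v (n - p - h) k w.
Proof.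
rewrite /branch (fsum_inj (h := fun k : nat => (n - p - h, k))
   (X := [fset k | k in iota 0 2]%fset)); first last.
- move=> [s k] ne /=; rewrite proj_twistY; case: eqP => [e|_]; last by rewrite scaler0.
  rewrite twistY_log ?scaler0 // leqNgt; apply/negP => k2; apply: (ne k).
    by apply/mem_fset_iota; exists k.
  by congr pair; rewrite e; ring.
- by move=> x y [].
rewrite (big_fset_iota _ (fun k : nat => (cexp ((n - p - h, k).1 * lbranch r z) *
  lbranch r z ^+ (n - p - h, k).2) *: proj (W1 Wg) n (Yg v (n - p - h, k).1 (n - p - h, k).2 w))
  (@inj_id nat)).
apply: eq_bigr => k _ /=; rewrite proj_twistY ifT //.
by apply/eqP; ring.
Qed.

Lemma branch_out r z n : (forall s : int, n <> p + h + s%:~R) -> branch Wg Yg r v z w n = 0.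
Proof.
move=> out; rewrite branch_log big1 // => k _.
rewrite (twistY_out VV sq0 BW) ?scaler0 // => s e; apply: (out s).
by rewrite -e; ring.
Qed.

Lemma branch_int r z (s : int) : z != 0 ->
  branch Wg Yg r v z w (p + h + s%:~R) =
  \sum_(k < 2) (z ^ s * lbranch r z ^+ k) *: Yg v s%:~R k w.
Proof.
move=> z0; rewrite branch_log; have -> : p + h + s%:~R - p - h = s%:~R :> C by ring.
by rewrite cexpMz cexp_lbranch.
Qed.

End Homogeneous.

(* the operators and the coefficients of the expansion
   Delta(x) v = v + log x u_0 v + \sum_(j >= 1) (-1)^j / (-j) x^-j u_j v *)
Definition uop (i : nat) (v : V) : V := if i is j.+1 then vmode u j%:Z v else v.
Definition ucoef (i : nat) (l : C) : C := if i is j.+1 then logmono j l else 1.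

(** Index 0 stands for v and index j + 1 for u_j v, so [i.-1] is the shift of the mode. The factor
    z^j makes up for the z^-j inside [ucoef]: with it, each mode appears with the power of z it has
    in the untwisted operator. *)
Lemma branchE p h v w r z (s : int) J : wt p v -> W1 Wg h w -> z != 0 ->
  (forall j : nat, (J <= j)%N -> vmode u j%:Z v = 0) ->
  branch Wg Yg r v z w (p + h + s%:~R) =
  \sum_(i < J.+1) (ucoef i (lbranch r z) * z ^ (s + i.-1%:Z)) *:
     YW (uop i v) (- s - 1 - i.-1%:Z) w.
Proof.
move=> vp wh z0 hJ; rewrite (branch_int vp wh) // big_ord_recl big_ord1.
rewrite !(twistYE VV sq0 BW _ _ _ hJ) /= expr0 expr1 mulr1.
rewrite big_ord_recl /= mul1r subr0 addr0 scalerDr -addrA; congr (_ + _).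
rewrite scaler_sumr; under [X in X + _]eq_bigr do rewrite scalerA.
have z1 : cexp (lbranch r z) = z by exact: cexp_lbranch.
case: J hJ => [|J] hJ.
  by rewrite !big_ord0 add0r hJ // (lin0 ((BW _).2 _)) scaler0.
rewrite !big_ord_recl logcoef0 mulr0 scale0r add0r addrC /= subr0 addr0 [z ^ s * _]mulrC.
congr (_ + _); apply: eq_bigr => i _; rewrite /bump /= !add1n.
rewrite z1 expfzDr // -exprnP; congr (_ *: _).
by field; rewrite expf_neq0.
Qed.

Section Pairing.
Variable w' : {linear W -> C^o}.
Variable F1 : {fset C}.
Hypothesis w'0 : forall n x, n \notin F1 -> W1 Wg n x -> w' x = 0.

Lemma pairing_fset y : (forall n, W1 Wg n (y n)) -> pairing w' y = \sum_(n <- F1) w' (y n).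
Proof. by move=> hy; apply: fsum_fset => n nF; exact: (w'0 nF). Qed.

(** The offset c can be adapted to the intermediate weight, so that one finite set E serves for all
    of them. *)
Lemma pairing_branch p h v w r z (c : int) (E : {fset int}) : wt p v -> W1 Wg h w ->
  (forall e, e \notin E -> p + h + (c - e)%:~R \notin F1) ->
  pairing w' (branch Wg Yg r v z w) =
  \sum_(e <- E) w' (branch Wg Yg r v z w (p + h + (c - e)%:~R)).
Proof.
move=> vp wh hE; apply: (fsum_inj (h := fun e : int => p + h + (c - e)%:~R)).
  by move=> x y /addrI /intr_inj; lia.
move=> n hn; have [[s nE]|out] := pselect (exists s : int, n = p + h + s%:~R).
  have sE : s = c - (c - s) by lia.
  have : n \notin F1.
    rewrite nE sE; apply: hE; apply/negP => /hn; apply; rewrite nE -sE //.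
  by move=> /w'0; apply; exact: branch_in.
rewrite (branch_out vp wh) ?linear0 // => s e; apply: out; by exists s.
Qed.

Lemma fset_weights (c : C) : exists E : {fset int}, forall e, e \notin E -> c - e%:~R \notin F1.
Proof.
have hi : injective (fun e : int => c - e%:~R) by move=> x y /addrI /oppr_inj /intr_inj.
by have [E hE] := fset_preimage F1 hi; exists E => e; rewrite hE.
Qed.

(** The result has weight h + pa + pb - 2 - e whatever the intermediate weight, so E does not depend
    on n. The two mode indices add up to e minus the shifts due to u. *)
Lemma pairing_iterated_branch pa va la za ra pb vb zb rb h w J (E : {fset int}) (n : int) :
  wt pa va -> wt pb vb -> W1 Wg h w -> za != 0 -> zb != 0 -> la = lbranch ra za ->
  (forall j : nat, (J <= j)%N -> vmode u j%:Z va = 0 /\ vmode u j%:Z vb = 0) ->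
  (forall e, e \notin E -> h + pa + pb - 2%:R - e%:~R \notin F1) ->
  pairing w' (branch Wg Yg ra va za (branch Wg Yg rb vb zb w (pb + h + (- n - 1)%:~R))) =
  \sum_(e <- E) \sum_(i < J.+1) \sum_(j < J.+1)
    ucoef i la * ucoef j (lbranch rb zb) *
    (za ^ (n - 1 - e + i.-1%:Z) * zb ^ (- n - 1 + j.-1%:Z) *
     w' (YW (uop i va) (e - n - i.-1%:Z) (YW (uop j vb) (n - j.-1%:Z) w))).
Proof.
move=> pa_ pb_ wh za0 zb0 -> hJ hE.
set x := branch _ _ _ _ _ w _.
have xk : W1 Wg (pb + h + (- n - 1)%:~R) x by exact: branch_in.
rewrite (pairing_branch _ _ (c := n - 1) (E := E) pa_ xk); last first.
  move=> e /hE.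
  have -> // : pa + (pb + h + (- n - 1)%:~R) + (n - 1 - e)%:~R =
    h + pa + pb - 2%:R - e%:~R :> C by rewrite !rmorphB rmorphN /=; ring.
apply: eq_bigr => e _.
rewrite (branchE _ _ pa_ xk za0 (fun j Jj => (hJ j Jj).1)) linear_sum.
apply: eq_bigr => i _; rewrite functionalZ.
rewrite /x (branchE _ _ pb_ wh zb0 (fun j Jj => (hJ j Jj).2)).
rewrite (lin_sum ((BW _).1 _)) linear_sum mulr_sumr.
apply: eq_bigr => j _; rewrite (linZ ((BW _).1 _)) functionalZ.
have -> : - (n - 1 - e) - 1 - i.-1%:Z = e - n - i.-1%:Z by lia.
have -> : - (- n - 1) - 1 - j.-1%:Z = n - j.-1%:Z by lia.
ring.
Qed.

End Pairing.

(** * Duality *)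

Hypothesis gV : is_grading (@wt R V).
Hypothesis tW : truncated YW.

Lemma correlation_exists (a b : V) (w : W) (w' : {linear W -> C^o}) (e : int) :
  exists Rf : C -> C -> C,
  [/\ branch_function (fun _ _ z1 z2 => Rf z1 z2),
      (forall z1 z2, z2 != 0 -> cabs z2 < cabs z1 ->
        acvg (fun m : int => (w' (YW a m (YW b (e - m) w)) : C)
                * z1 ^ (- m - 1) * z2 ^ (m - e - 1)) (Rf z1 z2)),
      (forall z1 z2, z1 != 0 -> cabs z1 < cabs z2 ->
        acvg (fun m : int => (w' (YW b (e - m) (YW a m w)) : C)
                * z1 ^ (- m - 1) * z2 ^ (m - e - 1)) (Rf z1 z2))
    & (forall z1 z2, z1 != z2 -> cabs (z1 - z2) < cabs z2 ->
        acvg (fun l : int => (w' (YW (vmode a l b) (e - l) w) : C)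
                * (z1 - z2) ^ (- l - 1) * z2 ^ (l - e - 1)) (Rf z1 z2))].
Proof.
have [Ka hKa] := trunc_nat a w tW; have [Kb hKb] := trunc_nat b w tW.
have [Kab hKab] := trunc_nat a b tV.
(* The summand |e| accounts for the modes of b being indexed by e - m. *)
pose K := (Ka + Kb + Kab + `|e|)%N.
pose M m : C := w' (YW a m (YW b (e - m) w)).
pose M' m : C := w' (YW b (e - m) (YW a m w)).
pose I l : C := w' (YW (vmode a l b) (e - l) w).
have hM n : (K <= n)%N -> M (Negz n) = 0.
  move=> Kn; rewrite /M hKb ?(lin0 ((BW _).1 _)) ?linear0 //.
  by move: Kn; rewrite /K; lia.
have hM' n : (K <= n)%N -> M' n%:Z = 0.
  move=> Kn; rewrite /M' hKa ?(lin0 ((BW _).1 _)) ?linear0 //.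
  by move: Kn; rewrite /K; lia.
have hKi (i : nat) : (K <= i)%N -> vmode a i%:Z b = 0.
  by move=> Kn; apply: hKab; move: Kn; rewrite /K; lia.
have hI n : (K <= n)%N -> I n%:Z = 0.
  by move=> Kn; rewrite /I hKi // (lin0 ((BW _).2 _)) linear0.
have hcomm m : M m - M' m = \sum_(i < K) gbinom R m i * I i%:Z.
  have -> : M m - M' m = w' (YW a m (YW b (e - m) w) - YW b (e - m) (YW a m w)).
    by rewrite linearB.
  rewrite (commutator_formula BW jW _ _ _ hKi) linear_sum; apply: eq_bigr => i _.
  by rewrite functionalZ /I; congr (_ * w' (YW _ _ _)); lia.
have hiter j : I (Negz j) = \sum_(i < K) (-1) ^+ i * gbinom R (Negz j) i *
    (M (Negz j - i%:Z) - (-1) ^ (Negz j) * M' i%:Z).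
  rewrite /I (iterate_formula BW jW _ (K := K)) => [|i Ki|i Ki].
  - rewrite linear_sum; apply: eq_bigr => i _; rewrite functionalZ; congr (_ * _).
    rewrite linearB [X in _ - X]functionalZ /M /M'; congr (w' (YW _ _ (YW _ _ _)) - _ * w' (YW _ _ _)); lia.
  - by apply: hKb; move: Ki; rewrite /K; lia.
  by apply: hKa; move: Ki; rewrite /K; lia.
exists (correlation M M' I K e); split.
- rewrite /correlation; apply: branch_functionD; last first.
    apply: branch_function_sum => i _; apply: branch_functionM; last exact: branch_function_pole.
    by apply: branch_functionM; [exact: branch_function_cst|exact: branch_function_z2].
  apply: branch_functionD; apply: branch_function_sum => i _.
    apply: branch_functionM; last exact: branch_function_z2.
    by apply: branch_functionM; [exact: branch_function_cst|exact: branch_function_z1].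
  apply: branch_functionM; last exact: branch_function_z2.
  by apply: branch_functionM; [exact: branch_function_cst|exact: branch_function_z1].
- by move=> z1 z2 z20 lt; exact: (correlation_product e hM hM' hcomm).
- by move=> z1 z2 z20 lt; exact: (correlation_product_swap e hM hM' hcomm).
by move=> z1 z2 z20 lt; exact: (correlation_iterate e hM hI hiter).
Qed.

(** Duality for fixed vectors, with a branch function in place of explicit coefficients: in this
    form it is additive in each of v1, v2 and w. *)
Definition dual_ok (v1 v2 : V) (w : W) (w' : {linear W -> C^o}) :=
  exists F, branch_function F /\ forall (r : int) (z1 z2 : C),
    [/\ z2 != 0 -> cabs z2 < cabs z1 ->
          acvg (fun k => pairing w' (branch Wg Yg r v1 z1 (branch Wg Yg r v2 z2 w k)))
               (F (lbranch r z1) (lbranch r z2) z1 z2),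
        z1 != 0 -> cabs z1 < cabs z2 ->
          acvg (fun k => pairing w' (branch Wg Yg r v2 z2 (branch Wg Yg r v1 z1 w k)))
               (F (lbranch r z1) (lbranch r z2) z1 z2)
      & z1 != z2 -> cabs (z1 - z2) < cabs z2 -> forall r1 : int,
          `|complex.Im (lbranch r1 z1 - lbranch r z2)| < pi / 2%:R ->
          acvg (fun k => pairing w' (branch Wg Yg r (vcomp v1 (z1 - z2) v2 k) z2 w))
               (F (lbranch r1 z1) (lbranch r z2) z1 z2)].

Lemma vcomp_in (v1 : V) z v2 k : wt k (vcomp v1 z v2 k).
Proof.
apply: subspace_fsum => [|m]; first exact: (gV.1 k).
by apply: subspaceZ; [exact: (gV.1 k)|exact: (proj_in gV)].
Qed.

Lemma vcomp_int p1 (v1 : V) p2 v2 z (l : int) : wt p1 v1 -> wt p2 v2 ->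
  vcomp v1 z v2 (p1 + p2 + (- l - 1)%:~R) = z ^ (- l - 1) *: vmode v1 l v2.
Proof.
move=> h1 h2; rewrite /vcomp (fsum_at (i0 := l)) => [|m /eqP ml].
  rewrite (proj_at gV _ (mode_wt l h1 h2)) ifT //.
  by apply/eqP; rewrite !rmorphB rmorphN /=; ring.
rewrite (proj_at gV _ (mode_wt m h1 h2)) ifF ?scaler0 //.
apply/negP => /eqP h; apply: ml.
have : (- l - 1)%:~R = (- m - 1)%:~R :> C.
  by apply: (addrI (p1 + p2)); rewrite h !rmorphB rmorphN /=; ring.
by move/intr_inj; lia.
Qed.

Lemma vcomp_out p1 (v1 : V) p2 v2 z k : wt p1 v1 -> wt p2 v2 ->
  (forall l : int, k <> p1 + p2 + (- l - 1)%:~R) -> vcomp v1 z v2 k = 0.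
Proof.
move=> h1 h2 out; apply: fsum_0 => m.
rewrite (proj_at gV _ (mode_wt m h1 h2)) ifF ?scaler0 //.
apply/negP => /eqP h; apply: (out m); rewrite h !rmorphB rmorphN /=; ring.
Qed.

Lemma branch_0w r v z n : branch Wg Yg r v z 0 n = 0.
Proof.
apply: fsum_0 => sk; rewrite (lin0 (twistY_linear_w _ _ _)).
by rewrite (lin0 (proj_linear gW _)) scaler0.
Qed.

Lemma branch_0v r z w n : branch Wg Yg r 0 z w n = 0.
Proof.
apply: fsum_0 => sk; rewrite (lin0 (twistY_linear_v _ _ _)).
by rewrite (lin0 (proj_linear gW _)) scaler0.
Qed.

Lemma pairing_0 (w' : {linear W -> C^o}) y : (forall n, y n = 0) -> pairing w' y = 0.
Proof. by move=> h; apply: fsum_0 => n; rewrite h linear0. Qed.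

(** * Duality for homogeneous vectors *)

Section HomogeneousDuality.
Variables (p1 p2 h : C) (v1 v2 : V) (w : W) (w' : {linear W -> C^o}) (F1 : {fset C}).
Hypotheses (hv1 : wt p1 v1) (hv2 : wt p2 v2) (hw : W1 Wg h w).
Hypothesis w'0 : forall n x, n \notin F1 -> W1 Wg n x -> w' x = 0.
Variables (J : nat) (E : {fset int}) (Rf : int -> nat -> nat -> C -> C -> C).
Hypothesis hJ : forall j : nat, (J <= j)%N -> vmode u j%:Z v1 = 0 /\ vmode u j%:Z v2 = 0.
Hypothesis hE : forall e, e \notin E -> h + p1 + p2 - 2%:R - e%:~R \notin F1.

Local Notation deg e i j := (e - i.-1%:Z - j.-1%:Z).

(** For fixed e, i and j the logarithmic factors are constant, and the sum over intermediate weights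
    is a sum over modes, reindexed by m = e - i.-1 - n. *)
Lemma twisted_product r (z1 z2 : C) : z1 != 0 -> z2 != 0 ->
  (forall e i j, acvg (fun m : int =>
     (w' (YW (uop i v1) m (YW (uop j v2) (deg e i j - m) w)) : C)
       * z1 ^ (- m - 1) * z2 ^ (m - deg e i j - 1)) (Rf e i j z1 z2)) ->
  acvg (fun k => pairing w' (branch Wg Yg r v1 z1 (branch Wg Yg r v2 z2 w k)))
    (\sum_(e <- E) \sum_(i < J.+1) \sum_(j < J.+1)
       ucoef i (lbranch r z1) * ucoef j (lbranch r z2) * Rf e i j z1 z2).
Proof.
move=> z10 z20 hR.
apply: (acvg_inj (h := fun n : int => p2 + h + (- n - 1)%:~R)
  (a := fun n => pairing w' (branch Wg Yg r v1 z1
     (branch Wg Yg r v2 z2 w (p2 + h + (- n - 1)%:~R))))) => //.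
- by move=> x y /addrI /intr_inj; lia.
- move=> k out; apply: pairing_0 => n.
  rewrite (branch_out hv2 hw) ?branch_0w // => s e.
  by apply: (out (- s - 1)); rewrite e; congr (_ + _%:~R); lia.
rewrite (_ : (fun n => _) = fun n : int => \sum_(e <- E) \sum_(i < J.+1) \sum_(j < J.+1)
    ucoef i (lbranch r z1) * ucoef j (lbranch r z2) *
    (z1 ^ (n - 1 - e + i.-1%:Z) * z2 ^ (- n - 1 + j.-1%:Z) *
     w' (YW (uop i v1) (e - n - i.-1%:Z) (YW (uop j v2) (n - j.-1%:Z) w)))); last first.
  apply/funext => n.
  exact: (pairing_iterated_branch w'0 _ _ hv1 hv2 hw z10 z20 erefl hJ hE).
apply: acvg_sum => e _; apply: acvg_sum => i _; apply: acvg_sum => j _; apply: acvgZ.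
have bij : bijective (fun n : int => e - i.-1%:Z - n).
  by exists (fun n : int => e - i.-1%:Z - n) => n; lia.
have := acvg_bij bij (hR e i j); congr acvg; apply/funext => n /=.
have -> : deg e i j - (e - i.-1%:Z - n) = n - j.-1%:Z by lia.
have -> : e - i.-1%:Z - n = e - n - i.-1%:Z by lia.
rewrite -mulrA mulrC; congr (z1 ^ _ * z2 ^ _ * _); lia.
Qed.

Lemma twisted_product_swap r (z1 z2 : C) : z1 != 0 -> z2 != 0 ->
  (forall e i j, acvg (fun m : int =>
     (w' (YW (uop j v2) (deg e i j - m) (YW (uop i v1) m w)) : C)
       * z1 ^ (- m - 1) * z2 ^ (m - deg e i j - 1)) (Rf e i j z1 z2)) ->
  acvg (fun k => pairing w' (branch Wg Yg r v2 z2 (branch Wg Yg r v1 z1 w k)))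
    (\sum_(e <- E) \sum_(i < J.+1) \sum_(j < J.+1)
       ucoef i (lbranch r z1) * ucoef j (lbranch r z2) * Rf e i j z1 z2).
Proof.
move=> z10 z20 hR.
apply: (acvg_inj (h := fun n : int => p1 + h + (- n - 1)%:~R)
  (a := fun n => pairing w' (branch Wg Yg r v2 z2
     (branch Wg Yg r v1 z1 w (p1 + h + (- n - 1)%:~R))))) => //.
- by move=> x y /addrI /intr_inj; lia.
- move=> k out; apply: pairing_0 => n.
  rewrite (branch_out hv1 hw) ?branch_0w // => s e.
  by apply: (out (- s - 1)); rewrite e; congr (_ + _%:~R); lia.
rewrite (_ : (fun n => _) = fun n : int => \sum_(e <- E) \sum_(i < J.+1) \sum_(j < J.+1)
    ucoef i (lbranch r z1) * ucoef j (lbranch r z2) *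
    (z2 ^ (n - 1 - e + j.-1%:Z) * z1 ^ (- n - 1 + i.-1%:Z) *
     w' (YW (uop j v2) (e - n - j.-1%:Z) (YW (uop i v1) (n - i.-1%:Z) w)))); last first.
  apply/funext => n; rewrite (pairing_iterated_branch (J := J) (E := E) w'0 r n hv2 hv1 hw
    z20 z10 erefl) => [|j /hJ[]//|e /hE]; last first.
    by rewrite [h + p2 + p1]addrAC.
  apply: eq_bigr => e _; rewrite exchange_big; apply: eq_bigr => i _.
  by apply: eq_bigr => j _; rewrite [ucoef j _ * _]mulrC.
apply: acvg_sum => e _; apply: acvg_sum => i _; apply: acvg_sum => j _; apply: acvgZ.
have bij : bijective (fun n : int => n - i.-1%:Z).
  by exists (fun n : int => n + i.-1%:Z) => n; lia.
have := acvg_bij bij (hR e i j); congr acvg; apply/funext => n /=.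
have -> : deg e i j - (n - i.-1%:Z) = e - n - j.-1%:Z by lia.
rewrite -mulrA mulrC [X in X * _]mulrC; congr (z2 ^ _ * z1 ^ _ * _); lia.
Qed.

(** On (v1)_l v2 the operator u_j yields (v1)_l u_j v2, which keeps the factor at z2, and the
    vectors (u_i v1)_(j+l-i) v2 with binomial coefficients. For fixed i, summing the latter over j
    is the Taylor expansion of [logmono i] at z2, which turns the factor at z2 into the one at
    z1. *)
Lemma twisted_iterate r r1 (z1 z2 : C) : z1 != z2 -> cabs (z1 - z2) < cabs z2 ->
  `|complex.Im (lbranch r1 z1 - lbranch r z2)| < pi / 2%:R ->
  (forall e i j, acvg (fun l : int =>
     (w' (YW (vmode (uop i v1) l (uop j v2)) (deg e i j - l) w) : C)
       * (z1 - z2) ^ (- l - 1) * z2 ^ (l - deg e i j - 1)) (Rf e i j z1 z2)) ->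
  acvg (fun k => pairing w' (branch Wg Yg r (vcomp v1 (z1 - z2) v2 k) z2 w))
    (\sum_(e <- E) \sum_(i < J.+1) \sum_(j < J.+1)
       ucoef i (lbranch r1 z1) * ucoef j (lbranch r z2) * Rf e i j z1 z2).
Proof.
move=> ne lt im hR; set l1 := lbranch r1 z1 in im *; set l2 := lbranch r z2 in im *.
set z0 := z1 - z2 in lt hR *.
have z20 : z2 != 0 by rewrite -cabs_eq0 gt_eqF // (le_lt_trans (cabs_ge0 _) lt).
have z00 : z0 != 0 by rewrite subr_eq0.
have z10 : z1 != 0.
  by apply: contraTneq lt => z1E; rewrite /z0 z1E sub0r cabsN ltxx.
have e2 : cexp l2 = z2 by exact: cexp_lbranch.
have e1 : cexp l1 = cexp l2 + z0 by rewrite e2 cexp_lbranch // /z0 addrC subrK.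
(* With u applied to both vectors all terms of the iterate vanish, hence so does the limit, which is
   unique. *)
have R0 e i j : Rf e i.+1 j.+1 z1 z2 = 0.
  apply: acvg_uniq (hR e i.+1 j.+1) _.
  rewrite [X in acvg X](_ : _ = fun=> 0); first exact: acvg0.
  by apply/funext => l; rewrite /= sq0 (lin0 ((BW _).2 _)) linear0 !mul0r.
have -> : \sum_(e <- E) \sum_(i < J.+1) \sum_(j < J.+1)
       ucoef i l1 * ucoef j l2 * Rf e i j z1 z2 =
    \sum_(e <- E) (Rf e 0%N 0%N z1 z2 + \sum_(j < J) logmono j l2 * Rf e 0%N j.+1 z1 z2
       + \sum_(i < J) logmono i l1 * Rf e i.+1 0%N z1 z2).
  apply: eq_bigr => e _; rewrite big_ord_recl [X in X + _]big_ord_recl /=.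
  rewrite !mul1r; congr (_ + _ + _); first by apply: eq_bigr => j _; rewrite mul1r.
  apply: eq_bigr => i _; rewrite big_ord_recl big1 ?addr0 /= ?mulr1 // => j _.
  by rewrite R0 mulr0.
have [T hT] : exists T : nat, forall i : nat, (i < J)%N -> forall n : int, T%:Z <= n ->
    vmode (vmode u i%:Z v1) n v2 = 0.
  have tr i := trunc_nat (vmode u (i : nat)%:Z v1) v2 tV.
  exists (\sum_(i < J) projT1 (cid (tr i)))%N => i iJ n hn.
  have := projT2 (cid (tr i)); apply; apply: le_trans hn.
  by rewrite lez_nat (bigD1 (Ordinal iJ)) //= leq_addr.
(* Beyond [B l] the operators u_j annihilate (v1)_l v2. The bound grows with l because (u_i
   v1)_(j+l-i) v2 is known to vanish only once j + l - i >= T. *)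
pose B (l : int) : nat := (T + `|l| + J)%N.
have hB l : forall j : nat, (B l <= j)%N -> vmode u j%:Z (vmode v1 l v2) = 0.
  move=> j Bj; rewrite (umode_vmode VV _ _ _ (fun i Ji => (hJ Ji).1)).
  rewrite (hJ _).2 ?(lin0 ((BV _).1 _)) ?add0r; last by move: Bj; rewrite /B; lia.
  apply: big1 => i _; rewrite hT ?scaler0 //.
  by move: Bj (ltn_ord i); rewrite /B; lia.
apply: (acvg_inj (h := fun l : int => p1 + p2 + (- l - 1)%:~R)
  (a := fun l => pairing w' (branch Wg Yg r
     (vcomp v1 z0 v2 (p1 + p2 + (- l - 1)%:~R)) z2 w))) => //.
- by move=> x y /addrI /intr_inj; lia.
- move=> k out; apply: pairing_0 => n.
  by rewrite (vcomp_out _ hv1 hv2 out) branch_0v.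
pose S e i j l : C := w' (YW (vmode (uop i v1) l (uop j v2)) (deg e i j - l) w)
       * z0 ^ (- l - 1) * z2 ^ (l - deg e i j - 1).
(* Product of a Taylor term of [logmono i] and a term of the correlation series of u_i v1 and v2.
   The pairs (j, l + j - i) make up the contribution to degree l. *)
pose D e i (x : nat * int) : C :=
  (logmono x.1 l2 * 'C(x.1, i)%:R * z0 ^+ (x.1 - i)) * S e i.+1 0%N x.2.
have key l : pairing w' (branch Wg Yg r (vcomp v1 z0 v2 (p1 + p2 + (- l - 1)%:~R)) z2 w) =
   \sum_(e <- E) (S e 0%N 0%N l + \sum_(j < J) logmono j l2 * S e 0%N j.+1 l
       + \sum_(i < J) \sum_(j < B l) D e i (j : nat, l + j%:Z - i%:Z)).
  have yk := vcomp_in v1 z0 v2 (p1 + p2 + (- l - 1)%:~R).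
  have hy (j : nat) : (B l <= j)%N ->
      vmode u j%:Z (vcomp v1 z0 v2 (p1 + p2 + (- l - 1)%:~R)) = 0.
    by move=> /hB e; rewrite (vcomp_int _ _ hv1 hv2) (linZ (umode_linear u VV _)) e scaler0.
  rewrite (pairing_branch (c := l - 1) (E := E) w'0 _ _ yk hw);
      last first.
    move=> e /hE.
    have -> // : p1 + p2 + (- l - 1)%:~R + h + (l - 1 - e)%:~R =
      h + p1 + p2 - 2%:R - e%:~R :> C by rewrite !rmorphB rmorphN /=; ring.
  apply: eq_bigr => e _.
  rewrite (branchE _ _ yk hw z20 hy) linear_sum big_ord_recl.
  have d1 : - (l - 1 - e) - 1 - 0%:Z = deg e 0%N 0%N - l by rewrite /=; lia.
  rewrite -[RHS]addrA; congr (_ + _).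
    rewrite functionalZ (vcomp_int _ _ hv1 hv2) /= mul1r (linZ ((BW _).2 _)) functionalZ.
    rewrite [- _ - 1 - 0%:Z]d1 /S /=.
    have -> : z2 ^ (l - 1 - e + 0%:Z) = z2 ^ (l - (e - 0%:Z - 0%:Z) - 1).
      by congr (_ ^ _); lia.
    by ring.
  (* The added terms vanish because u_j v2 = 0 for j >= J. *)
  have -> : \sum_(j < J) logmono j l2 * S e 0%N j.+1 l =
      \sum_(j < B l) logmono j l2 * S e 0%N j.+1 l.
    pose f j := logmono j l2 * S e 0%N j.+1 l.
    have f0 j : (J <= j)%N -> f j = 0.
      move=> /hJ[_ uj]; rewrite /f /S /= uj (lin0 ((BV _).1 _)) (lin0 ((BW _).2 _)).
      by rewrite linear0 !mul0r mulr0.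
    rewrite -(fsum_ord f0) (fsum_ord (K := B l)) // => j Bj; apply: f0.
    by apply: leq_trans Bj; rewrite /B leq_addl.
  rewrite exchange_big -big_split; apply: eq_bigr => j _ /=.
  rewrite functionalZ (vcomp_int _ _ hv1 hv2) (linZ (umode_linear u VV _)).
  rewrite (umode_vmode VV _ _ _ (fun i Ji => (hJ Ji).1)).
  rewrite (linZ ((BW _).2 _)) functionalZ (linD ((BW _).2 _)) linearD.
  rewrite (lin_sum ((BW _).2 _)) linear_sum mulrDr mulrDr -/l2.
  have zE : z2 ^ (l - 1 - e + j%:Z) = z2 ^ (l - deg e 0%N j.+1 - 1).
    by congr (_ ^ _); rewrite /=; lia.
  congr (_ + _).
    rewrite /S /= zE; have -> : - (l - 1 - e) - 1 - j%:Z = deg e 0%N j.+1 - l by rewrite /=; lia.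
    by rewrite /=; ring.
  rewrite !mulr_sumr; apply: eq_bigr => i _.
  rewrite (linZ ((BW _).2 _)) functionalZ /D /S /=.
  have [ij|ji] := leqP i j; last by rewrite bin_small // !(mul0r, mulr0).
  have -> : - (l - 1 - e) - 1 - j%:Z = deg e i.+1 0%N - (l + j%:Z - i%:Z) by rewrite /=; lia.
  have -> : l + j%:Z - i%:Z = j%:Z + l - i%:Z by lia.
  have -> : z0 ^ (- l - 1) = z0 ^+ (j - i) * z0 ^ (- (j%:Z + l - i%:Z) - 1).
    by rewrite exprnP -expfzDr //; congr (_ ^ _); lia.
  have -> : z2 ^ (l - 1 - e + j%:Z) = z2 ^ (j%:Z + l - i%:Z - deg e i.+1 0%N - 1).
    by congr (_ ^ _); rewrite /=; lia.
  by rewrite /=; ring.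
rewrite (_ : (fun l => _) = fun l : int =>
   \sum_(e <- E) (S e 0%N 0%N l + \sum_(j < J) logmono j l2 * S e 0%N j.+1 l
       + \sum_(i < J) \sum_(j < B l) D e i (j : nat, l + j%:Z - i%:Z))); last first.
  by apply/funext => l; exact: key.
apply: acvg_sum => e _; apply: acvgD.
  by apply: acvgD; [exact: hR|apply: acvg_sum => j _; apply: acvgZ; exact: hR].
apply: acvg_sum => i _.
have cl : acvg (fun j => logmono j l2 * 'C(j, i)%:R * z0 ^+ (j - i)) (logmono i l1).
  by apply: acvg_logmono => //; rewrite e2.
have := acvg_mul cl (hR e i.+1 0%N).
apply: (acvg_regroup (h := fun x : nat * int => x.2 - x.1%:Z + i%:Z)
   (Fib := fun l => [fset (j, l + j%:Z - i%:Z) | j in iota 0 (B l)]%fset)).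
- by move=> l [j m] /mem_fset_iota[j' _ [-> ->]] /=; lia.
- move=> [j m] /= nin; have [jB|jB] := ltnP j (B (m - j%:Z + i%:Z)).
    case/negP: nin; apply/mem_fset_iota; exists j => //; congr pair; lia.
  rewrite /= hT // ?(lin0 ((BW _).2 _)) ?linear0 ?mul0r ?mulr0 //.
  by move: jB (ltn_ord i); rewrite /B; lia.
move=> l; rewrite (big_fset_iota (f := fun j : nat => (j, l + j%:Z - i%:Z))) //.
by move=> x y [].
Qed.

End HomogeneousDuality.

Lemma branch_function_ucoef1 i : branch_function (fun l1 _ _ _ : C => ucoef i l1).
Proof. by case: i => [|i]; [exact: branch_function_cst|exact: branch_function_logmono1]. Qed.

Lemma branch_function_ucoef2 i : branch_function (fun _ l2 _ _ : C => ucoef i l2).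
Proof. by case: i => [|i]; [exact: branch_function_cst|exact: branch_function_logmono2]. Qed.

(** * Reduction of duality to homogeneous vectors *)

Section FixedFunctional.
Variables (w' : {linear W -> C^o}) (F1 : {fset C}).
Hypothesis w'0 : forall n x, n \notin F1 -> W1 Wg n x -> w' x = 0.

Lemma dual_ok_homogeneous p1 p2 h v1 v2 w :
  wt p1 v1 -> wt p2 v2 -> W1 Wg h w -> dual_ok v1 v2 w w'.
Proof.
move=> hv1 hv2 hw.
have [J hJ] := umode_trunc2 v1 v2.
have [E hE] := fset_weights F1 (h + p1 + p2 - 2%:R).
have rf (e : int) i j := correlation_exists (uop i v1) (uop j v2) w w'
  (e - i.-1%:Z - j.-1%:Z).
pose Rf e i j := projT1 (cid (rf e i j)).
have hR e i j := projT2 (cid (rf e i j)).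
exists (fun l1 l2 z1 z2 => \sum_(e <- E) \sum_(i < J.+1) \sum_(j < J.+1)
       ucoef i l1 * ucoef j l2 * Rf e i j z1 z2); split.
  apply: branch_function_sum => e _; apply: branch_function_sum => i _.
  apply: branch_function_sum => j _; apply: branch_functionM; last by have [] := hR e i j.
  apply: branch_functionM; first exact: branch_function_ucoef1.
  exact: branch_function_ucoef2.
move=> r z1 z2; split.
- move=> z20 lt; have z10 : z1 != 0.
    by rewrite -cabs_eq0 gt_eqF // (le_lt_trans (cabs_ge0 _) lt).
  apply: (twisted_product hv1 hv2 hw w'0 hJ hE r z10 z20).
  by move=> e i j; have [_ + _ _] := hR e i j; apply.
- move=> z10 lt; have z20 : z2 != 0.
    by rewrite -cabs_eq0 gt_eqF // (le_lt_trans (cabs_ge0 _) lt).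
  apply: (twisted_product_swap hv1 hv2 hw w'0 hJ hE r z10 z20).
  by move=> e i j; have [_ _ + _] := hR e i j; apply.
move=> ne lt r1 im.
apply: (twisted_iterate hv1 hv2 hw w'0 hJ hE ne lt im).
by move=> e i j; have [_ _ _ +] := hR e i j; apply.
Qed.

(** Sums of finite support are additive only where the supports are finite; this is checked on
    homogeneous vectors and extended by additivity. *)
Lemma branch_supp v w n : exists X : {fset C * nat}, forall sk, sk \notin X ->
  proj (W1 Wg) n (Yg v sk.1 sk.2 w) = 0.
Proof.
have P0 := lin0 (proj_linear gW n); have PD := linD (proj_linear gW n).
have Yv s k w1 := twistY_linear_v s k w1.
have Yw s k v1 := twistY_linear_w s k v1.
move: v; apply: (grading_ind gV) => [|x y [X hX] [Y hY]|p v vp].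
- by exists fset0 => sk _; rewrite (lin0 (Yv _ _ _)).
- exists (X `|` Y)%fset => sk; rewrite inE negb_or => /andP[/hX hx /hY hy].
  by rewrite (linD (Yv _ _ _)) PD hx hy addr0.
move: w; apply: (grading_ind gW) => [|x y [X hX] [Y hY]|h w wh].
- by exists fset0 => sk _; rewrite (lin0 (Yw _ _ _)).
- exists (X `|` Y)%fset => sk; rewrite inE negb_or => /andP[/hX hx /hY hy].
  by rewrite (linD (Yw _ _ _)) PD hx hy addr0.
exists [fset (n - p - h, k) | k in iota 0 2]%fset => -[s k] nin.
rewrite (proj_twistY vp wh); case: eqP => // e.
rewrite twistY_log // leqNgt; apply: contra nin => k2.
by apply/mem_fset_iota; exists k => //; congr pair; rewrite e /=; ring.
Qed.

Lemma branchDv r v v' z w n :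
  branch Wg Yg r (v + v') z w n = branch Wg Yg r v z w n + branch Wg Yg r v' z w n.
Proof.
have P0 := lin0 (proj_linear gW n); have PD := linD (proj_linear gW n).
have YD s k w1 := linD (twistY_linear_v s k w1).
have [X hX] := branch_supp v w n; have [Y hY] := branch_supp v' w n.
rewrite /branch !(fsum_fset (X := (X `|` Y)%fset)) -?big_split.
- by apply: eq_bigr => sk _; rewrite YD PD scalerDr.
- by move=> sk; rewrite inE negb_or => /andP[_ /hY ->]; rewrite scaler0.
- by move=> sk; rewrite inE negb_or => /andP[/hX -> _]; rewrite scaler0.
by move=> sk; rewrite inE negb_or => /andP[/hX hx /hY hy]; rewrite YD PD hx hy addr0 scaler0.
Qed.

Lemma branchDw r v z w w1 n :
  branch Wg Yg r v z (w + w1) n = branch Wg Yg r v z w n + branch Wg Yg r v z w1 n.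
Proof.
have P0 := lin0 (proj_linear gW n); have PD := linD (proj_linear gW n).
have YD s k v1 := linD (twistY_linear_w s k v1).
have [X hX] := branch_supp v w n; have [Y hY] := branch_supp v w1 n.
rewrite /branch !(fsum_fset (X := (X `|` Y)%fset)) -?big_split.
- by apply: eq_bigr => sk _; rewrite YD PD scalerDr.
- by move=> sk; rewrite inE negb_or => /andP[_ /hY ->]; rewrite scaler0.
- by move=> sk; rewrite inE negb_or => /andP[/hX -> _]; rewrite scaler0.
by move=> sk; rewrite inE negb_or => /andP[/hX hx /hY hy]; rewrite YD PD hx hy addr0 scaler0.
Qed.

Lemma vcomp_supp (v1 v2 : V) n : exists X : {fset int}, forall m, m \notin X ->
  proj (@wt R V) n (vmode v1 m v2) = 0.
Proof.
have P0 := lin0 (proj_linear gV n); have PD := linD (proj_linear gV n).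
move: v1; apply: (grading_ind gV) => [|x y [X hX] [Y hY]|p v vp].
- by exists fset0 => m _; rewrite (lin0 ((BV _).2 _)).
- exists (X `|` Y)%fset => m; rewrite inE negb_or => /andP[/hX hx /hY hy].
  by rewrite (linD ((BV _).2 _)) PD hx hy addr0.
move: v2; apply: (grading_ind gV) => [|x y [X hX] [Y hY]|h w wh].
- by exists fset0 => m _; rewrite (lin0 ((BV _).1 _)).
- exists (X `|` Y)%fset => m; rewrite inE negb_or => /andP[/hX hx /hY hy].
  by rewrite (linD ((BV _).1 _)) PD hx hy addr0.
have hi : injective (fun m : int => h + (p - m%:~R - 1)).
  by move=> x y /addrI /addIr /addrI /oppr_inj /intr_inj.
have [X hX] := fset_preimage [fset n]%fset hi; exists X => m; rewrite hX inE => mn.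
by rewrite (proj_at gV _ (mode_wt m vp wh)) eq_sym (negPf mn).
Qed.

Lemma vcompDl (v1 v1' : V) z v2 n : vcomp (v1 + v1') z v2 n = vcomp v1 z v2 n + vcomp v1' z v2 n.
Proof.
have P0 := lin0 (proj_linear gV n); have PD := linD (proj_linear gV n).
have [X hX] := vcomp_supp v1 v2 n; have [Y hY] := vcomp_supp v1' v2 n.
rewrite /vcomp !(fsum_fset (X := (X `|` Y)%fset)) -?big_split.
- by apply: eq_bigr => m _; rewrite (linD ((BV _).2 _)) PD scalerDr.
- by move=> m; rewrite inE negb_or => /andP[_ /hY ->]; rewrite scaler0.
- by move=> m; rewrite inE negb_or => /andP[/hX -> _]; rewrite scaler0.
move=> m; rewrite inE negb_or => /andP[/hX hx /hY hy].
by rewrite (linD ((BV _).2 _)) PD hx hy addr0 scaler0.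
Qed.

Lemma vcompDr (v1 v2 : V) z v2' n : vcomp v1 z (v2 + v2') n = vcomp v1 z v2 n + vcomp v1 z v2' n.
Proof.
have P0 := lin0 (proj_linear gV n); have PD := linD (proj_linear gV n).
have [X hX] := vcomp_supp v1 v2 n; have [Y hY] := vcomp_supp v1 v2' n.
rewrite /vcomp !(fsum_fset (X := (X `|` Y)%fset)) -?big_split.
- by apply: eq_bigr => m _; rewrite (linD ((BV _).1 _)) PD scalerDr.
- by move=> m; rewrite inE negb_or => /andP[_ /hY ->]; rewrite scaler0.
- by move=> m; rewrite inE negb_or => /andP[/hX -> _]; rewrite scaler0.
move=> m; rewrite inE negb_or => /andP[/hX hx /hY hy].
by rewrite (linD ((BV _).1 _)) PD hx hy addr0 scaler0.
Qed.

Lemma pairingD y y' : (forall n, W1 Wg n (y n)) -> (forall n, W1 Wg n (y' n)) ->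
  pairing w' (fun n => y n + y' n) = pairing w' y + pairing w' y'.
Proof.
move=> hy hy'; rewrite !(pairing_fset w'0) // -?big_split => [|n].
  by apply: eq_bigr => n _; rewrite linearD.
exact: subspaceD (gW.1 n) (hy n) (hy' n).
Qed.

Let bin r v z w n : W1 Wg n (branch Wg Yg r v z w n) := branch_in r v z w n.

Lemma pairing_branchDv r v v1 z w :
  pairing w' (branch Wg Yg r (v + v1) z w) =
  pairing w' (branch Wg Yg r v z w) + pairing w' (branch Wg Yg r v1 z w).
Proof.
by rewrite -pairingD //; congr pairing; apply/funext => n; exact: branchDv.
Qed.

Lemma pairing_branchDw r v z w w1 :
  pairing w' (branch Wg Yg r v z (w + w1)) =
  pairing w' (branch Wg Yg r v z w) + pairing w' (branch Wg Yg r v z w1).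
Proof.
by rewrite -pairingD //; congr pairing; apply/funext => n; exact: branchDw.
Qed.

(** Stated with all three vectors free, so that one lemma covers the splitting of v1, of v2 and of
    w. *)
Lemma dual_ok_add v1 v2 w v1a v2a wa v1b v2b wb :
  (forall r z1 z2 k,
    pairing w' (branch Wg Yg r v1 z1 (branch Wg Yg r v2 z2 w k)) =
    pairing w' (branch Wg Yg r v1a z1 (branch Wg Yg r v2a z2 wa k)) +
    pairing w' (branch Wg Yg r v1b z1 (branch Wg Yg r v2b z2 wb k))) ->
  (forall r z1 z2 k,
    pairing w' (branch Wg Yg r v2 z2 (branch Wg Yg r v1 z1 w k)) =
    pairing w' (branch Wg Yg r v2a z2 (branch Wg Yg r v1a z1 wa k)) +
    pairing w' (branch Wg Yg r v2b z2 (branch Wg Yg r v1b z1 wb k))) ->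
  (forall r z z2 k,
    pairing w' (branch Wg Yg r (vcomp v1 z v2 k) z2 w) =
    pairing w' (branch Wg Yg r (vcomp v1a z v2a k) z2 wa) +
    pairing w' (branch Wg Yg r (vcomp v1b z v2b k) z2 wb)) ->
  dual_ok v1a v2a wa w' -> dual_ok v1b v2b wb w' -> dual_ok v1 v2 w w'.
Proof.
move=> e1 e2 e3 [F [hF cF]] [G [hG cG]].
exists (fun l1 l2 z1 z2 => F l1 l2 z1 z2 + G l1 l2 z1 z2).
split=> [|r z1 z2]; first exact: branch_functionD.
have [f1 f2 f3] := cF r z1 z2; have [g1 g2 g3] := cG r z1 z2; split.
- by move=> h1 h2; have := acvgD (f1 h1 h2) (g1 h1 h2); congr acvg; apply/funext => k; rewrite e1.
- by move=> h1 h2; have := acvgD (f2 h1 h2) (g2 h1 h2); congr acvg; apply/funext => k; rewrite e2.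
move=> h1 h2 r1 h3; have := acvgD (f3 h1 h2 r1 h3) (g3 h1 h2 r1 h3).
by congr acvg; apply/funext => k; rewrite e3.
Qed.

Lemma dual_ok_all v1 v2 w : dual_ok v1 v2 w w'.
Proof.
move: v1; apply: (grading_add_ind gV 0) => [x y dx dy|p1 v1 h1].
  apply: dual_ok_add dx dy => r z1 z2 k; first exact: pairing_branchDv.
    by rewrite branchDv pairing_branchDw.
  by rewrite vcompDl pairing_branchDv.
move: v2; apply: (grading_add_ind gV 0) => [x y dx dy|p2 v2 h2].
  apply: dual_ok_add dx dy => r z1 z2 k; last by rewrite vcompDr pairing_branchDv.
    by rewrite branchDv pairing_branchDw.
  exact: pairing_branchDv.
move: w; apply: (grading_add_ind gW 0) => [x y dx dy|h w hw].
  apply: dual_ok_add dx dy => r z1 z2 k; last exact: pairing_branchDw.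
    by rewrite branchDw pairing_branchDw.
  by rewrite branchDw pairing_branchDw.
exact: dual_ok_homogeneous h1 h2 hw.
Qed.

End FixedFunctional.

Lemma twistY_duality : duality Wg Yg.
Proof.
move=> v1 v2 w w' [F hF].
have w'0 n x : n \notin [fset na.1 | na in F]%fset -> W1 Wg n x -> w' x = 0.
  move=> nF [c dc]; have [_ Sc _] := dc; have [G [_ <-]] := decomp_fset dc.
  rewrite linear_sum big1 // => a _; apply: (hF n a) (Sc a).
  by apply: contra nF => naF; apply/imfsetP; exists (n, a).
have [f [hf cf]] := dual_ok_all w'0 v1 v2 w.
have [N [a [m [n [t [t0 hN]]]]]] := branch_function_fbranch hf.
exists N, a, m, n, t; split=> // r z1 z2; have [c1 c2 c3] := cf r z1 z2.
rewrite !normr_gt0 !cabsE !ltcR.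
have ne z z' : cabs z < cabs z' -> (z : C) != z'.
  by move=> lt; apply: contraTneq lt => ->; rewrite ltxx.
split.
- move=> z20 lt; have z10 : z1 != 0.
    by rewrite -cabs_eq0 gt_eqF // (le_lt_trans (cabs_ge0 _) lt).
  by rewrite -hN ?cexp_lbranch // ?[z1 == z2]eq_sym ?ne //; exact: c1.
- move=> z10 lt; have z20 : z2 != 0.
    by rewrite -cabs_eq0 gt_eqF // (le_lt_trans (cabs_ge0 _) lt).
  by rewrite -hN ?cexp_lbranch // ?ne //; exact: c2.
rewrite subr_eq0 => z12 lt r1 im.
have z20 : z2 != 0 by rewrite -cabs_eq0 gt_eqF // (le_lt_trans (cabs_ge0 _) lt).
have z10 : z1 != 0 by apply: contraTneq lt => ->; rewrite sub0r cabsN ltxx.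
by rewrite -hN ?cexp_lbranch //; exact: c3.
Qed.

(** * The other axioms of a twisted module *)

Hypothesis u_primary : forall n : nat, (2 <= n)%N -> vmode om n%:Z u = 0.

Let u0L := umode_linear u VV 0.
Let u0n := u0_lnilp VV sq0.
Local Notation g := (exp2pii (vmode u 0)).

Lemma monodromyE v : g v = v + twopii R *: vmode u 0 v.
Proof.
rewrite (exp2pii_lnilp u0L u0n (K := 2)); last exact: (umode_mode VV sq0).
by rewrite big_ord_recl big_ord1 /= expr0 divr1 scale1r expr1 -[(bump 0 0)`!]/1%N divr1.
Qed.

(** As u_0 is a derivation killing the vacuum and omega, 1 + 2 pi i u_0 is multiplicative up to a
    product of two u_0-terms, which [sq0] annihilates. *)
Lemma monodromy_automorphism : voa_automorphism g.
Proof.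
have dz : 0 <= 0 :> int by [].
split.
- exact: exp2pii_linear.
- exact: exp2pii_bijective.
- by rewrite monodromyE (umode_vac u VV) // scaler0 addr0.
- by rewrite monodromyE (umode_omega VV u_wt u_primary 0) scaler0 addr0.
move=> v n v'; rewrite !monodromyE.
have [J hJ] := umode_trunc v.
have hJ1 i : (J.+1 <= i)%N -> vmode u i%:Z v = 0 by move=> h; apply: hJ; lia.
have -> : vmode u 0 (vmode v n v') = vmode v n (vmode u 0 v') + vmode (vmode u 0 v) n v'.
  rewrite (umode_vmode VV 0 _ _ hJ1) big_ord_recl big1 => [|i _]; last by rewrite bin0n scale0r.
  by rewrite bin0 scale1r addr0 add0r subr0.
rewrite (linD ((BV _).2 _)) !(linD ((BV _).1 _)) !(linZ ((BV _).1 _)) !(linZ ((BV _).2 _)).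
by rewrite sq0 !scaler0 addr0 scalerDr addrA.
Qed.

Lemma monodromy_compatible : compatible_grading (geneig (vmode u 0)) g.
Proof.
move=> a v; rewrite geneig_lnilp //; case: eqP => [-> _|_ ->]; last first.
  by case: (geneig_subspace (cexp (twopii R * a)) (exp2pii_linear u0L u0n)).
rewrite mulr0 cexp0; exists 2%N => /=.
have e x : g x - 1 *: x = twopii R *: vmode u 0 x by rewrite monodromyE scale1r addrC addKr.
by rewrite !e (linZ u0L) (umode_mode VV sq0) !scaler0.
Qed.

(** Shifting log z by 2 pi i adds 2 pi i times the coefficient of log x. This coefficient is the
    operator of u_0 v, which is also what replacing v by g v adds. *)
Lemma twistY_equivariance : equivariance g Wg Yg.
Proof.
move=> r z v w n z0; set l := lbranch r z.
move: v; apply: (grading_add_ind gV 0) => [x y hx hy|p v vp].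
  by rewrite (linD (exp2pii_linear u0L u0n)) !branchDv hx hy.
move: w; apply: (grading_add_ind gW 0) => [x y hx hy|h w wh].
  by rewrite !branchDw hx hy.
have gp : wt p (g v).
  rewrite monodromyE; apply: (subspaceD (gV.1 p) vp); apply: (subspaceZ _ (gV.1 p)).
  by have := umode_wt 0 vp; rewrite subr0.
have [[s ->]|out] := pselect (exists s : int, n = p + h + s%:~R); last first.
  have out' s : n <> p + h + s%:~R by move=> e; apply: out; exists s.
  by rewrite (branch_out vp wh) //
             (branch_out gp wh).
rewrite (branch_int vp wh) //.
rewrite (branch_int gp wh) // !big_ord_recl !big_ord0 /=.
rewrite !addr0 !expr0 !mulr1 /bump /= !expr1 lbranchS -/l.
have [J hJ] := umode_trunc v.
have uu j : vmode u j (vmode u 0 v) = 0 by exact: (umode_mode VV sq0).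
have YD k x y := linD (twistY_linear_v s%:~R k w) x y.
have YZ k a x := linZ (twistY_linear_v s%:~R k w) a x.
rewrite monodromyE !YD !YZ.
have -> : Yg (vmode u 0 v) s%:~R 1 w = 0.
  rewrite (twistYE VV sq0 BW _ _ _ (J := 0)) => [|j _]; last exact: uu.
  by rewrite uu (lin0 ((BW _).2 _)).
have -> : Yg (vmode u 0 v) s%:~R 0 w = Yg v s%:~R 1 w.
  rewrite (twistYE VV sq0 BW _ _ _ (J := 0)) => [|j _]; last exact: uu.
  by rewrite big_ord0 addr0 (twistYE VV sq0 BW _ _ _ hJ).
rewrite scaler0 addr0 mulrDr scalerDl scalerDr scalerA -addrA; congr (_ + _).
by rewrite addrC.
Qed.

Hypothesis iW : identity_property YW.

Lemma twistY_vac s k w : Yg (vvac V) s k w = if (s == 0) && (k == 0%N) then w else 0.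
Proof.
have [[n ->]|out] := int_or_out s; last first.
  by rewrite (twistY_out VV sq0 BW) //; case: eqP => // e; case: (out 0).
rewrite (twistYE VV sq0 BW _ _ _ (J := 0)) => [|j _]; last exact: (umode_vac u VV).
rewrite big_ord0 addr0 intr_eq0 (umode_vac u VV) // (lin0 ((BW _).2 _)).
case: k => [|[|k]]; rewrite ?andbF // andbT iW; congr (if _ then _ else _).
by apply/eqP/eqP; lia.
Qed.

Lemma twistY_omega_modes s k w : Yg om s k w != 0 ->
  k = 0%N /\ exists n : int, s = n%:~R.
Proof.
have [[n ->]|out] := int_or_out s; last by rewrite (twistY_out VV sq0 BW) ?eqxx.
have [J hJ] := umode_trunc om.
rewrite (twistYE VV sq0 BW _ _ _ hJ); case: k => [|[|k]]; last by rewrite eqxx.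
  by split=> //; exists n.
by rewrite (umode_omega VV u_wt u_primary 0) (lin0 ((BW _).2 _)) eqxx.
Qed.

(** Among the u_j omega with j >= 0 only u_1 omega = u is nonzero, and [logcoef 1] equals 1. *)
Lemma twistLE n w : twistL u YW n w = Lmode YW n w + YW u n w.
Proof.
rewrite /twistL; have -> : - n%:~R - 2%:R = (- n - 2)%:~R :> C by rewrite rmorphB rmorphN.
have uo := umode_omega VV u_wt u_primary.
rewrite (twistYE VV sq0 BW _ _ _ (J := 2)) => [|j]; last by rewrite uo; case: j => [|[|j]].
rewrite !big_ord_recl big_ord0 addr0 logcoef0 scale0r add0r (uo 1%N) /=.
have -> : - (- n - 2) - 1 = n + 1 by lia.
rewrite -[bump 0 0]/1%N /logcoef expr1 invrN invr1 mulrNN mulr1 scale1r.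
have -> : n + 1 - 1%:Z = n by lia.
by rewrite addr0.
Qed.

Lemma alternating_telescope (U : lmodType C) (a : nat -> U) m :
  \sum_(j < m) (-1) ^+ j *: (a j.+1 + a j) = a 0%N - (-1) ^+ m *: a m.
Proof.
elim: m => [|m IH]; first by rewrite big_ord0 scale1r subrr.
rewrite big_ord_recr /= IH scalerDr exprS mulN1r scaleNr opprK addrC.
by rewrite -addrA [_ + (_ - _)]addrCA subrr addr0 addrC.
Qed.

(** Moving u_j past L(-1) produces j u_(j-1). Once the multiples of n + 1 are matched, the terms
    left over form an alternating sum that telescopes to the u_0-term, that is, to the derivative of
    log x. *)
Lemma twistY_L1 s k v w :
  (s + 1) *: Yg v (s + 1) k w + k.+1%:R *: Yg v (s + 1) k.+1 w = Yg (vmode om 0 v) s k w.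
Proof.
have [[n ->]|out] := int_or_out s; last first.
  have out1 m : s + 1 <> m%:~R.
    by move=> e; apply: (out (m - 1)); rewrite rmorphB /= -e addrK.
  by rewrite !(twistY_out VV sq0 BW) // !scaler0 addr0.
have [J hJ] := umode_trunc v.
have uL m := umode_L1 VV u_wt u_primary m v.
have hJ1 (j : nat) : (J.+1 <= j)%N -> vmode u j%:Z v = 0 by move=> Jj; apply: hJ; lia.
(* J + 1, since u_j L(-1) v involves u_(j-1) v. *)
have hJ2 (j : nat) : (J.+1 <= j)%N -> vmode u j%:Z (vmode om 0 v) = 0.
  move=> Jj; rewrite uL hJ1 // (lin0 ((BV _).1 _)) add0r.
  have -> : j%:Z - 1 = j.-1%:Z by lia.
  by rewrite hJ ?scaler0 //; lia.
have n1 : n%:~R + 1 = (n + 1)%:~R :> C by rewrite rmorphD.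
rewrite n1 !(twistYE VV sq0 BW _ _ _ hJ1) (twistYE VV sq0 BW _ _ _ hJ2).
have e1 : - (n + 1) - 1 = - n - 1 - 1 by lia.
rewrite e1; case: k => [|[|k]]; last by rewrite !scaler0 addr0.
- rewrite scale1r scalerDr -addrA dW; congr (_ + _).
    by congr (_ *: _); rewrite -rmorphN; congr (_%:~R); lia.
  pose a (j : nat) := YW (vmode u j%:Z v) (- n - 1 - 1 - j%:Z) w.
  have aJ : a J = 0 by rewrite /a hJ // (lin0 ((BW _).2 _)).
  have -> : YW (vmode u 0 v) (- n - 1 - 1) w = a 0%N by rewrite /a subr0.
  have step (j : nat) : logcoef R j *: YW (vmode u j%:Z (vmode om 0 v)) (- n - 1 - j%:Z) w =
     (n + 1)%:~R *: (logcoef R j *: a j) + (j%:R * logcoef R j) *: (a j + a j.-1).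
    rewrite uL (linD ((BW _).2 _)) dW (linZ ((BW _).2 _)).
    have -> : - n - 1 - j%:Z - 1 = - n - 1 - 1 - j%:Z by lia.
    rewrite -/(a j); case: j => [|j].
      by rewrite logcoef0 mulr0 !scale0r scaler0 addr0.
    have -> : j.+1%:Z - 1 = j%:Z by lia.
    have -> : - n - 1 - j.+1%:Z = - n - 1 - 1 - j%:Z by lia.
    rewrite -/(a j) /= -[(j.+1%:Z)%:~R]/(j.+1%:R).
    have -> : - (- n - 1 - 1 - j%:Z)%:~R = (n + 1)%:~R + j.+1%:R :> C.
      by rewrite !rmorphB !rmorphN rmorphD /= -[(j%:Z)%:~R]/(j%:R) -natr1; ring.
    rewrite scalerDl !scalerDr !scalerA addrA; congr (_ *: _ + _ *: _ + _ *: _); ring.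
  under [RHS]eq_bigr do rewrite step.
  rewrite big_split -scaler_sumr /=; congr (_ + _).
  rewrite big_ord_recl mul0r scale0r add0r.
  transitivity (\sum_(j < J) (-1) ^+ j *: (a j.+1 + a j)).
    by rewrite alternating_telescope aJ scaler0 subr0.
  by apply: eq_bigr => j _; rewrite /= /bump /= add1n logcoefS.
rewrite scaler0 addr0 uL scale0r addr0 dW; congr (_ *: _).
by rewrite -rmorphN; congr (_%:~R); lia.
Qed.

Lemma twistY_map : twisted_map Wg Yg.
Proof.
split=> [s k|v w|m n s k v w vm wn].
- split=> [v|w]; first exact: twistY_linear_w.
  exact: twistY_linear_v.
- by exists 2%N => s k k2; exact: twistY_log.
exact: twistY_W1.
Qed.

End TwistedModule.

(** * Lower bound of the weights *)

Section LowestWeight.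
Variables (R : realType) (W : lmodType R[i]).
Local Notation C := R[i].

Lemma lowest_weight (S : C -> set W) (n : C) w :
  S n w -> w != 0 ->
  (exists N : int, forall l : int, l < N -> S (n + l%:~R) = [set 0]) ->
  exists (j : nat) (w1 : W), [/\ S (n - j%:R) w1, w1 != 0 &
    forall k : nat, (0 < k)%N -> forall x, S (n - j%:R - k%:R) x -> x = 0].
Proof.
move=> Sw w0 [N hN].
pose P (j : nat) := `[< exists2 x, S (n - j%:R) x & x != 0 >].
have exP : exists j, P j by exists 0%N; apply/asboolP; exists w; rewrite ?subr0.
have bP j : P j -> (j <= `|N|)%N.
  move=> /asboolP[x Sx x0]; rewrite leqNgt; apply/negP => Nj.
  have := hN (- j%:Z); rewrite rmorphN /= -[(j%:Z)%:~R]/(j%:R) => h.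
  by move: Sx x0; rewrite h => [->|]; [rewrite eqxx|lia].
case: (ex_maxnP exP bP) => j /asboolP[x Sx x0] jmax.
exists j, x; split=> // k k0 y Sy; apply/eqP; apply: contraT => y0.
have : P (j + k)%N by apply/asboolP; exists y; rewrite // natrD opprD addrA.
by move/jmax; lia.
Qed.

End LowestWeight.

Section LatticeBound.
Variables (R : realType) (V : voaData R) (W : lmodType R[i]).
Variable YW : V -> int -> W -> W.
Local Notation C := R[i].
Local Notation om := (vomega V).
Local Notation L0 := (Lmode YW 0).
Hypothesis tV : truncated (@vmode R V).
Hypotheses (BW : bilinear_modes YW) (tW : truncated YW) (iW : identity_property YW).
Hypotheses (jW : jacobi YW) (dW : L1_derivative YW).
(** In the application these are gamma(-1)1, e^gamma and e^-gamma, the two coefficients of omega,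
    the weight of e^gamma, and the norm 2pq of gamma. *)
Variables (ga e f : V) (al be hg : R) (N : nat).
Hypothesis al_gt0 : 0 < al.
Hypothesis ga_e : forall n : nat, vmode ga n%:Z e = if n == 0%N then N%:R *: e else 0.
Hypothesis om_e : vmode om 0 e = vmode ga (-1) e.
Hypothesis f_e : exists M : int, vmode f M e = vvac V.
Hypothesis omE :
  om = al%:C%C *: vmode ga (-1) ga + be%:C%C *: vmode ga (-2) (vvac V).
Hypothesis ga_wt : wt 1 ga.
Hypothesis e_wt : wt hg%:C%C e.

Let Y0 v n : YW v n 0 = 0. Proof. exact: lin0 ((BW n).1 v). Qed.

(** If all modes of e killed w, so would all modes of every f_l e, by descending induction on l from
    the truncation. But some f_l e is the vacuum, which acts as the identity. *)
Lemma lattice_mode_neq0 w : w != 0 -> exists m, YW e m w != 0.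
Proof.
move=> w0; apply: contrapT => /forallNP e0.
have {}e0 m : YW e m w = 0 by apply/eqP; apply: contraT => h; case: (e0 m).
have [Kf hf] := trunc_nat f w tW; have [K hK] := trunc_nat f e tV.
suff fe (j : nat) (l : int) k : K%:Z - j%:Z <= l -> YW (vmode f l e) k w = 0.
  have [M fM] := f_e; have := fe (K + `|M|)%N M (-1).
  by rewrite fM iW eqxx => /(_ ltac:(lia)) wz; rewrite wz eqxx in w0.
elim: j l k => [|j IH] l k hl; first by rewrite hK ?(lin0 ((BW _).2 _)) //; lia.
(* With f-modes from Kf on the whole left side is zero; on the right the terms i > 0 involve f_(l+i)
   e and vanish by induction. *)
have := jW f e w l Kf%:Z (k - Kf%:Z).
rewrite fsum_0 => [|i]; last first.
  by rewrite e0 hf ?Y0 ?scaler0 ?subr0 ?scaler0 ?Y0 //; lia.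
rewrite (@fsum_at _ _ _ 0%N) => [|i i0]; last by rewrite IH ?scaler0 //; lia.
rewrite (gbinom_nat R Kf) bin0 scale1r addr0.
by have -> : Kf%:Z + (k - Kf%:Z) - 0%:Z = k by lia.
Qed.

Lemma top_mode w : w != 0 -> exists m, YW e m w != 0 /\ forall k, m < k -> YW e k w = 0.
Proof.
move=> /lattice_mode_neq0[m0 hm0]; have [K hK] := trunc_nat e w tW.
pose P (j : nat) := `[< YW e (K%:Z - j%:Z) w != 0 >].
have m0K : m0 < K%:Z by rewrite ltNge; apply: contra hm0 => /hK ->.
have exP : exists j, P j.
  exists `|K%:Z - m0|%N; apply/asboolP.
  by have -> : K%:Z - `|K%:Z - m0|%N%:Z = m0 by lia.
case: (ex_minnP exP) => j /asboolP hj jmin; exists (K%:Z - j%:Z); split=> // k hk.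
apply/eqP; apply: contraT => nz.
have kK : k < K%:Z by rewrite ltNge; apply: contra nz => /hK ->.
have : P `|K%:Z - k|%N.
  apply/asboolP; have -> // : K%:Z - `|K%:Z - k|%N%:Z = k by lia.
by move/jmin; lia.
Qed.

(* e^gamma maps a lowest weight vector to an eigenvector of gamma(0) with an
   integral eigenvalue c: the leading power of x in Y(e^gamma, x) w is governed
   by d/dx Y(e^gamma, x) = Y(gamma(-1) e^gamma, x) *)
Lemma lowest_weight_integral n w : geneig L0 n w -> w != 0 ->
  (forall k : nat, (0 < k)%N -> forall x, geneig L0 (n - k%:R) x -> x = 0) ->
  exists c : int, n = al%:C%C * c%:~R ^+ 2 - be%:C%C * c%:~R - hg%:C%C + N%:R - c%:~R.
Proof.
move=> wn w0 low.
have ga0 (k : nat) : (0 < k)%N -> YW ga k%:Z w = 0.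
  move=> k0; apply: (low k k0).
  have := mode_geneig tV BW jW dW k%:Z ga_wt wn; congr geneig.
  by rewrite -[(k%:Z)%:~R]/(k%:R); ring.
have [m [nz top]] := top_mode w0; set w2 := YW e m w in nz.
have gae (k : nat) : YW ga k%:Z w2 = YW e m (YW ga k%:Z w) + N%:R *: YW e (k%:Z + m) w.
  have := commutator_formula BW jW k%:Z m w (K := 1) (a := ga) (b := e).
  move=> /(_ _)/eqP; rewrite big_ord1 ga_e (gbinom_nat R k) bin0 scale1r subr0.
  rewrite (linZ ((BW _).2 _)) subr_eq addrC => h; apply/eqP/h.
  by move=> i i0; rewrite ga_e; case: i i0.
(* In mode m + 1 the derivative formula for e reads e_m gamma(0) w = -(m + 1) e_m w, and commuting
   gamma(0) past e_m adds N. *)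
pose c : int := N%:Z - m - 1.
have g0 : YW ga 0 w2 = c%:~R *: w2.
  have := dW e (m + 1) w; rewrite addrK -/w2 om_e.
  rewrite (iterate_formula BW jW (-1) (K := 1)) => [|i i1|i i1]; first last.
  - exact: ga0.
  - by rewrite top //; lia.
  rewrite big_ord1 expr0 mul1r (gbinom_Negz R 0) mul1r addn0 bin0 scale1r.
  rewrite addr0 top ?Y0 ?sub0r; last by lia.
  rewrite subr0 addrK (_ : (-1) ^ (-1) = -1 :> C); last first.
    by rewrite exprN1 invrN1.
  rewrite scaleN1r opprK => e1.
  rewrite (gae 0%N) e1 add0r -/w2 -scalerDl; congr (_ *: _).
  by rewrite /c !rmorphB rmorphD /= -[(N%:Z)%:~R]/(N%:R); ring.
have gk (k : nat) : (0 < k)%N -> YW ga k%:Z w2 = 0.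
  by move=> k0; rewrite gae ga0 // Y0 add0r top ?scaler0 //; lia.
exists c.
(* The positive modes of gamma kill w2, so L(0) reduces to al gamma(0)^2 - be gamma(0). *)
have L0w2 : L0 w2 = (al%:C%C * c%:~R ^+ 2 - be%:C%C * c%:~R) *: w2.
  rewrite /Lmode add0r omE (linD ((BW _).2 _)) !(linZ ((BW _).2 _)).
  rewrite (iterate_formula BW jW (-1) (K := 1)) => [|i i1|i i1]; first last.
  - exact: gk.
  - have -> : 1 + i%:Z = (1 + i)%N%:Z by lia.
    exact: gk.
  rewrite (iterate_formula BW jW (-2) (K := 1)) => [|i i1|i i1]; first last.
  - exact: gk.
  - by rewrite iW.
  rewrite !big_ord1 !expr0 !mul1r (gbinom_Negz R 0) (gbinom_Negz R 1) !mul1r.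
  rewrite !addn0 !bin0 !scale1r !addr0 (gk 1%N) // iW Y0 Y0 !sub0r.

  rewrite (_ : (-1) ^ (-1) = -1 :> C); last by rewrite exprN1 invrN1.
  rewrite (_ : (-1) ^ (-2) = 1 :> C); last by rewrite -exprnN sqrrN expr1n invr1.
  rewrite scaleN1r opprK scale1r.
  rewrite subrr -[YW ga ord0 w2]/(YW ga 0 w2).
  rewrite iW eqxx !g0 (linZ ((BW _).1 _)) g0 !scalerN !scalerA -scalerBl.
  by congr (_ *: _); rewrite expr2 mulrA.
have w2n := mode_geneig tV BW jW dW m e_wt wn.
have w2c : geneig L0 (al%:C%C * c%:~R ^+ 2 - be%:C%C * c%:~R) w2.
  by exists 1%N; rewrite /= L0w2 subrr.
have L0L : linear L0 by exact: (BW _).1.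
(* The weight of the nonzero w2 is known in two ways. Both values must agree, and m = N - 1 - c
   turns the equation into a formula for n. *)
have [E|E] := eqVneq (n + (hg%:C%C - m%:~R - 1)) (al%:C%C * c%:~R ^+ 2 - be%:C%C * c%:~R).
  rewrite -[LHS](addrK (hg%:C%C - m%:~R - 1)) E.
  by rewrite /c !rmorphB /= -[(N%:Z)%:~R]/(N%:R); ring.
by move: nz; rewrite /w2 (geneig_disjoint L0L E w2n w2c : YW e m w = 0) eqxx.
Qed.

(** The bound is the minimum over real c of the quadratic polynomial for n, found by completing the
    square. *)
Lemma lowest_weight_real n w : geneig L0 n w -> w != 0 ->
  (forall k : nat, (0 < k)%N -> forall x, geneig L0 (n - k%:R) x -> x = 0) ->
  N%:R - hg - (be + 1) ^+ 2 / (4%:R * al) <= complex.Re n.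
Proof.
move=> h1 h2 h3; have [c nE] := lowest_weight_integral h1 h2 h3.
have -> : n = (al * c%:~R ^+ 2 - be * c%:~R - hg + N%:R - c%:~R)%:C%C.
  have hc : c%:~R = (c%:~R : R)%:C%C :> C by rewrite rmorph_int.
  have hN : N%:R = (N%:R : R)%:C%C :> C by rewrite rmorph_nat.
  rewrite nE hc hN !expr2; apply/eqP; rewrite eq_complex /=.
  by apply/andP; split; apply/eqP; ring.
rewrite /=; set x := c%:~R.
have h : 0 <= (2%:R * al * x - (be + 1)) ^+ 2 / (4%:R * al).
  by rewrite divr_ge0 ?sqr_ge0 // mulr_ge0 // ltW.
have e1 : (2%:R * al * x - (be + 1)) ^+ 2 / (4%:R * al) =
   al * x ^+ 2 - (be + 1) * x + (be + 1) ^+ 2 / (4%:R * al).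
  by field; rewrite lt0r_neq0.
rewrite e1 in h; lra.
Qed.

End LatticeBound.

(** An eigenvector of L(0) is a sum of integral weight vectors, so by independence there are none of
    nonintegral weight. *)
Lemma wt_grading (R : realType) (V : voaData R) : bilinear_modes (@vmode R V) ->
  is_grading (fun n : int => @wt R V n%:~R) -> is_grading (@wt R V).
Proof.
move=> BV g.
have sub n : subspace (@wt R V n).
  split=> [|a x y]; first by rewrite /wt /= (lin0 ((BV _).1 _)) scaler0.
  rewrite /wt /= => hx hy; rewrite (BV _).1 hx hy scalerDr !scalerA.
  by rewrite mulrC.
apply/(grading_reindex (h := fun n : int => n%:~R : R[i]) _ sub) => //.
  by move=> x y /intr_inj.
move=> n out; apply/seteqP; split=> v; last by move=> ->; case: (sub n).
rewrite /wt /= => vn; have [_ ex indep] := (gradingP _).1 g.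
have [F [c [hc vE]]] := ex v.
rewrite vE big1_seq // => k /andP[_ kF].
have : (k%:~R - n) *: c k = 0.
  apply: (indep F (fun k => (k%:~R - n) *: c k)) kF => [i|].
    by apply: subspaceZ; [exact: sub|exact: hc].
  under eq_bigr do rewrite scalerBl; rewrite sumrB -scaler_sumr -vE -vn.
  by rewrite [in vmode _ _ v]vE (lin_sum ((BV _).1 _)) -sumrB big1 // => i _; rewrite hc subrr.
move/eqP; rewrite scaler_eq0 subr_eq0 => /orP[/eqP e|/eqP //].
by case: (out k).
Qed.

(** * Twisting by a vector of square zero *)

Section AbstractTheorem.
Variables (R : realType) (V : voaData R) (u : V).
Local Notation C := R[i].
Local Notation om := (vomega V).
Hypothesis sq0 : forall i j n v v', vmode (vmode u i v) n (vmode u j v') = 0.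
Hypothesis u_wt : vmode om 1 u = u.
Hypothesis u_primary : forall n : nat, (2 <= n)%N -> vmode om n%:Z u = 0.
Variables (W : lmodType C) (YW : V -> int -> W -> W) (Wg : C -> C -> set W).
Hypothesis MW : strongly_graded_module (geneig (vmode u 0)) YW Wg.
Hypothesis Wu : graded_by_geneig Wg (YW u 0).
Variables (ga e f : V) (al be hg : R) (N : nat).
Hypothesis al_gt0 : 0 < al.
Hypothesis ga_e : forall n : nat, vmode ga n%:Z e = if n == 0%N then N%:R *: e else 0.
Hypothesis om_e : vmode om 0 e = vmode ga (-1) e.
Hypothesis f_e : exists M : int, vmode f M e = vvac V.
Hypothesis omE :
  om = al%:C%C *: vmode ga (-1) ga + be%:C%C *: vmode ga (-2) (vvac V).
Hypothesis ga_wt : wt 1 ga.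
Hypothesis e_wt : wt hg%:C%C e.

Let VV : vertex_operator_algebra V. Proof. by case: MW => -[]. Qed.
Let BV : bilinear_modes (@vmode R V). Proof. by case: VV => -[]. Qed.
Let tV : truncated (@vmode R V). Proof. by case: VV => -[]. Qed.
Let cV v : vmode v (-1) (vvac V) = v. Proof. by case: VV => _ /(_ v)[]. Qed.
Let BW : bilinear_modes YW. Proof. by case: MW => _ []. Qed.
Let tW : truncated YW. Proof. by case: MW => _ []. Qed.
Let iW : identity_property YW. Proof. by case: MW => _ []. Qed.
Let jW : jacobi YW. Proof. by case: MW => _ []. Qed.
Let dW : L1_derivative YW. Proof. by case: MW => _ []. Qed.
Let gW2 : is_grading (fun na : C * C => Wg na.1 na.2). Proof. by case: MW => _ _ []. Qed.
Let ssW n : ssum (Wg n) = geneig (Lmode YW 0) n. Proof. by case: MW => _ _ [_ h]. Qed.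
Let modeW a b v w n : geneig (vmode u 0) a v -> ssum (fun m => Wg m b) w ->
  ssum (fun m => Wg m (a + b)) (YW v n w).
Proof. by case: MW => _ _ _ h _; exact: h. Qed.
Let finW n a : findim (Wg n a). Proof. by case: MW => _ _ _ _ /(_ n a)[]. Qed.
Let bndW n a : exists K : int, forall l : int, l < K -> Wg (n + l%:~R) a = [set 0].
Proof. by case: MW => _ _ _ _ /(_ n a)[]. Qed.
Let subW n a : subspace (Wg n a). Proof. exact: (gW2.1 (n, a)). Qed.

Let u0L : linear (YW u 0). Proof. exact: (BW 0).1. Qed.
Let gu a : geneig (vmode u 0) a = if a == 0 then setT else [set 0].
Proof. exact: (geneig_lnilp (umode_linear u VV 0) (u0_lnilp VV sq0)). Qed.

(* In a lowest weight vector u_j w = 0 for j >= 1, hence u_0 u_0 w is the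
   coefficient (u_(-1) u)_1 w, which is 0. *)
Lemma charge_trivial n a : a != 0 -> Wg n a = [set 0].
Proof.
move=> a0; apply/seteqP; split=> w; last by move=> ->; case: (subW n a).
move=> ww; apply/eqP; apply: contraT => w0.
have [j [x [xx x0 low]]] := lowest_weight (S := fun n => Wg n a) ww w0 (bndW n a).
have low1 (k : nat) : (0 < k)%N -> YW u k%:Z x = 0.
  move=> k0; apply: (low k k0); apply: (ssumI gW2).
    rewrite ssW.
    have xg : geneig (Lmode YW 0) (n - j%:R) x.
      by rewrite -ssW; exact: (ssum_le (S := Wg (n - j%:R)) (subW _) xx).
    have := mode_geneig tV BW jW dW k%:Z (u_wt1 u_wt) xg; congr geneig.
    by rewrite -[(k%:Z)%:~R]/(k%:R); ring.
  have u0 : geneig (vmode u 0) 0 u by rewrite gu eqxx.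
  have := modeW k%:Z u0 (ssum_le (S := fun m => Wg m a) (fun m => subW m a) xx).
  by rewrite add0r.
have uux : YW u 0 (YW u 0 x) = 0.
  have uu : vmode u (-1) u = 0 by rewrite -{2}[u]cV (umode_mode VV sq0).
  have := iterate_formula BW jW (-1) (n := 1) (w := x) (a := u) (b := u) (K := 1).
  rewrite uu (lin0 ((BW _).2 _)) big_ord1 expr0 mul1r (gbinom_Negz R 0) mul1r.
  rewrite addn0 bin0 scale1r addr0 (low1 1%N) // (lin0 ((BW _).1 _)) sub0r.
  rewrite (_ : (-1) ^ (-1) = -1 :> C); last by rewrite exprN1 invrN1.
  rewrite scaleN1r opprK => h; apply/esym/h => i i1; last exact: low1.
  have -> : 1 + i%:Z = (1 + i)%N%:Z by lia.
  exact: low1.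
(* The nonzero x would have both charge a and charge 0. *)
have gx : geneig (YW u 0) a x.
  by rewrite -Wu; exact: (ssum_le (S := fun m => Wg m a) (fun m => subW m a) xx).
have g0 : geneig (YW u 0) 0 x by exists 2%N; rewrite /= !scale0r !subr0.
by move: x0; rewrite (geneig_disjoint u0L a0 gx g0) eqxx.
Qed.

Let Wg0 n : Wg n 0 = geneig (Lmode YW 0) n.
Proof.
by rewrite -ssW (ssumE (S := Wg n) (i0 := 0)) // => a; exact: charge_trivial.
Qed.

Lemma u0W_lnilp : locally_nilpotent (YW u 0).
Proof.
suff h w : geneig (YW u 0) 0 w.
  move=> w; have [K hK] := h w; exists K; rewrite -[RHS]hK; apply: eq_iter => x.
  by rewrite scale0r subr0.
move: w; apply: (grading_add_ind gW2 (0, 0)) => [x y|[n a] x /= xx].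
  exact: subspaceD (geneig_subspace 0 u0L).
have [a0|a0] := eqVneq a 0.
  by rewrite -Wu -a0; exact: (ssum_le (S := fun m => Wg m a) (fun m => subW m a) xx).
by move: xx; rewrite charge_trivial // => ->; case: (geneig_subspace 0 u0L).
Qed.

Lemma jointgradingE : jointgrading u YW = Wg.
Proof.
apply/funext => n; apply/funext => a; rewrite /jointgrading.
rewrite (geneig_lnilp u0L u0W_lnilp); case: eqP => [->|/eqP a0]; last first.
  rewrite charge_trivial //; apply/seteqP; split=> [x []//|x ->]; split=> //.
  suff tL : linear (twistL u YW 0) by case: (geneig_subspace n tL).
  exact: twistY_linear_w.
rewrite setIT Wg0.
have -> : twistL u YW 0 = fun x => Lmode YW 0 x + YW u 0 x.
  by apply/funext => x; exact: (twistLE VV sq0 u_wt BW u_primary).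
have L0L : linear (Lmode YW 0) by exact: (BW _).1.
have comm x : Lmode YW 0 (YW u 0 x) = YW u 0 (Lmode YW 0 x).
  have := omega_umode u_wt u_primary BW jW dW 1 0 x.
  by rewrite oppr0 scale0r /Lmode add0r => /eqP; rewrite subr_eq0 => /eqP.
apply/seteqP; split=> x; last exact: (geneig_add L0L u0L u0W_lnilp comm).
(* For the other inclusion the commuting, locally nilpotent operator -u_0 is added to L(0) + u_0. *)
have SL : linear (fun x => Lmode YW 0 x + YW u 0 x).
  by move=> c y z; rewrite L0L u0L scalerDr addrACA.
have NL : linear (fun x => - YW u 0 x).
  by move=> c y z; rewrite u0L opprD scalerN.
have Nn : locally_nilpotent (fun x => - YW u 0 x).
  move=> y; have [K hK] := u0W_lnilp y; exists K.
  have -> : iter K (fun x => - YW u 0 x) y = (-1) ^+ K *: iter K (YW u 0) y.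
    elim: K {hK} => [|K /= ->]; first by rewrite scale1r.
    by rewrite (linZ u0L) exprS mulN1r scaleNr.
  by rewrite hK scaler0.
have comm2 y : Lmode YW 0 (- YW u 0 y) + YW u 0 (- YW u 0 y) =
    - YW u 0 (Lmode YW 0 y + YW u 0 y).
  by rewrite (linN L0L) (linN u0L) (linD u0L) comm opprD.
move=> /(geneig_add SL NL Nn comm2); congr (geneig _ n x).
by apply/funext => y; rewrite addrK.
Qed.

(** Integral steps lead from any weight down to a lowest one, whose real part is at least a constant
    that does not depend on the coset of the integers. *)
Lemma twisted_bound n a : exists M : R, forall l : R, l < M -> Wg (n + l%:C%C) a = [set 0].
Proof.
have [a0|a0] := eqVneq a 0; last by exists 0 => l _; exact: charge_trivial.
exists (N%:R - hg - (be + 1) ^+ 2 / (4%:R * al) - complex.Re n) => l lM.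
rewrite a0; apply/seteqP; split=> w; last by move=> ->; case: (subW (n + l%:C%C) 0).
move=> ww; apply/eqP; apply: contraT => w0.
have [j [x [xx x0 low]]] := lowest_weight (S := fun n => Wg n 0) ww w0 (bndW _ 0).
rewrite Wg0 in xx.
have low' (k : nat) : (0 < k)%N -> forall y,
    geneig (Lmode YW 0) (n + l%:C%C - j%:R - k%:R) y -> y = 0.
  by move=> k0 y; rewrite -Wg0; exact: low.
have := lowest_weight_real tV BW tW iW jW dW al_gt0 ga_e om_e f_e omE ga_wt e_wt xx x0 low'.
have hj : j%:R = (j%:R : R)%:C%C :> C by rewrite rmorph_nat.
rewrite hj; case: (n) lM => n1 n2 /= lM; have := ler0n R j; lra.
Qed.

Theorem twisted_module_of_square_zero :
  twisted_module (geneig (vmode u 0)) (exp2pii (vmode u 0))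
    (jointgrading u YW) (twistY u YW) (exp2pii (YW u 0)).
Proof.
have W1E : W1 Wg = geneig (Lmode YW 0) by apply/funext => n; exact: ssW.
have gW : is_grading (W1 Wg).
  (* The grading by weights alone is the joint grading restricted to charge 0. *)
  rewrite (_ : W1 Wg = fun n => Wg n 0); last first.
    by apply/funext => n; rewrite Wg0 -ssW.
  apply/(grading_reindex (h := fun n : C => (n, 0 : C))
    (S := fun na : C * C => Wg na.1 na.2)) => //.
  - by move=> x y [].
  - by move=> [n a] ne /=; apply: charge_trivial; apply/eqP => a0; apply: (ne n); rewrite a0.
have gV : is_grading (@wt R V) by apply: wt_grading BV _; case: VV.
have SV : strongly_graded_voa (geneig (vmode u 0)) by case: MW.
rewrite jointgradingE; split.
- split=> //; first exact: monodromy_automorphism.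
  exact: monodromy_compatible.
- split=> //.
  + exact: (twistY_map VV sq0 u_wt BW jW dW W1E gW).
  + exact: exp2pii_linear u0W_lnilp.
  exact: exp2pii_bijective u0W_lnilp.
- by move=> n a; split; [exact: finW|exact: twisted_bound].
- split.
  + exact: (twistY_equivariance VV sq0 u_wt BW jW dW W1E gW gV).
  + exact: twistY_vac.
  exact: (twistY_duality VV sq0 u_wt BW jW dW W1E gW gV tW).
split.
- exact: twistY_omega_modes.
(* The exponent is required to be positive, hence K + 1. *)
- move=> n a w; rewrite -{1}jointgradingE => -[[K hK] _]; exists K.+1 => //.
  have tL : linear (twistL u YW 0) by exact: twistY_linear_w.
  have e2 x : twistL u YW 0 x = twistY u YW om (- 2%:R) 0 x.
    by rewrite /twistL mulr0z oppr0 sub0r.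
  rewrite (eq_iter (f' := fun x => twistL u YW 0 x - n *: x)) => [|x]; last by rewrite e2.
  by rewrite iterS hK (lin0 tL) scaler0 subrr.
- move=> a b s k v w va wb.
  have W2E c : W2 Wg c = if c == 0 then setT else [set 0].
    by rewrite /W2 Wu (geneig_lnilp u0L u0W_lnilp).
  move: va wb; rewrite gu !W2E; case: (a =P 0) => [->|/eqP a0] => [_|->]; last first.
    move=> _; rewrite (lin0 (twistY_linear_v VV sq0 BW _ _ _)).
    by case: eqP.
  rewrite add0r; case: eqP => // _ ->.
  by rewrite (lin0 (twistY_linear_w VV sq0 BW _ _ _)).
by move=> s k v w; exact: twistY_L1.
Qed.

End AbstractTheorem.

(** * The lattice vertex operators *)

Lemma lin_scale (K : comPzRingType) (U U' : lmodType K) (f : U -> U') c :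
  linear f -> linear (fun w => c *: f w).
Proof. by move=> fL a x y; rewrite fL scalerDr !scalerA mulrC. Qed.

Lemma fsum_set_at (I : choiceType) (V : nmodType) (A : set I) (F : I -> V) i0 :
  (forall i, A i -> i != i0 -> F i = 0) ->
  \sum_(i \in A) F i = if i0 \in A then F i0 else 0.
Proof.
move=> h; rewrite fsbig_mkcond (fsum_at (i0 := i0)) /patch // => i ne.
by case: ifP => //; rewrite inE => Ai; exact: h.
Qed.

Lemma fsum_congr (I : choiceType) (V : nmodType) (F G : I -> V) : F =1 G ->
  \sum_(j \in [set: I]) F j = \sum_(j \in [set: I]) G j.
Proof. by move=> h; apply: eq_fsbigr => j _; exact: h. Qed.

Lemma expcoef_vanishing (R : realType) (W : lmodType R[i]) (A : nat -> W -> W) n w :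
  (forall m, linear (A m)) ->
  (forall m, (0 < m)%N -> A m w = 0) -> expcoef A n w = if n == 0%N then w else 0.
Proof.
move=> AL A0.
have pc k m : powcoef A k m w = if (k == 0%N) && (m == 0%N) then w else 0.
  elim: k m => [|k IH] m /=; first by [].
  rewrite big_nat_cond big1 // => i /andP[/andP[i0 _] _]; rewrite IH.
  by case: ifP => _; [exact: A0|exact: (lin0 (AL i))].
rewrite /expcoef big_ord_recl big1 ?addr0 => [|i _]; last by rewrite pc scaler0.
by rewrite fact0 invr1 scale1r.
Qed.

Lemma lin2 (K : pzRingType) (U U' : lmodType K) (f : U -> U') a b x y : linear f ->
  f (a *: x + b *: y) = a *: f x + b *: f y.
Proof. by move=> fL; rewrite fL (linZ fL). Qed.

Section LatticeModes.
Variables (R : realType) (p q : nat).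
Local Notation C := R[i].
Local Notation VLt := (VLt R).
Local Notation D := (2 * p * q)%N.
Local Notation heis := (@heis R p q).
Local Notation Yexp := (@Yexp R p q).
Local Notation Ymono := (@Ymono R p q).
Local Notation YVLt := (@YVLt R p q).
Local Notation Yc := (@Yc R p q).
Local Notation to_coset := (@to_coset R p q).
Local Notation in_coset := (@in_coset R p q).
Local Notation omegaL := (omegaL R p q).
Local Notation vacL := (vacL R p q).
Local Notation al := ((4 * p * q)%N%:R^-1 : C).
Local Notation be := ((p%:R - q%:R) / D%:R : C).
Implicit Type w : VLt.

Lemma linext_basis (f : fockidx -> VLt) K : linext f (basisv R K) = f K.
Proof.
rewrite /linext /basisv msuppU oner_eq0 big_seq_fset1 mcoeffUU scale1r //.
Qed.

Lemma linext_fset (f : fockidx -> VLt) w (X : {fset fockidx}) : (msupp w `<=` X)%fset ->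
  linext f w = \sum_(K <- X) mcoeff K w *: f K.
Proof.
move=> h; apply: big_fset_incl h _ => K _ /mcoeff_outdom ->.
by rewrite scale0r.
Qed.

Lemma linext_linear (f : fockidx -> VLt) : linear (linext f).
Proof.
move=> a x y; pose X := (msupp (a *: x + y) `|` (msupp x `|` msupp y))%fset.
rewrite !(@linext_fset _ _ X) ?scaler_sumr -?big_split /=.
- by apply: eq_bigr => K _; rewrite mcoeffD mcoeffZ scalerDl scalerA.
- by rewrite /X fsubsetU // fsubsetU ?orbT // fsubset_refl orbT.
- by rewrite /X fsubsetU // fsubsetU ?orbT // fsubset_refl.
by rewrite /X fsubsetUl.
Qed.

Lemma linext_id w : linext (basisv R) w = w.
Proof.
rewrite {2}[w]monalgE /linext; apply: eq_bigr => K _.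
by apply/malgP => k; rewrite mcoeffZ !mcoeffU mulrnAr mulr1.
Qed.

Lemma heis_linear n : linear (heis n).
Proof. exact: linext_linear. Qed.

Lemma heis0_basis m k : heis 0 (basisv R (m, k)) = k%:~R *: basisv R (m, k).
Proof. exact: linext_basis. Qed.

Lemma heisS_basis (j : nat) (m : multiset nat) k : heis j.+1%:Z (basisv R (m, k)) =
  (D * j.+1 * m j)%N%:R *: basisv R (m `\ j, k)%mset.
Proof. exact: linext_basis. Qed.

Lemma heisN_basis i m k : heis (Negz i) (basisv R (m, k)) = basisv R (i +` m, k)%mset.
Proof. exact: linext_basis. Qed.

Lemma heisS_vacuum (j : nat) k : heis j.+1%:Z (basisv R (mset0, k)) = 0.
Proof. by rewrite heisS_basis mset0E muln0 scale0r. Qed.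

Lemma heisl_linear c l n : linear (fun w => c *: heisl p q l n w).
Proof.
exact: (lin_scale _ (lin_scale _ (heis_linear n))).
Qed.

Lemma Eminus0 n w : Eminus p q 0 n w = if n == 0%N then w else 0.
Proof.
apply: expcoef_vanishing => [m|m _]; first exact: heisl_linear.
by rewrite /heisl mul0r scale0r scaler0.
Qed.

Lemma Eplus0 n w : Eplus p q 0 n w = if n == 0%N then w else 0.
Proof.
apply: expcoef_vanishing => [m|m _]; first exact: heisl_linear.
by rewrite /heisl mul0r scale0r scaler0.
Qed.

Lemma Eplus_vacuum l n k : Eplus p q l n (basisv R (mset0, k)) =
  if n == 0%N then basisv R (mset0, k) else 0.
Proof.
apply: expcoef_vanishing => [m|m m0]; first exact: heisl_linear.
by case: m m0 => // m _; rewrite /heisl heisS_vacuum !scaler0.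
Qed.

Lemma Eminus_0 l w : Eminus p q l 0 w = w.
Proof. by rewrite /Eminus /expcoef big_ord1 /= fact0 invr1 scale1r. Qed.

Lemma Yexp0 s w : Yexp 0 s w = if s == 0 then w else 0.
Proof.
rewrite -[in RHS](linext_id w).
have -> : Yexp 0 s w = linext (fun K => if s == 0 then basisv R K else 0) w.
  congr (linext _ w); apply/funext => K.
  rewrite (fsum_set_at (i0 := (0, 0)%N)) => [|[a b] _ ne]; last first.
    have z : shift 0 0 = 0 :> VLt by exact: lin0 (linext_linear _).
    rewrite Eplus0 Eminus0; have [b0|_] := eqVneq b 0%N; last by rewrite z if_same.
    by have [a0|//] := eqVneq a 0%N; move: ne; rewrite a0 b0 eqxx.
  rewrite Eplus0 Eminus0 /shift linext_basis addr0.
  have e : (0 * K.2)%:~R / D%:R + 0%:R - 0%:R = 0 :> rat by rewrite !mul0r !addr0.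
  have -> : ((0, 0)%N \in [set ab : nat * nat |
      (0 * K.2)%:~R / D%:R + ab.1%:R - ab.2%:R = s]) = (s == 0).
    by apply/idP/eqP => [/set_mem /= <-|->] //; apply/mem_set.
  by case: K {e}.
by case: ifP => // _; rewrite /linext big1 // => K _; rewrite scaler0.
Qed.

Lemma YVLt_linext v s w :
  YVLt v s w = linext (fun K => Ymono K.2 (enum_mset K.1) s w) v.
Proof. by []. Qed.

Lemma YVLt_basis K s w : YVLt (basisv R K) s w = Ymono K.2 (enum_mset K.1) s w.
Proof. by rewrite YVLt_linext linext_basis. Qed.

Lemma YVLt_linear s w : linear (fun v => YVLt v s w).
Proof. exact: linext_linear. Qed.

Lemma in_coset_basis k m l : (l = k %[mod D])%Z -> basisv R (m, l) \in in_coset k.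
Proof.
move=> e; rewrite inE; apply/allP => K'.
by rewrite /basisv msuppU oner_eq0 => /fset1P ->; apply/eqP.
Qed.

(* keeps the unifier from unfolding the sums over supports *)
#[local] Opaque linext.

Lemma Ymono_cons l i ms s w : Ymono l (i :: ms) s w =
  \sum_(j \in [set: nat]) 'C(i + j, i)%:R *: heis (- (i + j).+1%:Z) (Ymono l ms (s - j%:R) w)
  + \sum_(j \in [set: nat]) ((-1) ^+ i * 'C(i + j, i)%:R) *:
      Ymono l ms (s + (i + j).+1%:R) (heis j%:Z w).
Proof. by []. Qed.

Lemma Ymono_nil l s w : Ymono l [::] s w = Yexp l s w.
Proof. by []. Qed.

(** Since Y(1, x) = 1, a single index j survives: in the first sum, the creation part of gamma(x),
    for n < 0, and in the second for n >= 0. *)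
Lemma Ymono_gamma (n : int) w : Ymono 0 [:: 0%N] (- n%:~R - 1) w = heis n w.
Proof.
have H0 m : heis m 0 = 0 by exact: lin0 (heis_linear m).
have e1 (j : nat) : (- n%:~R - 1 - j%:R == 0 :> rat) = (n == Negz j).
  by rewrite -!opprD oppr_eq0 -addrA addr_eq0 NegzE -(eqr_int rat) rmorphN /=
    -[(j.+1%:Z)%:~R]/(j.+1%:R) -nat1r.
have e2 (j : nat) : (- n%:~R - 1 + j.+1%:R == 0 :> rat) = (n == j%:Z).
  by rewrite -natr1 addrACA addNr addr0 addrC subr_eq0 eq_sym -(eqr_int rat).
have t1 (j : nat) : 'C(0 + j, 0)%:R *:
    heis (- (0 + j).+1%:Z) (Ymono 0 [::] (- n%:~R - 1 - j%:R) w) =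
    if n == Negz j then heis n w else 0.
  rewrite Ymono_nil Yexp0 e1 bin0 scale1r add0n.
  by case: eqP => [->|_]; rewrite ?NegzE.
have t2 (j : nat) : ((-1) ^+ 0 * 'C(0 + j, 0)%:R) *:
    Ymono 0 [::] (- n%:~R - 1 + (0 + j).+1%:R) (heis j%:Z w) =
    if n == j%:Z then heis n w else 0.
  rewrite Ymono_nil Yexp0 add0n e2 expr0 bin0 mul1r scale1r.
  by case: eqP => [->|_].
apply: etrans (Ymono_cons _ _ _ _ _) _.
apply: etrans (f_equal2 +%R (fsum_congr t1) (fsum_congr t2)) _.
move: (heis n w) => x; case: n {e1 e2 t1 t2} => n.
  rewrite fsum_0 ?add0r // (fsum_at (i0 := n)) ?eqxx // => j /negPf ne.
  by rewrite eqz_nat eq_sym ne.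
rewrite [X in _ + X]fsum_0 ?addr0 // (fsum_at (i0 := n)) ?eqxx // => j /negPf ne.
by rewrite (_ : (Negz n == Negz j) = (j == n)) ?ne //; apply/eqP/eqP; lia.
Qed.

Lemma Ymono_gamma2 (n : int) w : Ymono 0 [:: 0%N; 0%N] (- n%:~R - 1) w =
  \sum_(j \in [set: nat]) heis (Negz j) (heis (n + j%:Z) w)
  + \sum_(j \in [set: nat]) heis (n - j%:Z - 1) (heis j%:Z w).
Proof.
have t1 (j : nat) : 'C(0 + j, 0)%:R *:
    heis (- (0 + j).+1%:Z) (Ymono 0 [:: 0%N] (- n%:~R - 1 - j%:R) w) =
    heis (Negz j) (heis (n + j%:Z) w).
  rewrite bin0 scale1r add0n NegzE (_ : _ - j%:R = - (n + j%:Z)%:~R - 1) ?Ymono_gamma //.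
  by rewrite rmorphD /= -[(j%:Z)%:~R]/(j%:R); ring.
have t2 (j : nat) : ((-1) ^+ 0 * 'C(0 + j, 0)%:R) *:
    Ymono 0 [:: 0%N] (- n%:~R - 1 + (0 + j).+1%:R) (heis j%:Z w) =
    heis (n - j%:Z - 1) (heis j%:Z w).
  rewrite expr0 bin0 mul1r scale1r add0n.
  rewrite (_ : _ + j.+1%:R = - (n - j%:Z - 1)%:~R - 1) ?Ymono_gamma //.
  by rewrite !rmorphB /= -[(j%:Z)%:~R]/(j%:R) -natr1; ring.
apply: etrans (Ymono_cons _ _ _ _ _) _.
exact: (f_equal2 +%R (fsum_congr t1) (fsum_congr t2)).
Qed.

(** As n is natural, the power of x is negative and the creation part of the derivative of gamma(x)
    does not reach it. *)
Lemma Ymono_gamma' (n : nat) w : Ymono 0 [:: 1%N] (- n%:R - 1) w =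
  (- n%:R) *: heis (n%:Z - 1) w.
Proof.
have H0 m : heis m 0 = 0 by exact: lin0 (heis_linear m).
have t1 (j : nat) : 'C(1 + j, 1)%:R *:
    heis (- (1 + j).+1%:Z) (Ymono 0 [::] (- n%:R - 1 - j%:R) w) = 0.
  rewrite Ymono_nil Yexp0 ifF ?H0 ?scaler0 //; apply/negP => /eqP h.
  have h1 := ler0n rat n; have h2 := ler0n rat j; lra.
have t2 (j : nat) : ((-1) ^+ 1 * 'C(1 + j, 1)%:R) *:
    Ymono 0 [::] (- n%:R - 1 + (1 + j).+1%:R) (heis j%:Z w) =
    if n == j.+1 then (- n%:R) *: heis (n%:Z - 1) w else 0.
  have e2 : (- n%:R - 1 + (1 + j).+1%:R == 0 :> rat) = (n == j.+1).
    rewrite -(eqr_nat rat) add1n -!natr1; apply/eqP/eqP => h; lra.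
  rewrite Ymono_nil Yexp0 e2; case: eqP => [->|_]; last by rewrite scaler0.
  rewrite expr1 mulN1r bin1 add1n; congr (_ *: heis _ w); lia.
apply: etrans (Ymono_cons _ _ _ _ _) _.
apply: etrans (f_equal2 +%R (fsum_congr t1) (fsum_congr t2)) _.
move: (heis (n%:Z - 1) w) => x; rewrite fsum_0 // add0r; case: n {t1 t2} => [|n].
  by rewrite fsum_0 ?oppr0 ?scale0r // => j; rewrite oppr0 scale0r if_same.
by rewrite (fsum_at (i0 := n)) ?eqxx // => j /negPf ne; rewrite eqSS eq_sym ne.
Qed.

Lemma mset1_msetn n (i : nat) : (i +` msetn n i)%mset = msetn n.+1 i.
Proof. by apply/msetP => j; rewrite mset1DE !msetnE; case: (j == i). Qed.

(** * Action of gamma and omega on the exponentials and on gamma *)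

Definition ebasis (k : int) : VLt := basisv R (mset0, k).
Definition gammav : VLt := basisv R (msetn 1 0%N, 0).

Lemma heis0_ebasis k : heis 0 (ebasis k) = k%:~R *: ebasis k.
Proof. exact: heis0_basis. Qed.

Lemma heis_ebasis (n : nat) k : heis n%:Z (ebasis k) =
  if n == 0%N then k%:~R *: ebasis k else 0.
Proof. by case: n => [|n]; [exact: heis0_ebasis|exact: heisS_vacuum]. Qed.

Lemma heis_gammav (n : nat) : heis n%:Z gammav = if n == 1%N then D%:R *: ebasis 0 else 0.
Proof.
case: n => [|[|n]].
- apply: etrans (heis0_basis _ _) _; rewrite mulr0z scale0r //.
- apply: etrans (heisS_basis 0 _ _) _.
  have -> : (msetn 1 0%N `\ 0%N)%mset = mset0 :> multiset nat.
    by apply/msetP => j; rewrite msetB1E msetnE mset0E; case: (j == _).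
  have -> : (D * 1 * (msetn 1 0%N : multiset nat) 0)%N = D by rewrite msetnE eqxx !muln1.
  by [].
apply: etrans (heisS_basis n.+1 _ _) _.
have -> : (msetn 1 0%N : multiset nat) n.+1 = 0%N by rewrite msetnE.
by rewrite muln0 scale0r.
Qed.

Lemma heisN1_ebasis0 : heis (-1) (ebasis 0) = gammav.
Proof.
apply: etrans (heisN_basis 0 _ _) _.
by congr (basisv _ (_, _)); rewrite -(msetn0 0%N) mset1_msetn.
Qed.

Lemma YVLt_gammav (n : int) w : YVLt gammav (- n%:~R - 1) w = heis n w.
Proof. by rewrite YVLt_basis enum_msetn; exact: Ymono_gamma. Qed.

Definition omegav : VLt := (4 * p * q)%N%:R^-1 *: heis (-1) (heis (-1) (ebasis 0))
  + ((p%:R - q%:R) / D%:R) *: heis (-2) (ebasis 0).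

Lemma YVLt_omegav (n : nat) w : YVLt omegav (- n%:R - 1) w =
  (4 * p * q)%N%:R^-1 *: (\sum_(j \in [set: nat]) heis (Negz j) (heis (n%:Z + j%:Z) w)
    + \sum_(j \in [set: nat]) heis (n%:Z - j%:Z - 1) (heis j%:Z w))
  + ((p%:R - q%:R) / D%:R) *: ((- n%:R) *: heis (n%:Z - 1) w).
Proof.
rewrite /omegav heisN1_ebasis0.
rewrite (heisN_basis 0 _ _ : heis (-1) _ = _) (heisN_basis 1 _ _ : heis (-2) _ = _).
apply: etrans (lin2 _ _ _ _ (YVLt_linear (- n%:R - 1) w)) _.
apply: (f_equal2 (fun x y => (4 * p * q)%N%:R^-1 *: x + ((p%:R - q%:R) / D%:R) *: y)).
  apply: etrans (YVLt_basis _ _ _) _.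
  rewrite mset1_msetn enum_msetn; exact: (Ymono_gamma2 n%:Z w).
apply: etrans (YVLt_basis _ _ _) _.
rewrite -(msetn0 1%N) mset1_msetn enum_msetn; exact: (Ymono_gamma' n w).
Qed.

Lemma heis_0 n : heis n 0 = 0 :> VLt.
Proof. exact: lin0 (heis_linear n). Qed.

Lemma heis_scale n a (w : VLt) : heis n (a *: w) = a *: heis n w.
Proof. exact: (linZ (heis_linear n) a w). Qed.

Lemma sum_heis_ebasisl (n : nat) k :
  \sum_(j \in [set: nat]) heis (Negz j) (heis (n%:Z + j%:Z) (ebasis k)) =
  if n == 0%N then k%:~R *: heis (-1) (ebasis k) else 0.
Proof.
have t j : heis (Negz j) (heis (n%:Z + j%:Z) (ebasis k)) =
    if (n + j == 0)%N then k%:~R *: heis (-1) (ebasis k) else 0.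
  rewrite -PoszD heis_ebasis; case: (eqVneq (n + j)%N 0%N) => [e|_]; last exact: heis_0.
  have -> : j = 0%N by lia.
  exact: heis_scale.
apply: etrans (fsum_congr t) _; move: (_ *: _) => x.
case: n {t} => [|n]; last by rewrite fsum_0.
by rewrite (fsum_at (i0 := 0%N)) // => j /negPf ->.
Qed.

Lemma sum_heis_ebasisr (n : nat) k :
  \sum_(j \in [set: nat]) heis (n%:Z - j%:Z - 1) (heis j%:Z (ebasis k)) =
  k%:~R *: heis (n%:Z - 1) (ebasis k).
Proof.
have t j : heis (n%:Z - j%:Z - 1) (heis j%:Z (ebasis k)) =
    if (j == 0)%N then k%:~R *: heis (n%:Z - 1) (ebasis k) else 0.
  rewrite heis_ebasis; case: (eqVneq j 0%N) => [->|_]; last exact: heis_0.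
  rewrite subr0; exact: heis_scale.
apply: etrans (fsum_congr t) _; move: (_ *: _) => x.
by rewrite (fsum_at (i0 := 0%N)) // => j /negPf ->.
Qed.

Lemma omegav_ebasis (n : nat) k : YVLt omegav (- n%:R - 1) (ebasis k) =
  al *: ((if n == 0%N then k%:~R *: heis (-1) (ebasis k) else 0)
    + k%:~R *: heis (n%:Z - 1) (ebasis k))
  + be *: ((- n%:R) *: heis (n%:Z - 1) (ebasis k)).
Proof.
apply: etrans (YVLt_omegav _ _) _.
exact: (f_equal2 (fun x y => al *: (x + y) + _) (sum_heis_ebasisl n k) (sum_heis_ebasisr n k)).
Qed.

Lemma omegav0_ebasis k : YVLt omegav (-1) (ebasis k) =
  (2%:R * k%:~R * al) *: heis (-1) (ebasis k).
Proof.
have := omegav_ebasis 0 k; rewrite oppr0 !sub0r => ->.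
rewrite eqxx oppr0; move: (heis _ _) => x; rewrite scale0r scaler0 addr0 -scalerDl scalerA.
by congr (_ *: _); ring.
Qed.

Lemma omegav1_ebasis k : YVLt omegav (- 2%:R) (ebasis k) =
  (al * k%:~R ^+ 2 - be * k%:~R) *: ebasis k.
Proof.
have := omegav_ebasis 1 k; rewrite subrr -opprD heis0_ebasis => ->.
move: (ebasis k) => x; rewrite add0r !scalerA -scalerDl.
by congr (_ *: _); ring.
Qed.

Lemma omegavS_ebasis (n : nat) k : YVLt omegav (- n.+2%:R - 1) (ebasis k) = 0.
Proof.
rewrite omegav_ebasis.
have -> : n.+2%:Z - 1 = n.+1%:Z by lia.
by rewrite heis_ebasis !scaler0 !addr0 scaler0.
Qed.

Hypotheses (p_gt0 : (0 < p)%N) (q_gt0 : (0 < q)%N).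

(** In each of the two sums only gamma(1) acts nontrivially and gives 2pq gamma; the coefficient 1 /
    (4pq) of omega normalises the total. *)
Lemma omegav_gammav : YVLt omegav (- 2%:R) gammav = gammav.
Proof.
have t1 j : heis (Negz j) (heis (1%:Z + j%:Z) gammav) = if j == 0%N then D%:R *: gammav else 0.
  have -> : 1%:Z + j%:Z = j.+1%:Z by lia.
  rewrite heis_gammav eqSS.
  case: eqP => [->|_]; last exact: heis_0.
  apply: etrans (heis_scale _ _ _) _; apply: (f_equal (fun x => D%:R *: x)).
  exact: heisN1_ebasis0.
have t2 j : heis (1%:Z - j%:Z - 1) (heis j%:Z gammav) = if j == 1%N then D%:R *: gammav else 0.
  rewrite heis_gammav; case: eqP => [->|_]; last exact: heis_0.
  apply: etrans (heis_scale _ _ _) _; apply: (f_equal (fun x => D%:R *: x)).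
  exact: heisN1_ebasis0.
have e3 : heis (1%:Z - 1) gammav = 0 by rewrite subrr; exact: (heis_gammav 0).
have := YVLt_omegav 1 gammav; rewrite e3 scaler0 scaler0 addr0 -opprD => ->.
have s1 : \sum_(j \in [set: nat]) heis (Negz j) (heis (1%:Z + j%:Z) gammav) = D%:R *: gammav.
  apply: etrans (fsum_congr t1) _; move: (_ *: _) => x.
  by rewrite (fsum_at (i0 := 0%N)) // => j /negPf ->.
have s2 : \sum_(j \in [set: nat]) heis (1%:Z - j%:Z - 1) (heis j%:Z gammav) = D%:R *: gammav.
  apply: etrans (fsum_congr t2) _; move: (_ *: _) => x.
  by rewrite (fsum_at (i0 := 1%N)) // => j /negPf ->.
apply: etrans (f_equal2 (fun x y => al *: (x + y)) s1 s2) _.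
move: gammav => x; rewrite -scalerDl scalerA -natrD -[RHS]scale1r; congr (_ *: _).
rewrite (_ : D + D = 4 * p * q)%N; last by ring.
by rewrite mulVf // pnatr_eq0; lia.
Qed.

Lemma omegavE : omegav = al *: heis (-1) gammav + be *: heis (-2) (ebasis 0).
Proof.
exact: (f_equal (fun x => al *: heis (-1) x + be *: heis (-2) (ebasis 0))
  heisN1_ebasis0).
Qed.

(** The lowest power of x in Y(e^-gamma, x) e^gamma is minus the norm of gamma, and there both
    exponential factors contribute their constant terms. *)
Lemma exp_product : YVLt (ebasis (- D%:Z)) (- D%:R) (ebasis D%:Z) = ebasis 0.
Proof.
apply: etrans (YVLt_basis _ _ _) _.
rewrite enum_mset0; apply: etrans (linext_basis _ _) _.
have D0 : D%:R != 0 :> rat by rewrite pnatr_eq0; lia.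
have Dq : (- D%:Z * D%:Z)%:~R / D%:R = - D%:R :> rat.
  by rewrite intrM rmorphN /= -!pmulrn mulNr mulNr mulfK.
have t ab : Eminus p q (- D%:Z) ab.1 (shift (- D%:Z) (Eplus p q (- D%:Z) ab.2 (ebasis D%:Z))) =
    if ab.2 == 0%N then Eminus p q (- D%:Z) ab.1 (ebasis 0) else 0.
  rewrite Eplus_vacuum; case: eqP => _.
    congr (Eminus _ _ _ _ _); apply: etrans (linext_basis _ _) _; by rewrite addrN.
  rewrite (lin0 (linext_linear _ : linear (shift (- D%:Z)))).
  apply: etrans (expcoef_vanishing _ _ _) _; last by rewrite if_same.
    by move=> m; exact: heisl_linear.
  by move=> m _; exact: (lin0 (heisl_linear (m%:R)^-1 (- D%:Z) (- m%:Z))).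
rewrite (fsum_set_at (i0 := (0, 0)%N)) => [|[a b] /= h ne].
  rewrite ifT; last first.
    by apply/mem_set; rewrite /= addr0 subr0.
  by apply: etrans (t (0, 0)%N) _; rewrite Eminus_0.
apply: etrans (t (a, b)) _; rewrite /=; case: eqP => // b0; exfalso.
move: h; rewrite b0 subr0 Dq => /eqP.
rewrite -subr_eq0 opprK addrAC addNr add0r pnatr_eq0 => /eqP a0.
by move: ne; rewrite a0 b0 eqxx.
Qed.

(** * Passage from V_L~ to the cosets *)

Lemma to_coset_val k (v : VLt) : v \in in_coset k -> val (to_coset k v) = v.
Proof. by move=> h; rewrite /to_coset insubdK. Qed.

Lemma to_coset_lin2 k a b (x y : VLt) : x \in in_coset k -> y \in in_coset k ->
  to_coset k (a *: x + b *: y) = a *: to_coset k x + b *: to_coset k y.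
Proof.
move=> hx hy; have hz : a *: x + b *: y \in in_coset k.
  apply: rpredD; exact: rpredZ.
apply: val_inj.
apply: etrans (to_coset_val hz) _.
apply: etrans _ (esym (lin2 _ _ _ _ (linearP (val : Vcoset R p q k -> VLt)))).
exact: (f_equal2 (fun x y => a *: x + b *: y) (esym (to_coset_val hx)) (esym (to_coset_val hy))).
Qed.

Lemma to_coset_scale k a (x : VLt) : x \in in_coset k ->
  to_coset k (a *: x) = a *: to_coset k x.
Proof.
move=> hx; have := @to_coset_lin2 k a 0 x x hx hx.
by rewrite !scale0r !addr0.
Qed.

Lemma to_coset0 k : to_coset k 0 = 0.
Proof. by apply: val_inj; rewrite to_coset_val ?rpred0 // raddf0. Qed.

Lemma Yc_to_coset k1 k2 k3 (v w : VLt) n : v \in in_coset k1 -> w \in in_coset k2 ->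
  Yc k3 (to_coset k1 v) n (to_coset k2 w) = to_coset k3 (YVLt v (- n%:~R - 1) w).
Proof. by move=> hv hw; rewrite /Yc !to_coset_val. Qed.

Lemma Yc_0l k1 k2 k3 n (w : Vcoset R p q k2) : Yc k3 (0 : Vcoset R p q k1) n w = 0.
Proof.
rewrite /Yc raddf0; apply: etrans (to_coset0 k3); congr (to_coset k3 _).
exact: lin0 (YVLt_linear _ _).
Qed.

(** Linearity in the last argument would need finiteness of the sums over j; at 0 every term
    vanishes. *)
Lemma Ymono_0 l ms s : Ymono l ms s 0 = 0.
Proof.
elim: ms s => [|i ms IH] s; first exact: lin0 (linext_linear _).
apply: etrans (Ymono_cons l i ms s 0) _.
have t1 (j : nat) : 'C(i + j, i)%:R *: heis (- (i + j).+1%:Z) (Ymono l ms (s - j%:R) 0) = 0.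
  by rewrite IH heis_0 scaler0.
have t2 (j : nat) : ((-1) ^+ i * 'C(i + j, i)%:R) *:
    Ymono l ms (s + (i + j).+1%:R) (heis j%:Z 0) = 0.
  by rewrite heis_0 IH scaler0.
exact: etrans (f_equal2 +%R (fsum_0 t1) (fsum_0 t2)) (addr0 _).
Qed.

Lemma Yc_0r k1 k2 k3 n (v : Vcoset R p q k1) : Yc k3 v n (0 : Vcoset R p q k2) = 0.
Proof.
rewrite /Yc raddf0; apply: etrans (to_coset0 k3); congr (to_coset k3 _).
by rewrite /YVLt big1 // => K _; rewrite Ymono_0 scaler0.
Qed.

Definition evec (k l : int) : Vcoset R p q k := to_coset k (ebasis l).
Definition gammaL : VL R p q := to_coset 0 gammav.

Lemma in_coset_ebasis k l : (l = k %[mod D])%Z -> ebasis l \in in_coset k.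
Proof. exact: in_coset_basis. Qed.

Lemma in_coset_gammav : gammav \in in_coset 0.
Proof. exact: in_coset_basis. Qed.

Lemma in_coset_heisN_ebasis i k l : (l = k %[mod D])%Z ->
  heis (Negz i) (ebasis l) \in in_coset k.
Proof. by move=> h; rewrite (heisN_basis i mset0 l); exact: in_coset_basis. Qed.

Lemma in_coset_heisN1_gammav : heis (-1) gammav \in in_coset 0.
Proof.
rewrite (heisN_basis 0 _ 0 : heis (-1) gammav = _).
exact: in_coset_basis.
Qed.

Lemma in_coset_omegav : omegav \in in_coset 0.
Proof.
rewrite omegavE; apply: rpredD; apply: rpredZ; first exact: in_coset_heisN1_gammav.
exact: (@in_coset_heisN_ebasis 1).
Qed.

Lemma mode1 : - (1 : int)%:~R - 1 = - 2%:R :> rat.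
Proof. by rewrite -opprD. Qed.

Lemma modDD : (D%:Z = 0 %[mod D])%Z.
Proof. by rewrite modzz mod0z. Qed.

Lemma Yc_gammaL_evec (n : nat) : Yc 0 gammaL n%:Z (evec 0 D) =
  if n == 0%N then D%:R *: evec 0 D else 0.
Proof.
apply: etrans (Yc_to_coset _ _ in_coset_gammav (in_coset_ebasis modDD)) _.
rewrite YVLt_gammav // heis_ebasis; case: ifP => _; last exact: to_coset0.
exact: (to_coset_scale _ (in_coset_ebasis modDD)).
Qed.

Lemma Yc_omegaL0_evec : Yc 0 omegaL 0 (evec 0 D) = Yc 0 gammaL (-1) (evec 0 D).
Proof.
apply: etrans (Yc_to_coset _ _ in_coset_omegav (in_coset_ebasis modDD)) _.
apply: etrans _ (esym (Yc_to_coset _ _ in_coset_gammav (in_coset_ebasis modDD))).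
apply: (f_equal (to_coset 0)).
have e : - (0 : int)%:~R - 1 = -1 :> rat by rewrite mulr0z oppr0 add0r.
apply: etrans (f_equal (fun s => YVLt omegav s (ebasis D)) e) _.
apply: etrans (omegav0_ebasis _) _.
apply: etrans _ (esym (YVLt_gammav _ _)).
rewrite (_ : 2%:R * _ * al = 1); first exact: scale1r.
rewrite -pmulrn -natrM (_ : (2 * D = 4 * p * q)%N); last by ring.
by rewrite mulfV // pnatr_eq0; lia.
Qed.

Lemma Yc_exp_product : Yc 0 (evec 0 (- D%:Z)) (D%:Z - 1) (evec 0 D) = vacL.
Proof.
have mN : (- D%:Z = 0 %[mod D])%Z by rewrite -mulN1r modzMl mod0z.
apply: etrans (Yc_to_coset _ _ (in_coset_ebasis mN) (in_coset_ebasis modDD)) _.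
apply: (f_equal (to_coset 0)).
(* Mode 2pq - 1 is the coefficient of x^-2pq. *)
have e : - (D%:Z - 1)%:~R - 1 = - D%:R :> rat by rewrite rmorphB /= -pmulrn; ring.
apply: etrans (f_equal (fun s => YVLt _ s _) e) _.
exact: exp_product.
Qed.

Lemma omegaLE : omegaL = al *: Yc 0 gammaL (-1) gammaL + be *: Yc 0 gammaL (-2) vacL.
Proof.
have e0 : (0 = 0 %[mod D])%Z by [].
have e1 : Yc 0 gammaL (-1) gammaL = to_coset 0 (heis (-1) gammav).
  apply: etrans (Yc_to_coset _ _ in_coset_gammav in_coset_gammav) _.
  exact: (f_equal (to_coset 0) (YVLt_gammav _ _)).
have e2 : Yc 0 gammaL (-2) vacL = to_coset 0 (heis (-2) (ebasis 0)).
  apply: etrans (Yc_to_coset _ _ in_coset_gammav (in_coset_ebasis e0)) _.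
  exact: (f_equal (to_coset 0) (YVLt_gammav _ _)).
rewrite e1 e2; apply: etrans (f_equal (to_coset 0) omegavE) _.
exact: (to_coset_lin2 _ _ in_coset_heisN1_gammav (in_coset_heisN_ebasis 1 e0)).
Qed.

Lemma Yc_omegaL_gammaL : Yc 0 omegaL 1 gammaL = gammaL.
Proof.
apply: etrans (Yc_to_coset _ _ in_coset_omegav in_coset_gammav) _.
apply: (f_equal (to_coset 0)).
apply: etrans (f_equal (fun s => YVLt _ s _) mode1) _.
exact: omegav_gammav.
Qed.

Lemma Yc_omegaL1_evec k l : (l = k %[mod D])%Z ->
  Yc k omegaL 1 (evec k l) = (al * l%:~R ^+ 2 - be * l%:~R) *: evec k l.
Proof.
move=> h; apply: etrans (Yc_to_coset _ _ in_coset_omegav (in_coset_ebasis h)) _.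
apply: etrans (f_equal (fun s => to_coset k (YVLt _ s _)) mode1) _.
apply: etrans (f_equal (to_coset k) (omegav1_ebasis _)) _.
exact: (to_coset_scale _ (in_coset_ebasis h)).
Qed.

Lemma Yc_omegaLS_evec k l (n : nat) : (l = k %[mod D])%Z -> (2 <= n)%N ->
  Yc k omegaL n%:Z (evec k l) = 0.
Proof.
case: n => [|[|n]] // h _.
apply: etrans (Yc_to_coset _ _ in_coset_omegav (in_coset_ebasis h)) _.
exact: etrans (f_equal (to_coset k) (omegavS_ebasis n l)) (to_coset0 k).
Qed.

End LatticeModes.

(** * The extensions of the lattice vertex algebra *)

Section Extension.
Variables (R : realType) (p q : nat).
Hypotheses (p_gt0 : (0 < p)%N) (q_gt0 : (0 < q)%N).
Local Notation C := R[i].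
Local Notation D := (2 * p * q)%N.
Local Notation VL := (VL R p q).
Local Notation Yc := (@Yc R p q).
#[local] Opaque linext.
Variables (V : voaData R) (inj : VL -> V) (u : V).
Hypotheses (injL : linear inj)
  (inj_mode : forall a n b, vmode (inj a) n (inj b) = inj (Yc 0 a n b))
  (inj_vac : vvac V = inj (vacL R p q)) (inj_omega : vomega V = inj (omegaL R p q))
  (sq0 : forall i j n v v', vmode (vmode u i v) n (vmode u j v') = 0)
  (u_wt : vmode (vomega V) 1 u = u)
  (u_primary : forall n : nat, (2 <= n)%N -> vmode (vomega V) n%:Z u = 0).

Lemma twisted_module_of_extension (W : lmodType C) (YW : V -> int -> W -> W)
    (Wg : C -> C -> set W) :
  strongly_graded_module (geneig (vmode u 0)) YW Wg -> graded_by_geneig Wg (YW u 0) ->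
  twisted_module (geneig (vmode u 0)) (exp2pii (vmode u 0)) (jointgrading u YW)
    (twistY u YW) (exp2pii (YW u 0)).
Proof.
move=> MW gW.
have alC : (((4 * p * q)%N%:R^-1 : R)%:C)%C = (4 * p * q)%N%:R^-1 by rewrite fmorphV rmorph_nat.
have beC : (((p%:R - q%:R) / D%:R : R)%:C)%C = (p%:R - q%:R) / D%:R.
  by rewrite rmorphM fmorphV !rmorph_nat rmorphB !rmorph_nat.
(* The data for the weight bound all come from V_L: gamma(-1)1, e^gamma, e^-gamma, the coefficients
   of omega, the weight of e^gamma and its norm 2pq. *)
apply: (@twisted_module_of_square_zero R V u sq0 u_wt u_primary W YW Wg MW gW
  (inj (gammaL R p q)) (inj (evec R p q 0 D%:Z)) (inj (evec R p q 0 (- D%:Z)))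
  ((4 * p * q)%N%:R^-1) ((p%:R - q%:R) / D%:R)
  ((4 * p * q)%N%:R^-1 * D%:R ^+ 2 - (p%:R - q%:R) / D%:R * D%:R) D).
- by rewrite invr_gt0 ltr0n; lia.
- move=> n; rewrite inj_mode Yc_gammaL_evec //; case: ifP => _; last exact: lin0.
  exact: linZ.
- by rewrite inj_omega !inj_mode Yc_omegaL0_evec.
- by exists (D%:Z - 1); rewrite inj_mode Yc_exp_product.
- rewrite inj_omega inj_vac !inj_mode -!(linZ injL) -(linD injL); congr inj.
  apply: etrans (omegaLE R p q) _.
  by rewrite alC beC.
- apply: etrans _ (esym (scale1r _)); rewrite inj_omega; apply: etrans (inj_mode _ _ _) _.
  exact: (f_equal inj (Yc_omegaL_gammaL R p_gt0 q_gt0)).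
apply: etrans (f_equal (fun o => vmode o 1 _) inj_omega) _.
apply: etrans (inj_mode _ _ _) _.
apply: etrans (f_equal inj (Yc_omegaL1_evec R (modDD p q))) _.
apply: etrans (linZ injL _ _) _; apply: (f_equal (fun c : C => c *: _)).
rewrite -pmulrn -alC -beC (_ : D%:R = (D%:R : R)%:C%C :> C); last by rewrite rmorph_nat.
by rewrite -rmorphXn -!rmorphM -rmorphB.
Qed.

End Extension.

Section Extensions.
Variables (R : realType) (p q : nat).
Hypotheses (p_gt0 : (0 < p)%N) (q_gt0 : (0 < q)%N).
Local Notation C := R[i].
Local Notation VL := (VL R p q).
Local Notation Vpq := (Vpq R p q).
Local Notation kp := (kp q).
Local Notation kq := (kq p).
Local Notation Yc := (@Yc R p q).
Local Notation omegaL := (omegaL R p q).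
Local Notation Y0l := (@Yc_0l R p q).
Local Notation Y0r := (@Yc_0r R p q).

#[local] Opaque linext.

Lemma add_eq0 (U : zmodType) (x y : U) : x = 0 -> y = 0 -> x + y = 0.
Proof. by move=> -> ->; rewrite addr0. Qed.

Lemma add_eqr (U : zmodType) (x y z : U) : x = 0 -> y = z -> x + y = z.
Proof. by move=> -> ->; rewrite add0r. Qed.

Lemma scale0_add0 (U : lmodType C) c : c *: 0 + 0 = 0 :> U.
Proof. by rewrite scaler0 addr0. Qed.

Lemma Yc_0l_0r k n (a b : VL) :
  Yc k (0 : Vcoset R p q k) n b + Yc k a n (0 : Vcoset R p q k) = 0.
Proof. by apply: add_eq0; [exact: Y0l|exact: Y0r]. Qed.

Lemma Yc_0r_0l k n (a b : Vcoset R p q k) : Yc k a n (0 : VL) + Yc k (0 : VL) n b = 0.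
Proof. by apply: add_eq0; [exact: Y0r|exact: Y0l]. Qed.

(** The left side is the weight of e^(k gamma/(2pq)) for k = -2q, that is, of e^(-gamma/p). *)
Lemma kp_weight : (4 * p * q)%N%:R^-1 * kp%:~R ^+ 2
  - (p%:R - q%:R) / (2 * p * q)%N%:R * kp%:~R = 1 :> C.
Proof.
have p0 : p%:R != 0 :> C by rewrite pnatr_eq0; lia.
have q0 : q%:R != 0 :> C by rewrite pnatr_eq0; lia.
rewrite /kp rmorphN /= -pmulrn !natrM; field.
by rewrite p0 q0.
Qed.

Lemma kq_weight : (4 * p * q)%N%:R^-1 * kq%:~R ^+ 2
  - (p%:R - q%:R) / (2 * p * q)%N%:R * kq%:~R = 1 :> C.
Proof.
have p0 : p%:R != 0 :> C by rewrite pnatr_eq0; lia.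
have q0 : q%:R != 0 :> C by rewrite pnatr_eq0; lia.
rewrite /kq -pmulrn !natrM; field.
by rewrite p0 q0.
Qed.

Lemma omegaL1_evec k : (4 * p * q)%N%:R^-1 * k%:~R ^+ 2
    - (p%:R - q%:R) / (2 * p * q)%N%:R * k%:~R = 1 :> C ->
  Yc k omegaL 1 (evec R p q k k) = evec R p q k k.
Proof.
move=> h; apply: etrans (Yc_omegaL1_evec R (erefl _)) _.
by rewrite h; exact: scale1r.
Qed.

Section OneModule.
Variable k : int.
Hypothesis k_weight : (4 * p * q)%N%:R^-1 * k%:~R ^+ 2
  - (p%:R - q%:R) / (2 * p * q)%N%:R * k%:~R = 1 :> C.

(* V0 and V0o, for k = kp and k = kq *)
Definition oneV : voaData R := @VoaData R (VL * Vcoset R p q k)%type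
  (fun a n b => (Yc 0 a.1 n b.1, Yc k a.2 n b.1 + Yc k a.1 n b.2))
  (vacL R p q, 0) (omegaL, 0).

Definition oneu : oneV := (0, evec R p q k k).

(** All modes of u land in the second summand, so this supplies the square-zero hypothesis. *)
Lemma oneV_square_zero (a b : oneV) n : a.1 = 0 -> b.1 = 0 -> vmode a n b = 0.
Proof.
case: a b => [a1 a2] [b1 b2] /= -> ->.
apply: (@f_equal2 _ _ _ pair _ 0 _ 0); [exact: Y0l|exact: Yc_0r_0l].
Qed.

Lemma twisted_module_one (W : lmodType C) (YW : oneV -> int -> W -> W)
    (Wg : C -> C -> set W) :
  strongly_graded_module (geneig (vmode oneu 0)) YW Wg ->
  graded_by_geneig Wg (YW oneu 0) ->
  twisted_module (geneig (vmode oneu 0)) (exp2pii (vmode oneu 0))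
    (jointgrading oneu YW) (twistY oneu YW) (exp2pii (YW oneu 0)).
Proof.
apply: (@twisted_module_of_extension R p q p_gt0 q_gt0 oneV (fun a => (a, 0)) oneu).
- move=> c x y; exact: (f_equal (pair _) (esym (scale0_add0 _ _))).
- move=> a n b; exact: (f_equal (pair (Yc 0 a n b)) (Yc_0l_0r _ _ _ _)).
- by [].
- by [].
- by move=> i j n v v'; apply: oneV_square_zero; exact: Yc_0l.
- exact: (f_equal2 pair (Yc_0r _ _ _ _) (add_eqr (Yc_0l _ _ _ _) (omegaL1_evec k_weight))).
move=> n n2; apply: (f_equal2 pair (Yc_0r _ _ _ _) (add_eq0 (Yc_0l _ _ _ _) _)).
exact: (Yc_omegaLS_evec R (erefl _) n2).
Qed.

End OneModule.

Definition injVpq (a : VL) : Vpq := (a, 0, 0).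

Lemma injVpq_linear : linear injVpq.
Proof.
move=> c x y; exact: (f_equal2 (fun x y => (_, x, y)) (esym (scale0_add0 _ _))
  (esym (scale0_add0 _ _))).
Qed.

Lemma injVpq_mode a n b : vmode (injVpq a) n (injVpq b) = injVpq (Yc 0 a n b).
Proof.
exact: (f_equal2 (fun x y => (_, x, y)) (Yc_0l_0r _ _ _ _)
  (Yc_0l_0r _ _ _ _)).
Qed.

Lemma Vpq_square_zero (a b : Vpq) n : a.1.1 = 0 -> b.1.1 = 0 -> vmode a n b = 0.
Proof.
case: a b => [[a1 a2] a3] [[b1 b2] b3] /= -> ->.
apply: (@f_equal2 _ _ _ pair _ 0 _ 0); last exact: Yc_0r_0l.
by apply: (@f_equal2 _ _ _ pair _ 0 _ 0); [exact: Y0l|exact: Yc_0r_0l].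
Qed.

End Extensions.

Theorem theorem5p8 (R : realType) (p q : nat)
    (p_gt0 : (0 < p)%N) (q_gt0 : (0 < q)%N) (pq_coprime : coprime p q) :
  (forall (W : lmodType R[i]) (YW : V0 R p q -> int -> W -> W)
          (Wg : R[i] -> R[i] -> set W),
     strongly_graded_module (geneig (vmode (u0 R p q) 0)) YW Wg ->
     graded_by_geneig Wg (YW (u0 R p q) 0) ->
     twisted_module (geneig (vmode (u0 R p q) 0))
       (exp2pii (@Qtilde_V0 R p q))
       (jointgrading (u0 R p q) YW) (twistY (u0 R p q) YW)
       (exp2pii (YW (u0 R p q) 0)))
  /\
  (forall (W : lmodType R[i]) (YW : V0o R p q -> int -> W -> W)
          (Wg : R[i] -> R[i] -> set W),
     strongly_graded_module (geneig (vmode (u0o R p q) 0)) YW Wg ->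
     graded_by_geneig Wg (YW (u0o R p q) 0) ->
     twisted_module (geneig (vmode (u0o R p q) 0))
       (exp2pii (@Q_V0o R p q))
       (jointgrading (u0o R p q) YW) (twistY (u0o R p q) YW)
       (exp2pii (YW (u0o R p q) 0)))
  /\
  (forall (W : lmodType R[i]) (YW : Vpq R p q -> int -> W -> W)
          (Wg : R[i] -> R[i] -> set W),
     strongly_graded_module (geneig (vmode (upq_p R p q) 0)) YW Wg ->
     graded_by_geneig Wg (YW (upq_p R p q) 0) ->
     twisted_module (geneig (vmode (upq_p R p q) 0))
       (exp2pii (@Qtilde R p q))
       (jointgrading (upq_p R p q) YW) (twistY (upq_p R p q) YW)
       (exp2pii (YW (upq_p R p q) 0)))
  /\
  (forall (W : lmodType R[i]) (YW : Vpq R p q -> int -> W -> W)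
          (Wg : R[i] -> R[i] -> set W),
     strongly_graded_module (geneig (vmode (upq_q R p q) 0)) YW Wg ->
     graded_by_geneig Wg (YW (upq_q R p q) 0) ->
     twisted_module (geneig (vmode (upq_q R p q) 0))
       (exp2pii (@Q R p q))
       (jointgrading (upq_q R p q) YW) (twistY (upq_q R p q) YW)
       (exp2pii (YW (upq_q R p q) 0))).
Proof.
split; [|split; [|split]].
(* [V0] is [oneV] for k = [kp], and the restricted screening operator [Qtilde_V0] unfolds to the
   zero mode of u there. *)
- exact: (twisted_module_one p_gt0 q_gt0 (kp_weight R p_gt0 q_gt0)).
- exact: (twisted_module_one p_gt0 q_gt0 (kq_weight R p_gt0 q_gt0)).
- apply: (@twisted_module_of_extension R p q p_gt0 q_gt0 _ (@injVpq R p q) (upq_p R p q)).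
  + exact: injVpq_linear.
  + exact: injVpq_mode.
  + by [].
  + by [].
  + by move=> i j n v v'; apply: Vpq_square_zero; exact: Yc_0l.
  + exact: (f_equal2 pair (f_equal2 pair (Yc_0r _ _ _ _)
      (add_eqr (Yc_0l _ _ _ _) (omegaL1_evec (kp_weight R p_gt0 q_gt0))))
      (add_eq0 (Yc_0l _ _ _ _) (Yc_0r _ _ _ _))).
  move=> n n2.
  exact: (f_equal2 pair (f_equal2 pair (Yc_0r _ _ _ _)
      (add_eq0 (Yc_0l _ _ _ _) (Yc_omegaLS_evec R (erefl _) n2)))
      (add_eq0 (Yc_0l _ _ _ _) (Yc_0r _ _ _ _))).
apply: (@twisted_module_of_extension R p q p_gt0 q_gt0 _ (@injVpq R p q) (upq_q R p q)).
- exact: injVpq_linear.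
- exact: injVpq_mode.
- by [].
- by [].
- by move=> i j n v v'; apply: Vpq_square_zero; exact: Yc_0l.
- exact: (f_equal2 pair (f_equal2 pair (Yc_0r _ _ _ _)
    (add_eq0 (Yc_0l _ _ _ _) (Yc_0r _ _ _ _)))
    (add_eqr (Yc_0l _ _ _ _) (omegaL1_evec (kq_weight R p_gt0 q_gt0)))).
move=> n n2.
exact: (f_equal2 pair (f_equal2 pair (Yc_0r _ _ _ _)
    (add_eq0 (Yc_0l _ _ _ _) (Yc_0r _ _ _ _)))
    (add_eq0 (Yc_0l _ _ _ _) (Yc_omegaLS_evec R (erefl _) n2))).
Qed.
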